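(* Assume the Markov semigroup $(P_t)$ on the Polish space $(E,\rho)$ is Feller, and that: (1) there exist a measurable $V:E\to[0,\infty)$, a concave differentiable function $\phi:\mathbb R_+\to\mathbb R_+$ increasing to infinity with $\phi(0)=0$, and a constant $K>0$ such that $P_tV(x)\le V(x)-\int_0^tP_s(\phi\circ V)(x)\,ds+Kt$ for all $t\ge0$, $x\in E$; (2) $\rho\wedge1\le\theta$ for a premetric $\theta$; (3) Assumption A holds (with this $\theta$) for some functions $r,L$; (4) there exists $t_0>0$ such that for any $M>0$, Assumption B1 holds for $B=\{V\le M\}$ and $t_0$. Then $(P_t)$ has a unique invariant probability measure $\pi$, and for any $\delta\in(0,1)$ there exist constants $C_1,C_2>0$ such that for all $x\in E$ and $t\ge0$, $$W_{\rho\wedge1}(P_t(x,\cdot),\pi)\le\frac{C_1(1+\phi(V(x))^\delta)}{\phi(H_\phi^{-1}(C_2t))^\delta},$$ where $H_\phi(x):=\int_1^x\frac{du}{\phi(u)}$, $x\ge1$.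
   Context: $(E,\rho)$ is a Polish space with Borel $\sigma$-field $\mathcal E$; $\{P_t\}_{t\ge0}$ is a Markov transition function with semigroup $P_t\phi(x)=\int\phi(y)P_t(x,dy)$ and $\mathbb P_x$ the law of the corresponding Markov process started at $x$. Feller means $P_t$ maps bounded continuous functions to bounded continuous functions. A premetric is a lower semicontinuous $\theta:E\times E\to\mathbb R_+$ with $\theta(x,y)=0\iff x=y$. For a distance-like (symmetric, lower semicontinuous, vanishing exactly on the diagonal) or metric $d$, $W_d(\mu,\nu):=\inf\int d\,d\lambda$ over couplings $\lambda$ of $\mu,\nu$; $d_{TV}(\mu,\nu)=\sup_A|\mu(A)-\nu(A)|$. Assumption A: there exist a non-increasing $r:\mathbb R_+\to\mathbb R_+$ with $r(t)\to0$ and a locally bounded $L:\mathbb R_+\to\mathbb R_+$ such that for any $x,y\in E$ there exist random processes $X^{x,y},Y^{x,y}$ on a common probability space with (1) $\mathrm{Law}(X^{x,y})=\mathbb P_x$ and $d_{TV}(\mathrm{Law}(Y^{x,y}_t),P_t(y,\cdot))\le L(t)\theta(x,y)$, $t\ge0$; (2) $\mathbb E\theta(X^{x,y}_t,Y^{x,y}_t)\le r(t)\theta(x,y)$, $t\ge0$. Assumption B1 (for a set $B$ and $t_0>0$): for any $\varepsilon>0$ there is a measurable $D$ with $\inf_{x\in B}P_{t_0}(x,D)>0$ and $\sup_{x,y\in D}\theta(x,y)\le\varepsilon$. *)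

(* Defs.v *)
From HB Require Import structures.
From mathcomp Require Import all_boot all_order all_algebra.
From mathcomp Require Import all_classical all_reals all_analysis measurable_realfun.
Set Implicit Arguments. Unset Strict Implicit. Unset Printing Implicit Defensive.
Import Order.TTheory GRing.Theory Num.Theory.
Import numFieldNormedType.Exports.
Local Open Scope classical_set_scope.
Local Open Scope ring_scope.

Section Defs.
Context {R : realType} {d : measure_display} {E : measurableType d}.

Definition is_metric (rho : E -> E -> R) : Prop :=
  [/\ (forall x y, 0 <= rho x y), (forall x y, rho x y = 0 <-> x = y),
      (forall x y, rho x y = rho y x) &
      (forall x y z, rho x z <= rho x y + rho y z)].

Definition rho_open (rho : E -> E -> R) (A : set E) : Prop :=
  forall x, A x -> exists2 e : R, 0 < e & forall y, rho x y < e -> A y.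

Definition rho_cauchy (rho : E -> E -> R) (u : nat -> E) : Prop :=
  forall e : R, 0 < e -> exists N : nat, forall m n : nat,
    (N <= m)%N -> (N <= n)%N -> rho (u m) (u n) < e.

Definition rho_cvg (rho : E -> E -> R) (u : nat -> E) (l : E) : Prop :=
  forall e : R, 0 < e -> exists N : nat, forall n : nat, (N <= n)%N -> rho (u n) l < e.

Definition polish_borel (rho : E -> E -> R) : Prop :=
  [/\ is_metric rho,
      (forall u, rho_cauchy rho u -> exists l, rho_cvg rho u l),
      (exists D : set E, countable D /\
         forall x (e : R), 0 < e -> exists2 y, D y & rho x y < e) &
      (@measurable d E = <<s rho_open rho >>)].

Definition rho_continuous (rho : E -> E -> R) (f : E -> R) : Prop :=
  forall x (e : R), 0 < e -> exists2 del : R, 0 < del &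
    forall y, rho x y < del -> `|f x - f y| < e.

Definition rho_lsc2 (rho : E -> E -> R) (th : E -> E -> R) : Prop :=
  forall x y (e : R), 0 < e -> exists2 del : R, 0 < del &
    forall x' y', rho x x' < del -> rho y y' < del -> th x y - e < th x' y'.

Definition premetric (rho : E -> E -> R) (th : E -> E -> R) : Prop :=
  [/\ rho_lsc2 rho th, (forall x y, 0 <= th x y) & (forall x y, th x y = 0 <-> x = y)].

Definition markov_tf (P : R -> E -> probability E R) : Prop :=
  [/\ (forall t A, 0 <= t -> measurable A -> measurable_fun [set: E] ((fun x => P t x A) : E -> \bar R)),
      (forall x A, measurable A -> P 0 x A = \d_x A) &
      (forall s t x A, 0 <= s -> 0 <= t -> measurable A ->
          P (s + t) x A = (\int[P s x]_y P t y A)%E)].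

Definition feller (rho : E -> E -> R) (P : R -> E -> probability E R) : Prop :=
  forall t (f : E -> R), 0 <= t -> rho_continuous rho f ->
    (exists M : R, forall x, `|f x| <= M) ->
    rho_continuous rho (fun x => Rintegral (P t x) setT f) /\
    (exists M : R, forall x, `|Rintegral (P t x) setT f| <= M).

Definition invariant_prob (P : R -> E -> probability E R) (mu : probability E R) : Prop :=
  forall t A, 0 <= t -> measurable A -> (\int[mu]_x P t x A)%E = mu A.

Definition dTV (mu nu : set E -> \bar R) : \bar R :=
  ereal_sup [set (`|mu A - nu A|)%E | A in [set A | measurable A]].

Definition is_coupling (mu nu : probability E R)
    (lam : probability (E * E)%type R) : Prop :=
  forall A, measurable A -> lam (A `*` setT) = mu A /\ lam (setT `*` A) = nu A.

Definition wasserstein (c : E -> E -> R) (mu nu : probability E R) : \bar R :=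
  ereal_inf [set (\int[lam]_z (c z.1 z.2)%:E)%E
            | lam in [set lam | is_coupling mu nu lam]].

(** finite-dimensional distributions of the Markov process started at x:
    a list [(s1,A1);...;(sn,An)] of time increments and sets encodes the
    event {X_{t1} in A1, ..., X_{tn} in An} with t_k = s1 + ... + sk. *)
Fixpoint mfdd (P : R -> E -> probability E R) (x : E) (l : seq (R * set E)) : \bar R :=
  match l with
  | [::] => 1%E
  | (s, A) :: l' => (\int[P s x]_(y in A) mfdd P y l')%E
  end.

Fixpoint mevent {dO} {Om : measurableType dO} (X : R -> Om -> E) (t0 : R)
    (l : seq (R * set E)) : set Om :=
  match l with
  | [::] => setT
  | (s, A) :: l' => X (t0 + s) @^-1` A `&` mevent X (t0 + s) l'
  end.

Fixpoint adm_list (l : seq (R * set E)) : Prop :=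
  match l with
  | [::] => True
  | (s, A) :: l' => 0 <= s /\ measurable A /\ adm_list l'
  end.

(** Law(X) = P_x : X is a Markov process with transition function P started at x
    (law on path space determined by finite-dimensional distributions) *)
Definition markov_law (P : R -> E -> probability E R) (x : E)
    {dO} {Om : measurableType dO} (Pr : probability Om R) (X : R -> Om -> E) : Prop :=
  (forall t, 0 <= t -> measurable_fun setT (X t)) /\
  (forall l, adm_list l -> Pr (mevent X 0 l) = mfdd P x l).

Definition assumptionA (P : R -> E -> probability E R) (theta : E -> E -> R)
    (r L : R -> R) : Prop :=
  [/\ (forall t, 0 <= t -> 0 <= r t) /\ (forall s t, 0 <= s -> s <= t -> r t <= r s),
      r t @[t --> +oo] --> 0,
      (forall t, 0 <= t -> 0 <= L t) /\
        (forall T, exists M : R, forall t, 0 <= t <= T -> L t <= M) &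
      forall x y, exists (dO : measure_display) (Om : measurableType dO)
        (Pr : probability Om R) (X Y : R -> Om -> E),
        [/\ markov_law P x Pr X,
            (forall t, 0 <= t -> measurable_fun setT (Y t)),
            (forall t, 0 <= t ->
               (dTV (fun A => Pr (Y t @^-1` A)) (P t y) <= (L t * theta x y)%:E)%E) &
            (forall t, 0 <= t ->
               (\int[Pr]_w (theta (X t w) (Y t w))%:E <= (r t * theta x y)%:E)%E)]].

Definition assumptionB1 (P : R -> E -> probability E R) (theta : E -> E -> R)
    (B : set E) (t0 : R) : Prop :=
  forall eps : R, 0 < eps -> exists D : set E,
    [/\ measurable D,
        (exists2 c : R, 0 < c & forall x, B x -> (c%:E <= P t0 x D)%E) &
        (forall x y, D x -> D y -> theta x y <= eps)].

Definition Hphi (phi : R -> R) (x : R) : \bar R :=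
  (\int[@lebesgue_measure R]_(u in [set u : R | (1 <= u <= x)%R]) ((phi u)^-1)%:E)%E.

End Defs.

(* Main.v *)
Require Import Defs.
From HB Require Import structures.
From mathcomp Require Import all_boot all_order all_algebra.
From mathcomp Require Import all_classical all_reals all_analysis measurable_realfun.
From mathcomp Require Import ring lra.
Import Order.TTheory GRing.Theory Num.Theory.
Import numFieldNormedType.Exports.
Local Open Scope classical_set_scope.
Local Open Scope ring_scope.

(* All estimates are made on the dual side, for functions [f] that are Lipschitz for the
   distance-like function [d = min(N theta, 1)]. Writing [Q = P_h], Assumption A shows that
   [Q f] is [d / 2]-Lipschitz where [d < 1], B1 that the oscillation of [Q f] shrinks by a fixed
   factor on level sets of [V], and both survive when an unbounded error [s + q (W x + W y)] is
   added to the Lipschitz bound (truncate [f], and push the error through [Q]). A jointly concave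
   bound [Psi(d, w)], [w = 1 + W x + W y], is an infimum of such affine bounds, so it is propagated
   to [Psi(kappa d, Q w)]. We take [Psi = d^(1 - delta) B_k(w)^delta], where [B_k] is built from the
   iterates of [F w = w + eta phi(w)], a discrete version of [H_phi^-1(H_phi(w) + eta k)]; a second
   pass with [F^k(w)] alone replaces the weight [w^delta] by [phi(w)^delta].
   Cesaro averages along the chain make [P_t(x, .)] Cauchy for bounded Lipschitz functions; the
   limit functional is represented by a measure through Daniell's outer measure, tightness coming
   from completeness and separability. Finally the dual bound is turned into couplings by
   Kantorovich duality on finite partitions, which is an instance of Farkas' lemma. *)

(** * Concave functions and the discrete flow *)

Section Concave.
Context {R : realType}.
Implicit Types f : R -> R.

(** Functions are iterated instead of couplings because Assumption A supplies a coupling for each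
    pair of points separately, with no measurable dependence on the pair and only one exact
    marginal; such couplings cannot be composed in time. The second marginal is off by [L t * theta]
    in total variation, which need not become small. Multiplying [theta] by a large [N] makes this
    error small relative to [N * theta], whence the condition [N * r h + 2 * L h <= N / 2]. The step
    [h = t0 + Tt] has two stages: after time [t0] both chains charge a common set of small
    [theta]-diameter, and after a further time [Tt] this smallness has become a small oscillation.
    Times that are not multiples of [2 * h] are absorbed at the start: for a remainder [s <= 2 * h]
    and [f] Lipschitz for [rho1], [Op s f] is already Lipschitz for the truncated [dd]. A concave
    [phi] may have infinite slope at [0]; it is replaced by its minimum with the line [phi 1 * u],
    which agrees with [phi] on [[1, +oo)], and the summand [1] keeps the weight in that region. *)

Definition concave0 f : Prop := forall a b l : R, 0 <= a -> 0 <= b -> 0 <= l <= 1 ->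
  l * f a + (1 - l) * f b <= f (l * a + (1 - l) * b).

Definition nondecr0 f : Prop := forall a b : R, 0 <= a -> a <= b -> f a <= f b.

(** The supremum of the lower family separates. This yields slopes of supporting lines here, and
    later truncation levels and central values of functions of controlled oscillation. *)
Lemma between_sets (T : Type) (D : set T) (F G : T -> R) :
  (exists x, D x) -> (forall x y, D x -> D y -> F x <= G y) ->
  exists m, forall x, D x -> F x <= m <= G x.
Proof.
move=> [x0 Dx0] FG; pose S := [set F x | x in D].
have ub : has_ubound S by exists (G x0) => _ [x Dx <-]; exact: FG.
exists (sup S) => x Dx; apply/andP; split.
- by apply: ub_le_sup => //; exists x.
- apply: ge_sup; first by exists (F x0), x0.
  by move=> _ [y Dy <-]; exact: FG.
Qed.

(** Monotonicity of difference quotients, cross-multiplied so that points may coincide. *)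
Lemma concave_slopes f x y z : concave0 f -> 0 <= x -> x <= y -> y <= z ->
  (f z - f y) * (y - x) <= (f y - f x) * (z - y).
Proof.
move=> cf x0 xy yz; have [zx|zx] := eqVneq z x.
  have -> : y = x by apply/eqP; rewrite eq_le xy -zx yz.
  by rewrite zx !subrr !mulr0.
have zx0 : 0 < z - x by rewrite subr_gt0 lt_neqAle eq_sym zx (le_trans xy yz).
pose l := (z - y) / (z - x).
have l01 : 0 <= l <= 1.
  rewrite divr_ge0 ?subr_ge0 ?(ltW zx0)//=; last by rewrite -subr_ge0 ltW.
  by rewrite ler_pdivrMr// mul1r; lra.
have := cf x z l x0 (le_trans x0 (le_trans xy yz)) l01.
have -> : l * x + (1 - l) * z = y by rewrite /l; field; exact: lt0r_neq0.
have E : l * f x + (1 - l) * f z = ((z - y) * f x + (y - x) * f z) / (z - x).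
  by rewrite /l; field; exact: lt0r_neq0.
by rewrite E ler_pdivrMr//; nra.
Qed.

(** Any number between the slopes to the right of [v0] and those to the left of it is a
    supergradient; monotonicity makes it nonnegative. The point is interior because the slope at [0]
    may be infinite. *)
Lemma concave_supergradient f v0 : concave0 f -> nondecr0 f -> 0 < v0 ->
  exists2 s, 0 <= s & forall v, 0 <= v -> f v <= f v0 + s * (v - v0).
Proof.
move=> cf nf v00.
have := @between_sets (R * R)%type [set p | v0 < p.1 /\ (0 <= p.2 < v0)]
  (fun p => (f p.1 - f v0) / (p.1 - v0)) (fun p => (f v0 - f p.2) / (v0 - p.2)).
case.
- by exists (v0 + 1, 0) => /=; rewrite lexx v00; split => //; lra.
- move=> [a b] [a' b'] /= [av bv] [av' /andP[b'0 bv']].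
  rewrite ler_pdivrMr ?subr_gt0// mulrAC ler_pdivlMr ?subr_gt0//.
  by apply: concave_slopes => //; exact: ltW.
move=> s Hs.
have HU v : v0 < v -> (f v - f v0) / (v - v0) <= s.
  by move=> vv; have /andP[] := Hs (v, 0) (conj vv (introT andP (conj (lexx 0) v00))).
have HL v : 0 <= v -> v < v0 -> s <= (f v0 - f v) / (v0 - v).
  move=> v_ge0 vv; have v1 : v0 < v0 + 1 by lra.
  by have /andP[] := Hs (v0 + 1, v) (conj v1 (introT andP (conj v_ge0 vv))).
exists s.
  have v1 : v0 < v0 + 1 by lra.
  apply: le_trans (HU _ v1); rewrite divr_ge0 ?subr_ge0//; last lra.
  by apply: nf; lra.
move=> v v_ge0; have [vv|vv|->] := ltgtP v v0; last by rewrite subrr mulr0 addr0.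
- have := HL v v_ge0 vv; rewrite ler_pdivlMr ?subr_gt0//; lra.
- have := HU v vv; rewrite ler_pdivrMr ?subr_gt0//; lra.
Qed.

Lemma one_powR (b : R) : 1 `^ b = 1.
Proof. by rewrite powR1. Qed.

(** The tangent plane at [(d0, B0)] of a concave geometric mean; after rescaling by [d0] and [B0] it
    is Young's inequality. This is the source of the affine bounds whose infimum is the joint
    weight. *)
Lemma powR_amgm (a d B d0 B0 : R) : 0 < a < 1 -> 0 <= d -> 0 <= B -> 0 < d0 -> 0 < B0 ->
  d `^ a * B `^ (1 - a) <= d0 `^ a * B0 `^ (1 - a) * (a * (d / d0) + (1 - a) * (B / B0)).
Proof.
move=> /andP[a0 a1] hd hB d00 B00.
have a1' : 0 < 1 - a by rewrite subr_gt0.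
have -> : d = d0 * (d / d0) by rewrite mulrCA mulfV ?mulr1 ?lt0r_neq0.
have -> : B = B0 * (B / B0) by rewrite mulrCA mulfV ?mulr1 ?lt0r_neq0.
set u := d / d0; set v := B / B0.
have u0 : 0 <= u by rewrite divr_ge0 // ltW.
have v0 : 0 <= v by rewrite divr_ge0 // ltW.
rewrite (_ : d0 * u / d0 = u); last by rewrite mulrAC mulfV ?mul1r ?lt0r_neq0.
rewrite (_ : B0 * v / B0 = v); last by rewrite mulrAC mulfV ?mul1r ?lt0r_neq0.
rewrite (powRM a (ltW d00) u0) (powRM (1 - a) (ltW B00) v0).
rewrite mulrACA ler_wpM2l ?mulr_ge0 ?powR_ge0//.
have := @conjugate_powR R (u `^ a) (v `^ (1 - a)) a^-1 (1 - a)^-1.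
rewrite !invrK -!powRrM !mulfV ?lt0r_neq0// !powRr1// => H.
rewrite (mulrC a u) (mulrC (1 - a) v); apply: H; rewrite ?powR_ge0 ?invr_gt0//.
ring.
Qed.

End Concave.

Section Flow.
Context {R : realType}.
Variables (ph : R -> R) (c : R).
Hypotheses (phC : concave0 ph) (phN : nondecr0 ph) (ph0 : ph 0 = 0) (ph1 : ph 1 = c)
  (c0 : 0 < c) (phL : forall u, 0 <= u -> ph u <= c * u).

Lemma ph_ge0 u : 0 <= u -> 0 <= ph u.
Proof. by move=> u0; rewrite -ph0; exact: phN. Qed.

Lemma ph_gt0 u : 1 <= u -> 0 < ph u.
Proof. by move=> u1; apply: lt_le_trans c0 _; rewrite -ph1; apply: phN. Qed.

(** Chords from the origin have decreasing slopes, as [ph 0 = 0]. *)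
Lemma ph_ratio a b : 0 <= a -> a <= b -> a * ph b <= b * ph a.
Proof.
move=> a0 ab; have := concave_slopes _ _ _ _ phC (lexx 0) a0 ab.
by rewrite ph0; lra.
Qed.

Lemma ph_subadd a b : 0 <= a -> 0 <= b -> ph (a + b) <= ph a + ph b.
Proof.
move=> a0 b0; have [ab|ab] := eqVneq (a + b) 0.
  by rewrite ab ph0 addr_ge0 ?ph_ge0.
have ab0 : 0 < a + b by rewrite lt_neqAle eq_sym ab addr_ge0.
have := ph_ratio a (a + b) a0; have := ph_ratio b (a + b) b0.
move=> /(_ ltac:(lra)) h1 /(_ ltac:(lra)) h2.
rewrite -(ler_pM2l ab0); lra.
Qed.

(** By subadditivity, the linear bound at the origin controls every increment. *)
Lemma ph_lip a b : 0 <= a -> a <= b -> ph b <= ph a + c * (b - a).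
Proof.
move=> a0 ab; rewrite {1}(_ : b = a + (b - a)); last by ring.
apply: (le_trans (ph_subadd _ _ a0 _)); first by rewrite subr_ge0.
by rewrite lerD2l phL// subr_ge0.
Qed.

(** Here [0] is allowed and the slope is at most [c]: evaluating the supporting line at [0] gives
    [s * v0 <= ph v0 <= c * v0]. *)
Lemma ph_supergradient v0 : 0 <= v0 ->
  exists2 s, 0 <= s <= c & forall v, 0 <= v -> ph v <= ph v0 + s * (v - v0).
Proof.
rewrite le_eqVlt => /predU1P[<-|v00].
  exists c; first by rewrite lexx ltW.
  by move=> v v0'; rewrite ph0 add0r subr0 phL.
have [s s0 Hs] := concave_supergradient ph v0 phC phN v00.
exists s => //; rewrite s0/=.
have := Hs 0 (lexx 0); have := phL v0 (ltW v00); rewrite ph0 => h1 h2.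
by rewrite -(ler_pM2r v00); lra.
Qed.

Variable eta : R.
Hypothesis eta0 : 0 < eta.

Definition flow (w : R) := w + eta * ph w.

Lemma flow_ge w : 0 <= w -> w <= flow w.
Proof. by move=> w0; rewrite lerDl mulr_ge0 ?ph_ge0// ltW. Qed.

Lemma flow_mono : nondecr0 flow.
Proof. by move=> a b a0 ab; rewrite lerD// ler_pM2l//; exact: phN. Qed.

Lemma flow_concave : concave0 flow.
Proof.
move=> a b l a0 b0 l01; rewrite /flow.
by have := ler_wpM2l (ltW eta0) (phC a b l a0 b0 l01); lra.
Qed.

Lemma flow_iter_ge k w : 0 <= w -> w <= iter k flow w.
Proof.
move=> w0; elim: k => //= k IH.
by apply: (le_trans IH); apply: flow_ge; apply: le_trans IH.
Qed.

Lemma flow_iter_mono k : nondecr0 (iter k flow).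
Proof.
move=> a b a0 ab; elim: k => //= k IH; apply: flow_mono => //.
by apply: le_trans (flow_iter_ge _ _ _).
Qed.

Lemma flow_iter_concave k : concave0 (iter k flow).
Proof.
move=> a b l a0 b0 l01; elim: k => //= k IH.
have fa := le_trans a0 (flow_iter_ge k _ a0).
have fb := le_trans b0 (flow_iter_ge k _ b0).
apply: (le_trans (flow_concave _ _ _ fa fb l01)).
apply: flow_mono => //; case/andP: l01 => l0 l1.
by rewrite addr_ge0 ?mulr_ge0 ?subr_ge0.
Qed.

(* Along the flow a gap of size [c1 * ph w] below [w] is transported to a gap of the same form. *)
Lemma flow_gap c1 v w : 0 <= v -> 1 <= w -> 0 <= c1 -> v <= w - c1 * ph w ->
  flow v <= flow w - c1 * ph (flow w).
Proof.
move=> v0 w1 c10 vw.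
have pw : 0 < ph w by exact: ph_gt0.
have vw' : v <= w by have := mulr_ge0 c10 (ltW pw); lra.
have w0 : 0 <= w by lra.
have := concave_slopes _ _ _ _ phC v0 vw' (flow_ge _ w0).
have -> : flow w - w = eta * ph w by rewrite /flow; ring.
move=> h.
set X := ph (flow w) in h *.
have h2 : ph w * c1 * X <= (w - v) * X.
  rewrite ler_wpM2r//; last by lra.
  by apply: ph_ge0; apply: le_trans (flow_ge _ w0).
rewrite /flow -(ler_pM2l pw); nra.
Qed.

Lemma flow_iter_gap k c1 v w : 0 <= v -> 1 <= w -> 0 <= c1 -> v <= w - c1 * ph w ->
  iter k flow v <= iter k flow w - c1 * ph (iter k flow w).
Proof.
move=> v0 w1 c10 vw; elim: k => //= k IH.
apply: flow_gap => //.
  by apply: le_trans (flow_iter_ge _ _ _).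
apply: (le_trans w1); apply: flow_iter_ge; lra.
Qed.

(* [zk k] and [rk k] stand for [H_phi^-1(eta k)] and [phi(H_phi^-1(eta k))]. *)
Definition zk k := iter k flow 1.
Definition rk k := ph (zk k).

Lemma zk_ge1 k : 1 <= zk k.
Proof. exact: flow_iter_ge. Qed.

Lemma rk_gt0 k : 0 < rk k.
Proof. by apply: ph_gt0; exact: zk_ge1. Qed.

Lemma zkS k : zk k.+1 = zk k + eta * rk k.
Proof. by []. Qed.

Lemma zk_le k : zk k <= zk k.+1.
Proof. by apply: flow_ge; apply: le_trans (zk_ge1 _). Qed.

Lemma rk_le_S k : rk k <= rk k.+1.
Proof. by apply: phN; [apply: le_trans (zk_ge1 _) | exact: zk_le]. Qed.

Lemma rk_le m n : (m <= n)%N -> rk m <= rk n.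
Proof.
move=> /subnK <-; elim: (n - m)%N => //= k IH.
by rewrite addSn; exact: le_trans IH (rk_le_S _).
Qed.

Lemma rk_growth k : rk k.+1 <= (1 + eta * c) * rk k.
Proof.
have z1 := zk_ge1 k; have z0 : 0 <= zk k by apply: le_trans z1.
have := ph_lip _ _ z0 (zk_le k).
have -> : zk k.+1 - zk k = eta * rk k by rewrite zkS; ring.
by rewrite -/(rk k) -/(rk k.+1); lra.
Qed.

Lemma zk_linear k : 1 + eta * c * k%:R <= zk k.
Proof.
elim: k => [|k IH]; first by rewrite mulr0 addr0.
rewrite zkS -natr1 mulrDr mulr1 addrA lerD//.
rewrite ler_pM2l// -ph1; apply: phN => //; exact: zk_ge1.
Qed.

(* The slope of [iter k.+1 flow] above [1] telescopes along the orbit of [1]. *)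
Lemma flow_iter_slope_aux k w : 1 <= w ->
  iter k.+1 flow w - zk k.+1 <= (flow w - flow 1) * (rk k / c).
Proof.
move=> w1; elim: k => [|k IH].
  by rewrite /rk /zk /= ph1 divff ?lt0r_neq0// mulr1.
have mono : zk k.+1 <= iter k.+1 flow w by apply: flow_iter_mono.
have z0 : 0 <= zk k by apply: le_trans (zk_ge1 k).
have := concave_slopes _ _ _ _ phC z0 (zk_le k) mono.
rewrite -[ph (zk k)]/(rk k) -[ph (zk k.+1)]/(rk k.+1) .
have -> : zk k.+1 - zk k = eta * rk k by rewrite zkS; ring.
set X := iter k.+1 flow w in IH mono *.
rewrite -[iter k.+2 flow w]/(flow X) -[zk k.+2]/(flow (zk k.+1)) /flow -/(rk k.+1).
have rk0 := rk_gt0 k; have rk1 := rk_gt0 k.+1.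
move=> h.
have h1 : rk k * (X + eta * ph X - (zk k.+1 + eta * rk k.+1)) <= (X - zk k.+1) * rk k.+1.
  by nra.
have h2 : (X - zk k.+1) * rk k.+1 <= (flow w - flow 1) * (rk k / c) * rk k.+1.
  by rewrite ler_pM2r.
rewrite -(ler_pM2l rk0); apply: (le_trans h1); apply: (le_trans h2).
by rewrite le_eqVlt; apply/orP; left; apply/eqP; rewrite /flow; ring.
Qed.

(** The spread of the [k]-th iterate over a bounded range is of order [rk k], which makes [Bk k]
    comparable to [rk k] on bounded sets. *)
Lemma flow_iter_slope k w : 1 <= w -> eta * c <= 1 ->
  iter k flow w - zk k <= 2 / c * (w - 1) * rk k.
Proof.
move=> w1 ec; have hw : 0 <= w - 1 by lra.
have h1 : 1 <= rk 0 / c by rewrite /rk /zk /= ph1 divff ?lt0r_neq0.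
have rc k' : 1 <= rk k' / c.
  by apply: (le_trans h1); rewrite ler_pM2r ?invr_gt0// rk_le.
case: k => [|k].
  rewrite /= /zk /= (_ : 2 / c * (w - 1) * rk 0 = 2 * (w - 1) * (rk 0 / c)); last by ring.
  by have := rc 0%N; nra.
apply: (le_trans (flow_iter_slope_aux _ _ w1)).
(* The factor [2] bounds [1 + eta * c]. *)
have fw : flow w - flow 1 <= 2 * (w - 1).
  have := ler_wpM2l (ltW eta0) (ph_lip 1 w ler01 w1); have := ler_wpM2r hw ec.
  by rewrite /flow; lra.
rewrite (_ : 2 / c * (w - 1) * _ = (2 * (w - 1)) * (rk k.+1 / c)); last by ring.
apply: (@le_trans _ _ (2 * (w - 1) * (rk k / c))).
  by rewrite ler_wpM2r//; have := rc k; lra.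
by rewrite ler_wpM2l ?ler_pM2r ?invr_gt0 ?rk_le_S//; lra.
Qed.

Variables (beta c1 : R).
Hypotheses (beta0 : 0 < beta) (c10 : 0 < c1).

(** The iterate [iter k flow w] alone would start at the height [zk k] instead of [rk k]. Keeping
    only a small multiple [beta] of its excess over [zk k] leaves a concave weight that is at least
    [rk k], changes little from one index to the next at bounded [w], and still decreases under the
    drift at large [w]. *)
Definition Bk k w := rk k + beta * (iter k flow w - zk k).

Lemma Bk_ge k w : 1 <= w -> rk k <= Bk k w.
Proof.
move=> w1; rewrite /Bk lerDl mulr_ge0 ?(ltW beta0)// subr_ge0.
exact: flow_iter_mono.
Qed.

Lemma Bk_supergradient k w0 : 1 <= w0 -> exists2 s, 0 <= s &
  forall w, 1 <= w -> Bk k w <= Bk k w0 + s * (w - w0).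
Proof.
move=> w01.
have [|s s0 Hs] := concave_supergradient _ w0 (flow_iter_concave k) (flow_iter_mono k).
  lra.
exists (beta * s); first by rewrite mulr_ge0// ltW.
move=> w w1; have := Hs w (le_trans ler01 w1).
by move=> /(ler_wpM2l (ltW beta0)); rewrite /Bk; lra.
Qed.

(** The part [eta * ph w] of the drift pays for one more application of [flow]. The part [c1 * ph w]
    is a gap that the flow transports to at least [c1 * rk k]; multiplied by [beta], it pays for the
    growth of [rk]. *)
Lemma Bk_far k w w' : 1 <= w -> 0 <= w' -> w' <= w - (c1 + eta) * ph w ->
  eta * c <= beta * c1 -> Bk k.+1 w' <= Bk k w.
Proof.
move=> w1 w'0 ww' ec.
have pw := ph_gt0 _ w1.
have w'w : w' <= w by have := mulr_ge0 (addr_ge0 (ltW c10) (ltW eta0)) (ltW pw); lra.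
have Fw' : flow w' <= w - c1 * ph w.
  by rewrite /flow; have := ler_wpM2l (ltW eta0) (phN _ _ w'0 w'w); lra.
have := flow_iter_gap k c1 (flow w') w (le_trans w'0 (flow_ge _ w'0)) w1 (ltW c10) Fw'.
rewrite -iterSr.
have rw : rk k <= ph (iter k flow w).
  apply: phN; last exact: flow_iter_mono.
  by apply: le_trans (zk_ge1 k).
have := rk_growth k; have := zk_le k; have r0 := rk_gt0 k.
rewrite /Bk -[iter k.+1 flow w']/(flow (iter k flow w')).
set a := flow _; set b := iter k flow w; move=> h1 h2 h3.
have h4 : a <= b - c1 * rk k by have := ler_wpM2l (ltW c10) rw; lra.
have h5 : beta * (a - zk k.+1) <= beta * (b - c1 * rk k - zk k) by rewrite ler_pM2l//; lra.
have := ler_wpM2r (ltW r0) ec; lra.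
Qed.

(** At bounded [w'] one more index costs a factor that tends to [1] with [beta], so a small [beta]
    lets the contraction of the distance pay for it. *)
Lemma Bk_near k w w' M1 : 1 <= w -> 1 <= w' -> w' <= M1 -> eta * c <= beta * c1 -> eta * c <= 1 ->
  Bk k.+1 w' <= (1 + beta * c1) * (1 + beta * (2 / c * M1)) * Bk k w.
Proof.
move=> w1 w'1 w'M ec ec1.
have h1 := flow_iter_slope k.+1 w' w'1 ec1.
have h2 := Bk_ge k _ w1; have r0 := rk_gt0 k; have r1 := rk_gt0 k.+1.
have h3 := rk_growth k.
have c2 : 0 < 2 / c by rewrite divr_gt0.
have h4 : iter k.+1 flow w' - zk k.+1 <= 2 / c * M1 * rk k.+1.
  apply: (le_trans h1); rewrite ler_pM2r// ler_pM2l//; lra.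
have M10 : 0 <= 2 / c * M1 by rewrite mulr_ge0 ?(ltW c2)//; lra.
set X := 2 / c * M1 in h4 M10 *.
have h5 : Bk k.+1 w' <= (1 + beta * X) * rk k.+1.
  have : beta * (iter k.+1 flow w' - zk k.+1) <= beta * (X * rk k.+1) by rewrite ler_pM2l.
  by rewrite /Bk; lra.
apply: (le_trans h5); rewrite mulrAC.
have bX : 0 <= 1 + beta * X by rewrite addr_ge0// mulr_ge0// ltW.
rewrite mulrC ler_wpM2r//; apply: (le_trans h3).
have : 0 <= eta * c by rewrite mulr_ge0// ltW.
by nra.
Qed.

End Flow.

(** * Farkas' lemma and finite transport *)

Section Farkas.
Context {R : realType} {X : lmodType R} {I : eqType}.

Definition is_lin (f : X -> R) : Prop := forall a x y, f (a *: x + y) = a * f x + f y.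

(* Bartl's induction: if dropping the constraint [i0] breaks the implication at [x0], projecting
   along [x0] onto the kernel of [al i0] reduces to the remaining constraints. *)
Lemma farkas (s : seq I) (al : I -> X -> R) (ga : X -> R) :
  uniq s -> (forall i, is_lin (al i)) -> is_lin ga ->
  (forall x, (forall i, i \in s -> al i x <= 0) -> ga x <= 0) ->
  exists2 la : I -> R, (forall i, 0 <= la i) & forall x, ga x = \sum_(i <- s) la i * al i x.
Proof.
elim: s al ga => [|i0 s IH] al ga.
  move=> _ _ lga H; exists (fun=> 0) => // x; rewrite big_nil.
  have g0 : ga 0 = 0 by have := lga (-1) 0 0; rewrite scaler0 addr0 mulN1r addNr.
  apply/eqP; rewrite eq_le H//= -oppr_le0.
  have -> : - ga x = ga (- x).
    by have := lga (-1) x 0; rewrite addr0 scaleN1r g0 addr0 mulN1r.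
  exact: H.
move=> /= /andP[i0s us] lal lga H.
have [H'|/existsNP[x0 /not_implyP[x0s /negP]]] :=
  pselect (forall x, (forall i, i \in s -> al i x <= 0) -> ga x <= 0).
  have [la la0 E] := IH al ga us lal lga H'.
  exists (fun i => if i == i0 then 0 else la i); first by move=> i; case: ifP.
  move=> x; rewrite big_cons eqxx mul0r add0r E; apply: eq_big_seq => i is_.
  by case: eqVneq => // ii0; rewrite -ii0 is_ in i0s.
rewrite -ltNge => gx0.
have ax0 : 0 < al i0 x0.
  rewrite ltNge; apply/negP => h; have := H x0; rewrite leNgt gx0 => /(_ _)/negP; apply => //.
  by move=> i; rewrite inE => /predU1P[->|/x0s].
pose al' i x := al i x - al i x0 / al i0 x0 * al i0 x.
pose ga' x := ga x - ga x0 / al i0 x0 * al i0 x.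
have proj (f : X -> R) x : is_lin f ->
    f (- (al i0 x / al i0 x0) *: x0 + x) = f x - f x0 / al i0 x0 * al i0 x.
  by move=> lf; rewrite lf; ring.
have lin' (f : X -> R) (k : R) : is_lin f -> is_lin (fun x => f x - k * al i0 x).
  by move=> lf a x y; rewrite lf lal; ring.
have [|||la la0 E] := IH al' ga' us.
- by move=> i; exact: lin'.
- exact: lin'.
- move=> x Hx; rewrite /ga' -proj//; apply: H => i; rewrite inE => /predU1P[->|is_].
    by rewrite proj//; rewrite divff ?lt0r_neq0// mul1r subrr.
  by rewrite proj//; exact: Hx.
exists (fun i => if i == i0 then (ga x0 - \sum_(i <- s) la i * al i x0) / al i0 x0 else la i).
  move=> i; case: ifP => // _; rewrite divr_ge0 ?(ltW ax0)// subr_ge0.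
  apply: le_trans (ltW gx0); rewrite big_seq; apply: sumr_le0 => j js.
  by rewrite mulr_ge0_le0// x0s.
move=> x; rewrite big_cons eqxx.
have := E x; rewrite /ga' /al' => /eqP; rewrite subr_eq => /eqP ->.
rewrite (_ : \sum_(i <- s) _ = \sum_(i <- s) la i * al i x -
    (\sum_(i <- s) la i * al i x0) / al i0 x0 * al i0 x); last first.
  rewrite !mulr_suml -sumrB; apply: eq_bigr => i _; ring.
have -> : \sum_(i <- s) (if i == i0 then (ga x0 - \sum_(i <- s) la i * al i x0) / al i0 x0 else la i)
     * al i x = \sum_(i <- s) la i * al i x.
  apply: eq_big_seq => i is_; case: eqVneq => // ii0; by rewrite -ii0 is_ in i0s.
ring.
Qed.

End Farkas.

Section FiniteTransport.
Context {R : realType} {n : nat}.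
Variables (p q : 'I_n -> R) (cost : 'I_n -> 'I_n -> R) (b : R).

(** Farkas' lemma for the dual problem made homogeneous by a third coordinate [t <= 0]: a triple
    with [t < 0] is, after division by [- t], a feasible pair of potentials. The multipliers of the
    constraints [Some (i, j)] form the transport plan, that of [None] is the slack in the cost. *)
Lemma finite_transport :
  (forall i, 0 <= p i) -> (forall i, 0 <= q i) -> \sum_i p i = 1 -> \sum_i q i = 1 ->
  (forall u v : 'I_n -> R, (forall i j, u i + v j <= cost i j) ->
    \sum_i p i * u i + \sum_j q j * v j <= b) ->
  exists la : 'I_n -> 'I_n -> R,
    [/\ (forall i j, 0 <= la i j), (forall i, \sum_j la i j = p i),
        (forall j, \sum_i la i j = q j) & \sum_i \sum_j la i j * cost i j <= b].
Proof.
move=> p0 q0 p1 q1 H.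
pose X : lmodType R := ('rV[R]_n * 'rV[R]_n * R^o)%type.
pose al (o : option ('I_n * 'I_n)) (x : X) : R :=
  if o is Some ij then x.1.1 0 ij.1 + x.1.2 0 ij.2 + cost ij.1 ij.2 * x.2 else x.2.
pose ga (x : X) : R := \sum_i p i * x.1.1 0 i + \sum_j q j * x.1.2 0 j + b * x.2.
have lal o : is_lin (al o).
  by case: o => [ij|] a x y; rewrite /al /= ?mxE /= /GRing.scale /=; ring.
have lga : is_lin ga.
  move=> a x y; rewrite /ga /=.
  have E (P : 'I_n -> R) (u v : 'rV[R]_n) : \sum_i P i * (a *: u + v) 0 i =
      a * (\sum_i P i * u 0 i) + \sum_i P i * v 0 i.
    rewrite mulr_sumr -big_split /=; apply: eq_bigr => i _; rewrite !mxE; ring.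
  by rewrite !E /GRing.scale /=; ring.
have [|la la0 E] := @farkas R X (option ('I_n * 'I_n)) (enum {: option ('I_n * 'I_n)}) al ga
  (enum_uniq _) lal lga.
  move=> [[u v] t] /= Hx.
  have Hx' o : al o (u, v, t) <= 0 by apply: Hx; rewrite mem_enum.
  have := Hx' None; rewrite /= le_eqVlt => /predU1P[t0|t0].
    (* At [t = 0] all sums [u i + v j] are nonpositive, so their average under the product weights
       [p i * q j] is too. *)
    rewrite /ga /= t0 mulr0 addr0.
    have -> : \sum_i p i * u 0 i + \sum_j q j * v 0 j =
        \sum_i \sum_j p i * q j * (u 0 i + v 0 j).
      have E1 : \sum_i p i * u 0 i = \sum_i \sum_j p i * q j * u 0 i.
        apply: eq_bigr => i _; rewrite -mulr_suml -mulr_sumr q1; ring.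
      have E2 : \sum_j q j * v 0 j = \sum_i \sum_j p i * q j * v 0 j.
        rewrite exchange_big /=; apply: eq_bigr => j _.
        rewrite -mulr_suml -mulr_suml p1; ring.
      rewrite E1 E2 -big_split; apply: eq_bigr => i _; rewrite -big_split.
      by apply: eq_bigr => j _ /=; ring.
    apply: sumr_le0 => i _; apply: sumr_le0 => j _.
    rewrite mulr_ge0_le0// ?mulr_ge0//.
    by have := Hx' (Some (i, j)); rewrite /= t0 mulr0 addr0.
  have tn0 : - t != 0 by rewrite oppr_eq0 lt_eqF.
  have nt0 : 0 < - t by rewrite oppr_gt0.
  have := H (fun i => u 0 i / - t) (fun j => v 0 j / - t) _.
  have -> : \sum_i p i * (u 0 i / - t) + \sum_j q j * (v 0 j / - t) =
      (\sum_i p i * u 0 i + \sum_j q j * v 0 j) / - t.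
    by rewrite mulrDl !mulr_suml; congr (_ + _); apply: eq_bigr => i _; ring.
  move=> h; suff : (\sum_i p i * u 0 i + \sum_j q j * v 0 j) / - t <= b.
    by rewrite ler_pdivrMr// /ga /=; lra.
  apply: h => i j; rewrite -mulrDl ler_pdivrMr//.
  by have := Hx' (Some (i, j)); rewrite /=; lra.
have E' x : ga x = la None * x.2 + \sum_i \sum_j la (Some (i, j)) * al (Some (i, j)) x.
  rewrite E big_enum /= (bigD1 None) //=; congr (_ + _).
  rewrite pair_big /= (reindex_omap Some id) /=; last by case.
  by apply: eq_big => [[i j]|[i j] _]; rewrite /= ?eqxx.
exists (fun i j => la (Some (i, j))); split => //.
(* The identity between linear forms is read off on unit vectors: those of [u] give row sums, those
   of [v] column sums, and [(0, 0, 1)] the cost. *)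
- move=> i; have := E' (delta_mx 0 i, 0, 0) : _ = _; rewrite /ga /al /= !mulr0 addr0 add0r.
  under [X in _ + X]eq_bigr do rewrite mxE mulr0.
  rewrite big1_eq addr0 (bigD1 i) //= mxE !eqxx mulr1 big1 ?addr0; last first.
    by move=> k ki; rewrite mxE eqxx (negbTE ki) mulr0.
  move=> ->; rewrite [RHS](bigD1 i) //= [X in _ + X]big1 ?addr0; last first.
    move=> k ki; apply: big1 => j _; rewrite !mxE eqxx (negbTE ki) !mulr0 !addr0 ?mulr0//.
  by apply: eq_bigr => j _; rewrite !mxE !eqxx /=; ring.
- move=> j; have := E' (0, delta_mx 0 j, 0) : _ = _; rewrite /ga /al /= !mulr0 addr0 add0r.
  under [X in X + _]eq_bigr do rewrite mxE mulr0.
  rewrite big1_eq add0r (bigD1 j) //= mxE !eqxx mulr1 big1 ?addr0; last first.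
    by move=> k ki; rewrite mxE eqxx (negbTE ki) mulr0.
  move=> ->; apply: eq_bigr => i _.
  rewrite [RHS](bigD1 j) //= [X in _ + X]big1 ?addr0; last first.
    by move=> k ki; rewrite !mxE eqxx (negbTE ki) /= mulr0n; ring.
  by rewrite !mxE !eqxx /=; ring.
- have := E' (0, 0, 1) : _ = _; rewrite /ga /al /= !mulr1.
  under eq_bigr do rewrite mxE mulr0.
  under [X in _ + X + _]eq_bigr do rewrite mxE mulr0.
  rewrite !big1_eq !add0r => Eb.
  have -> : b = la None + \sum_i \sum_j la (Some (i, j)) * cost i j :> R.
    rewrite Eb; congr (_ + _).
    by apply: eq_bigr => i _; apply: eq_bigr => j _; rewrite !mxE; ring.
  by rewrite -[X in X <= _]add0r; apply: lerD.
Qed.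

End FiniteTransport.

(** * Expectations *)

Section LowerIntegral.
Import HBNNSimple.

(** The integral of a nonnegative function is a supremum over simple functions below it, so it is
    monotone without measurability. This form serves for [theta] along a coupling and for the time
    integrand of the Lyapunov condition. *)
Lemma ge0_le_integral_lower (d : measure_display) (T : measurableType d) (R : realType)
    (mu : {measure set T -> \bar R}) (D : set T) (f g : T -> \bar R) :
  (forall x, D x -> (0 <= f x)%E) -> (forall x, D x -> (f x <= g x)%E) ->
  (\int[mu]_(x in D) f x <= \int[mu]_(x in D) g x)%E.
Proof.
move=> f0 fg; rewrite !ge0_integralE//; last by move=> x Dx; exact: le_trans (f0 x Dx) (fg x Dx).
apply: ereal_sup_le => _ [h /= hf <-]; exists h => // x /=.
by apply: le_trans (hf x) _; exact: lee_restrict.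
Qed.

End LowerIntegral.

Section Expectation.
Context {R : realType} {d : measure_display} {T : measurableType d}.
Implicit Types (mu nu : probability T R) (f g : T -> R).

Definition Ex mu f : R := Rintegral mu setT f.
Definition itg mu f : Prop := mu.-integrable setT (EFin \o f).
Definition bdd f : Prop := exists M : R, forall x, `|f x| <= M.

Lemma itg_bdd mu f : measurable_fun setT f -> bdd f -> itg mu f.
Proof.
move=> mf [M fM]; apply: measurable_bounded_integrable; [exact: measurableT | | exact: mf |].
  by rewrite [X in (X < _)%E]probability_setT ltry.
exists M; split; first exact: num_real.
by move=> y My x _; apply: le_trans (fM x) _; exact: ltW.
Qed.

Lemma itg_meas mu f : itg mu f -> measurable_fun setT f.
Proof. by move=> /integrableP[/measurable_EFinP]. Qed.

Lemma itg_cst mu (r : R) : itg mu (fun=> r).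
Proof. by apply: itg_bdd => //; exists `|r|. Qed.

Lemma itgD mu f g : itg mu f -> itg mu g -> itg mu (fun x => f x + g x).
Proof. by move=> hf hg; exact: (integrableD measurableT hf hg). Qed.

Lemma itgZ mu (r : R) f : itg mu f -> itg mu (fun x => r * f x).
Proof. by move=> hf; exact: (@integrableZl _ _ _ mu _ measurableT r _ hf). Qed.

Lemma itgN mu f : itg mu f -> itg mu (fun x => - f x).
Proof. by move=> /(itgZ mu (-1)); congr itg; apply/funext => x; rewrite mulN1r. Qed.

Lemma itgB mu f g : itg mu f -> itg mu g -> itg mu (fun x => f x - g x).
Proof. by move=> hf hg; apply: itgD => //; exact: itgN. Qed.

Lemma itg_le mu f g : measurable_fun setT f -> (forall x, `|f x| <= g x) -> itg mu g -> itg mu f.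
Proof.
move=> mf fg hg; apply: (le_integrable measurableT _ _ hg) => //; first exact/measurable_EFinP.
by move=> x _ /=; rewrite lee_fin; apply: le_trans (fg x) (ler_norm _).
Qed.

Lemma itg_abs mu f : itg mu f -> itg mu (fun x => `|f x|).
Proof. by move=> hf; exact: (integrable_abse hf). Qed.

Lemma ExE mu f : itg mu f -> (Ex mu f)%:E = (\int[mu]_x (f x)%:E)%E.
Proof. by move=> hf; rewrite /Ex /Rintegral fineK//; exact: integrable_fin_num. Qed.

Lemma Ex_cst mu (r : R) : Ex mu (fun=> r) = r.
Proof.
by rewrite /Ex Rintegral_cst// [X in fine X]probability_setT /= mulr1.
Qed.

Lemma ExD mu f g : itg mu f -> itg mu g -> Ex mu (fun x => f x + g x) = Ex mu f + Ex mu g.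
Proof. by move=> hf hg; rewrite /Ex RintegralD. Qed.

Lemma ExZ mu (r : R) f : itg mu f -> Ex mu (fun x => r * f x) = r * Ex mu f.
Proof. by move=> hf; rewrite /Ex RintegralZl. Qed.

Lemma ExN mu f : itg mu f -> Ex mu (fun x => - f x) = - Ex mu f.
Proof.
move=> hf; rewrite -mulN1r -ExZ//; congr Ex; by apply/funext => x; rewrite mulN1r.
Qed.

Lemma ExB mu f g : itg mu f -> itg mu g -> Ex mu (fun x => f x - g x) = Ex mu f - Ex mu g.
Proof. by move=> hf hg; rewrite /Ex RintegralB. Qed.

Lemma Ex_le mu f g : itg mu f -> itg mu g -> (forall x, f x <= g x) -> Ex mu f <= Ex mu g.
Proof. by move=> hf hg fg; apply: le_Rintegral. Qed.

Lemma Ex_ge0 mu f : (forall x, 0 <= f x) -> 0 <= Ex mu f.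
Proof. by move=> f0; apply: Rintegral_ge0. Qed.

Lemma Ex_le_cst mu f (r : R) : itg mu f -> (forall x, f x <= r) -> Ex mu f <= r.
Proof. by move=> hf fr; rewrite -(Ex_cst mu r); apply: Ex_le => //; exact: itg_cst. Qed.

Lemma Ex_ge_cst mu f (r : R) : itg mu f -> (forall x, r <= f x) -> r <= Ex mu f.
Proof. by move=> hf fr; rewrite -(Ex_cst mu r); apply: Ex_le => //; exact: itg_cst. Qed.

Lemma Ex_norm_le mu f g : itg mu f -> itg mu g -> (forall x, `|f x| <= g x) ->
  `|Ex mu f| <= Ex mu g.
Proof.
move=> hf hg fg; rewrite ler_norml; apply/andP; split.
  by rewrite lerNl -ExN//; apply: Ex_le => // [|x]; [exact: itgN | have := fg x; rewrite ler_norml; lra].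
by apply: Ex_le => // x; have := fg x; rewrite ler_norml; lra.
Qed.

Lemma itg_sum mu (n : nat) (F : 'I_n -> T -> R) : (forall i, itg mu (F i)) ->
  itg mu (fun x => \sum_(i < n) F i x).
Proof.
elim: n F => [|n IH] F hF.
  by under eq_fun do rewrite big_ord0; exact: itg_cst.
under eq_fun do rewrite big_ord_recr /=.
by apply: itgD => //; apply: IH.
Qed.

Lemma Ex_sum mu (n : nat) (F : 'I_n -> T -> R) : (forall i, itg mu (F i)) ->
  Ex mu (fun x => \sum_(i < n) F i x) = \sum_(i < n) Ex mu (F i).
Proof.
elim: n F => [|n IH] F hF.
  by under eq_fun do rewrite big_ord0; rewrite Ex_cst big_ord0.
under eq_fun do rewrite big_ord_recr /=.
by rewrite ExD//; [rewrite IH// big_ord_recr | apply: itg_sum].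
Qed.

Lemma Ex_indic mu (A : set T) : measurable A -> Ex mu (\1_A) = fine (mu A).
Proof.
by move=> mA; rewrite /Ex /Rintegral integral_indic// setIT.
Qed.

Lemma itg_indic mu (A : set T) : measurable A -> itg mu (\1_A).
Proof.
move=> mA; apply: itg_bdd; first exact: measurable_indic.
by exists 1 => x; rewrite indicE; case: (_ \in _); rewrite ?normr0 ?normr1.
Qed.

Lemma prob_fine mu (A : set T) : measurable A -> (fine (mu A))%:E = mu A.
Proof. by move=> mA; rewrite fineK// fin_num_measure. Qed.

Lemma prob_le mu (A B : set T) : measurable A -> measurable B -> A `<=` B ->
  fine (mu A) <= fine (mu B).
Proof.
move=> mA mB AB; rewrite -lee_fin !prob_fine//.
by apply: le_measure => //; rewrite inE.
Qed.

Lemma prob_le1 mu (A : set T) : measurable A -> fine (mu A) <= 1.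
Proof. by move=> mA; rewrite -lee_fin prob_fine// probability_le1. Qed.

Lemma prob_setC mu (A : set T) : measurable A -> fine (mu (~` A)) = 1 - fine (mu A).
Proof. by move=> mA; rewrite probability_setC// fineB ?fin_num_measure. Qed.

Lemma measurable_ge (f : T -> R) (r : R) : measurable_fun setT f -> measurable [set x | r <= f x].
Proof.
move=> mf; rewrite -[X in measurable X]setTI.
rewrite (_ : [set x | r <= f x] = f @^-1` `[r, +oo[%classic); first exact: mf.
by apply/seteqP; split => x /=; rewrite in_itv /= andbT.
Qed.

End Expectation.

Section LayerCake.
Context {R : realType}.

(** The sum counts the positive integers up to [n] that do not exceed [y]; the first clause carries
    the induction. *)
Lemma layer_count (n : nat) (y : R) : 0 <= y ->
  [/\ (n%:R <= y -> \sum_(i < n) ((i.+1)%:R <= y)%R%:R = n%:R :> R),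
      \sum_(i < n) ((i.+1)%:R <= y)%R%:R <= y &
      (y <= n%:R -> y <= \sum_(i < n) ((i.+1)%:R <= y)%R%:R + 1)].
Proof.
move=> y0; elim: n => [|n [IH1 IH2 IH3]].
  by rewrite big_ord0 add0r; split => // y1; apply: le_trans y1 ler01.
rewrite big_ord_recr /=; split.
- move=> ny; rewrite ny IH1 ?natr1//.
  by apply: le_trans ny; rewrite ler_nat.
- have [ny|ny] := leP n.+1%:R y; last by rewrite addr0.
  by rewrite IH1 ?natr1//; apply: le_trans ny; rewrite ler_nat.
- move=> yn; have [yn'|yn'] := leP y n%:R.
    by apply: le_trans (IH3 yn') _; rewrite lerD2r lerDl ler0n.
  rewrite (IH1 (ltW yn')); apply: (le_trans yn); rewrite -natr1 lerD2r lerDl; exact: ler0n.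
Qed.

Context {d : measure_display} {T : measurableType d}.

(** A discrete layer-cake formula: it involves only measures of sets and approximates [n] times the
    expectation up to [1]. Properties known for sets are carried to functions through it. *)
Definition layer_sum (mu : probability T R) (g : T -> R) (n : nat) : R :=
  \sum_(i < n) fine (mu [set x | (i.+1)%:R <= n%:R * g x]).

Lemma layer_cake (mu : probability T R) (g : T -> R) (n : nat) :
  measurable_fun setT g -> (forall x, 0 <= g x <= 1) -> (0 < n)%N ->
  layer_sum mu g n <= n%:R * Ex mu g <= layer_sum mu g n + 1.
Proof.
move=> mg g01 n0; set S := layer_sum _ _ _.
have mng : measurable_fun setT (fun x => n%:R * g x) by exact: measurable_funM.
have ig : itg mu g.
  apply: itg_bdd => //; exists 1 => x; have /andP[g0 g1] := g01 x.
  by rewrite ger0_norm.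
have mA i : measurable [set x | (i.+1)%:R <= n%:R * g x] by exact: measurable_ge.
pose s x : R := \sum_(i < n) \1_[set x | (i.+1)%:R <= n%:R * g x] x.
have is_ : itg mu s by apply: itg_sum => i; exact: itg_indic.
have ES : Ex mu s = S by rewrite Ex_sum => [|i]; [apply: eq_bigr => i _; rewrite Ex_indic | exact: itg_indic].
have sE x : s x = \sum_(i < n) ((i.+1)%:R <= n%:R * g x)%R%:R.
  by apply: eq_bigr => i _; rewrite indicE mem_setE.
rewrite -ExZ// -ES; apply/andP; split.
  apply: Ex_le => //; first exact: itgZ.
  move=> x; rewrite sE; have /andP[g0 g1] := g01 x.
  by have [] := layer_count n (n%:R * g x) (mulr_ge0 (ler0n _ _) g0).
rewrite -{2}(Ex_cst mu 1) -ExD//; last exact: itg_cst.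
apply: Ex_le; [exact: itgZ | apply: itgD => //; exact: itg_cst |].
move=> x; rewrite sE; have /andP[g0 g1] := g01 x.
have [_ _] := layer_count n (n%:R * g x) (mulr_ge0 (ler0n _ _) g0); apply.
by rewrite ler_piMr.
Qed.

Lemma inv_natr_small (e : R) : 0 < e -> exists n : nat, (0 < n)%N /\ n%:R^-1 <= e.
Proof.
move=> e0; exists (Num.truncn e^-1).+1; split => //.
by rewrite invf_ple ?posrE// ?ltr0n//; exact/ltW/truncnS_gt.
Qed.

Lemma le_of_natr (a b C : R) : (forall n, (0 < n)%N -> n%:R * a <= n%:R * b + C) -> a <= b.
Proof.
move=> H; apply/ler_addgt0Pr => e e0.
have C0 : 0 < `|C| + 1 by rewrite ltr_wpDl.
have [n [n0 ne]] := inv_natr_small (e / (`|C| + 1)) (divr_gt0 e0 C0).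
have n0' : 0 < n%:R :> R by rewrite ltr0n.
rewrite -(ler_pM2l n0') mulrDr; apply: (le_trans (H n n0)).
rewrite lerD2l; move: ne; rewrite ler_pdivlMr// ler_pdivrMl// => ne.
apply: le_trans ne; apply: le_trans (ler_norm C) _; lra.
Qed.

(** Each of the [n] level sets in the layer sum contributes at most [eps]; the error [1] of the
    layer sum disappears after division by [n]. *)
Lemma tv_expectation (mu nu : probability T R) (eps p : R) (g : T -> R) :
  (forall A, measurable A -> fine (mu A) - fine (nu A) <= eps) ->
  measurable_fun setT g -> (forall x, 0 <= g x <= p) -> 0 < p ->
  Ex mu g <= Ex nu g + p * eps.
Proof.
move=> H mg g0p p0; pose g' x := p^-1 * g x.
have mg' : measurable_fun setT g' by exact: measurable_funM.
have g'01 x : 0 <= g' x <= 1.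
  have /andP[h1 h2] := g0p x; rewrite /g' mulr_ge0 ?invr_ge0 ?(ltW p0)//=.
  by rewrite ler_pdivrMl// mulr1.
have bg m : itg m g.
  apply: itg_bdd => //; exists p => x; have /andP[h1 h2] := g0p x.
  by rewrite ger0_norm.
suff : Ex mu g' <= Ex nu g' + eps.
  rewrite /g' !ExZ// -(ler_pM2l p0) mulrDr !mulrA mulfV ?lt0r_neq0// !mul1r //.
apply: (@le_of_natr _ _ 1) => n n0; rewrite mulrDr.
have /andP[_ h1] := layer_cake mu g' n mg' g'01 n0.
have /andP[h2 _] := layer_cake nu g' n mg' g'01 n0.
have h3 : layer_sum mu g' n - layer_sum nu g' n <= n%:R * eps.
  rewrite /layer_sum -sumrB; apply: (@le_trans _ _ (\sum_(i < n) eps)).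
    by apply: ler_sum => i _; apply: H; apply: measurable_ge; exact: measurable_funM.
  by rewrite sumr_const card_ord mulr_natl.
lra.
Qed.

End LayerCake.

(** * Bounded Lipschitz functions on a Polish space *)

Lemma mk_probability (R : realType) (d : measure_display) (T : measurableType d)
    (m : set T -> \bar R) : m set0 = 0%E -> (forall A, (0 <= m A)%E) ->
  semi_sigma_additive m -> m setT = 1%E -> exists P : probability T R, forall A, P A = m A.
Proof.
move=> h0 hge hadd h1.
pose M1 := isMeasure.Build _ _ _ m h0 hge hadd.
pose M : {measure set T -> \bar R} := HB.pack m M1.
pose M2 := Measure_isProbability.Build _ _ _ (M : set T -> \bar R) h1.
pose P : probability T R := HB.pack m M1 M2.
by exists P.
Qed.

Definition clamp {R : realType} (a : R) : R := Num.max 0 (Num.min a 1).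

Section Clamp.
Context {R : realType}.
Implicit Types a : R.

Lemma clamp_ge0 a : 0 <= clamp a. Proof. by rewrite le_max lexx. Qed.
Lemma clamp_le1 a : clamp a <= 1. Proof. by rewrite ge_max ler01 ge_min lexx orbT. Qed.
Lemma clamp1 a : 1 <= a -> clamp a = 1.
Proof. by move=> a1; rewrite /clamp min_r// max_r ?ler01. Qed.
Lemma clamp0 a : a <= 0 -> clamp a = 0.
Proof. by move=> a0; rewrite /clamp min_l ?max_l//; apply: le_trans a0 ler01. Qed.
Lemma clamp_le a b : a <= b -> clamp a <= clamp b.
Proof.
move=> ab; rewrite /clamp ge_max le_max lexx /= le_max; apply/orP; right.
by rewrite le_min !ge_min ab lexx !orbT.
Qed.

Lemma clamp_lip a b : `|clamp a - clamp b| <= `|a - b|.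
Proof.
rewrite /clamp; case: (leP a 1) => a1; case: (leP b 1) => b1; case: (leP 0 a) => a0;
  case: (leP 0 b) => b0; rewrite ?(max_r ler01); case: (ger0P (a - b)) => ab;
  rewrite ?ler_norml; lra.
Qed.

(** Cuts [a] into slabs of height [1], the continuous counterpart of counting level sets. *)
Lemma sum_clamp (n : nat) a : 0 <= a -> \sum_(i < n) clamp (a - i%:R) = Num.min a n%:R.
Proof.
move=> a0; elim: n => [|n IH]; first by rewrite big_ord0 min_r.
rewrite big_ord_recr /= IH -natr1 /clamp.
case: (leP a n%:R) => an.
  rewrite [Num.min (a - _) 1]min_l; last by lra.
  by rewrite max_l ?addr0 ?min_l//; lra.
case: (leP a (n%:R + 1)) => an1.
  rewrite [Num.min (a - _) 1]min_l; last by lra.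
  by rewrite max_r; lra.
by rewrite [Num.min (a - _) 1]min_r ?max_r; lra.
Qed.

Lemma sum_geometric_le (n : nat) (e : R) : 0 <= e -> \sum_(i < n) e / 2 ^+ i.+1 <= e.
Proof.
move=> e0; suff -> : \sum_(i < n) e / 2 ^+ i.+1 = e - e / 2 ^+ n.
  by rewrite lerBlDr lerDl divr_ge0// exprn_ge0.
elim: n => [|n IH]; first by rewrite big_ord0 expr0 divr1 subrr.
rewrite big_ord_recr /= IH exprS; field.
by rewrite expf_neq0.
Qed.

End Clamp.

Section Metric.
Context {R : realType} {d : measure_display} {E : measurableType d}.
Variable rho : E -> E -> R.
Hypothesis polish : polish_borel rho.

Let rho_metric : is_metric rho. Proof. by case: polish. Qed.

Definition rho1 (x y : E) : R := Num.min (rho x y) 1.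

Lemma rho_ge0 x y : 0 <= rho x y. Proof. by case: rho_metric. Qed.
Lemma rho_sym x y : rho x y = rho y x. Proof. by case: rho_metric. Qed.
Lemma rho_tri x y z : rho x z <= rho x y + rho y z. Proof. by case: rho_metric. Qed.
Lemma rho_xx x : rho x x = 0. Proof. by case: rho_metric => _ h _ _; exact/h. Qed.

Lemma rho1_ge0 x y : 0 <= rho1 x y. Proof. by rewrite le_min rho_ge0 ler01. Qed.
Lemma rho1_le1 x y : rho1 x y <= 1. Proof. by rewrite ge_min lexx orbT. Qed.
Lemma rho1_le x y : rho1 x y <= rho x y. Proof. by rewrite ge_min lexx. Qed.
Lemma rho1_sym x y : rho1 x y = rho1 y x. Proof. by rewrite /rho1 rho_sym. Qed.
Lemma rho1_xx x : rho1 x x = 0. Proof. by rewrite /rho1 rho_xx min_l. Qed.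

Lemma rho1_tri x y z : rho1 x z <= rho1 x y + rho1 y z.
Proof.
have := rho_tri x y z; have := rho_ge0 x y; have := rho_ge0 y z.
by rewrite /rho1; case: (leP (rho x z) 1); case: (leP (rho x y) 1); case: (leP (rho y z) 1) => *; lra.
Qed.

Definition lip1 (f : E -> R) : Prop := forall x y, `|f x - f y| <= rho1 x y.

Lemma open_measurable_rho A : rho_open rho A -> measurable A.
Proof. by move=> oA; case: polish => _ _ _ ->; exact: sub_sigma_algebra. Qed.

Lemma continuous_measurable_rho f : rho_continuous rho f -> measurable_fun setT f.
Proof.
move=> cf; apply: (measurability _ (RGenOInfty.measurableE R)) => _ [_ [r ->] <-].
rewrite setTI; apply: open_measurable_rho => x /=; rewrite in_itv /= andbT => rfx.
have [|del del0 H] := cf x (f x - r); first by rewrite subr_gt0.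
exists del => // y /H; rewrite /= in_itv /= andbT ltr_norml; lra.
Qed.

Lemma lipschitz_continuous_rho (k : R) f : (forall x y, `|f x - f y| <= k * rho x y) ->
  rho_continuous rho f.
Proof.
move=> kf x e e0; have k0 : 0 < `|k| + 1 by rewrite ltr_wpDl.
exists (e / (`|k| + 1)); first exact: divr_gt0.
move=> y; rewrite ltr_pdivlMr// => h; apply: le_lt_trans h.
apply: (le_trans (kf x y)); rewrite mulrC ler_wpM2l ?rho_ge0//.
by apply: (le_trans (ler_norm k)); lra.
Qed.

Lemma lip1_continuous f : lip1 f -> rho_continuous rho f.
Proof.
move=> lf; apply: (lipschitz_continuous_rho 1) => x y; rewrite mul1r.
exact: le_trans (lf x y) (rho1_le x y).
Qed.

Lemma lip1_measurable f : lip1 f -> measurable_fun setT f.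
Proof. by move=> /lip1_continuous/continuous_measurable_rho. Qed.

Lemma lip1_bdd f : lip1 f -> bdd f.
Proof.
move=> lf; exists (`|f point| + 1) => x.
rewrite -[f x](subrK (f point)); apply: (le_trans (ler_normD _ _)).
by rewrite addrC lerD2l; exact: le_trans (lf x point) (rho1_le1 _ _).
Qed.

Lemma lip1_itg (mu : probability E R) f : lip1 f -> itg mu f.
Proof. by move=> lf; apply: itg_bdd; [exact: lip1_measurable | exact: lip1_bdd]. Qed.

Lemma ball_measurable x e : measurable [set y | rho x y < e].
Proof.
apply: open_measurable_rho => y /= xy; exists (e - rho x y); first by rewrite subr_gt0.
by move=> z yz; apply: le_lt_trans (rho_tri x y z) _; lra.
Qed.

Lemma dense_seq : exists q : nat -> E, forall x (e : R), 0 < e -> exists n, rho (q n) x < e.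
Proof.
case: polish => _ _ [D [/countable_injP[f injf] dD]] _.
pose q n := xget point [set x | D x /\ f x = n].
exists q => x e e0; have [y Dy xy] := dD x e e0.
exists (f y); suff -> : q (f y) = y by rewrite rho_sym.
rewrite /q; case: xgetP => [z _ [Dz fz]|/(_ y)]; last by move=> h; exfalso; apply: h.
by apply: injf => //; rewrite inE.
Qed.

Definition cover (q : nat -> E) (e : R) (n : nat) : set E :=
  [set x | exists2 j, (j < n)%N & rho (q j) x < e].

Lemma cover_measurable q e n : measurable (cover q e n).
Proof.
rewrite (_ : cover q e n = \bigcup_(j in [set j | (j < n)%N]) [set x | rho (q j) x < e]).
  by apply: bigcup_measurable => j _; exact: ball_measurable.
by apply/seteqP; split => x [j jn xj]; exists j.
Qed.

Lemma cover_mono q e m n : (m <= n)%N -> cover q e m `<=` cover q e n.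
Proof. by move=> mn x [j jm xj]; exists j => //; exact: leq_trans jm mn. Qed.

Lemma cover_prob (q : nat -> E) (mu : probability E R) (e eta : R) :
  (forall x (e : R), 0 < e -> exists n, rho (q n) x < e) -> 0 < e -> 0 < eta ->
  exists n, 1 - eta <= fine (mu (cover q e n)).
Proof.
move=> dq e0 eta0.
have UT : \bigcup_n cover q e n = setT.
  apply/seteqP; split => // x _; have [n xn] := dq x e e0.
  by exists n.+1 => //; exists n.
have := @nondecreasing_cvg_mu _ _ _ mu (cover q e) (fun n => cover_measurable q e n).
rewrite UT [X in _ --> X](probability_setT mu) => /(_ measurableT).
have nd : nondecreasing_seq (cover q e).
  by move=> m n mn; apply/subsetPset; exact: cover_mono.
move=> /(_ nd) /fine_cvgP[_] /cvgrPdist_le /(_ _ eta0) [n _ Hn].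
exists n; have := Hn n (leqnn n); rewrite /= ler_norml; lra.
Qed.


(** The extra element [1] caps the distance and gives the empty set the distance [1]. *)
Definition distA (A : set E) (x : E) : R := inf ([set 1] `|` [set rho1 x y | y in A]).

Lemma distA_lb A x : has_lbound ([set 1] `|` [set rho1 x y | y in A]).
Proof. by exists 0 => _ [->|[y _ <-]]; [exact: ler01 | exact: rho1_ge0]. Qed.

Lemma distA_le A x y : A y -> distA A x <= rho1 x y.
Proof. by move=> Ay; apply: ge_inf; [exact: distA_lb | right; exists y]. Qed.

Lemma distA_le1 A x : distA A x <= 1.
Proof. by apply: ge_inf; [exact: distA_lb | left]. Qed.

Lemma distA_ge A x e : e <= 1 -> (forall y, A y -> e <= rho1 x y) -> e <= distA A x.
Proof.
move=> e1 H; apply: lb_le_inf; first by exists 1; left.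
by move=> _ [->//|[y Ay <-]]; exact: H.
Qed.

Lemma distA_ge0 A x : 0 <= distA A x.
Proof. by apply: distA_ge => // y _; exact: rho1_ge0. Qed.

Lemma distA0 A x : A x -> distA A x = 0.
Proof.
by move=> Ax; apply/eqP; rewrite eq_le distA_ge0 andbT -(rho1_xx x); exact: distA_le.
Qed.

Lemma distA_lip A : lip1 (distA A).
Proof.
have H x y : distA A x - distA A y <= rho1 x y.
  rewrite lerBlDl -lerBlDr; apply: distA_ge.
    by have := distA_le1 A x; have := rho1_ge0 x y; lra.
  by move=> z Az; have := distA_le A x z Az; have := rho1_tri x y z; lra.
move=> x y; rewrite ler_norml H andbT lerNl opprB.
by rewrite rho1_sym; exact: H.
Qed.

Lemma distA_gt0 G x : rho_open rho G -> G x -> 0 < distA (~` G) x.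
Proof.
move=> oG Gx; have [e e0 He] := oG x Gx.
apply: (@lt_le_trans _ _ (Num.min e 1)); first by rewrite lt_min e0 ltr01.
apply: distA_ge; first by rewrite ge_min lexx orbT.
move=> y nGy; rewrite /rho1 le_min !ge_min !lexx orbT andbT.
by rewrite leNgt; apply/orP; left; apply/negP => /He.
Qed.

(** Boundedness is built in, because [rho1] is at most [1]. *)
Definition BL (f : E -> R) : Prop := exists k : R, forall x y, `|f x - f y| <= k * rho1 x y.

Lemma BL_lip1 f : BL f -> exists2 k : R, 0 < k & lip1 (fun x => k^-1 * f x).
Proof.
move=> [k kf]; have k0 : 0 < `|k| + 1 by rewrite ltr_wpDl.
exists (`|k| + 1) => // x y; rewrite -mulrBr normrM gtr0_norm ?invr_gt0//.
rewrite ler_pdivrMl//; apply: le_trans (kf x y) _.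
by rewrite ler_wpM2r ?rho1_ge0//; apply: (le_trans (ler_norm k)); lra.
Qed.

Lemma lip1_BL f : lip1 f -> BL f.
Proof. by move=> lf; exists 1 => x y; rewrite mul1r. Qed.

Lemma BL_cst (r : R) : BL (fun=> r).
Proof. by exists 0 => x y; rewrite subrr normr0 mul0r. Qed.

Lemma BLD f g : BL f -> BL g -> BL (fun x => f x + g x).
Proof.
move=> [k kf] [l lg]; exists (k + l) => x y.
rewrite opprD addrACA (le_trans (ler_normD _ _))// mulrDl lerD//.
Qed.

Lemma BLZ (r : R) f : BL f -> BL (fun x => r * f x).
Proof.
move=> [k kf]; exists (`|r| * k) => x y.
by rewrite -mulrBr normrM -mulrA ler_wpM2l.
Qed.

Lemma BLN f : BL f -> BL (fun x => - f x).
Proof. by move=> [k kf]; exists k => x y; rewrite -opprD normrN. Qed.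

Lemma BLB f g : BL f -> BL g -> BL (fun x => f x - g x).
Proof. by move=> hf hg; apply: BLD => //; exact: BLN. Qed.

Lemma BL_comp_lip (h : R -> R) f : (forall a b, `|h a - h b| <= `|a - b|) -> BL f ->
  BL (fun x => h (f x)).
Proof. by move=> hh [k kf]; exists k => x y; exact: le_trans (hh _ _) (kf x y). Qed.

Lemma BL_clamp f : BL f -> BL (fun x => clamp (f x)).
Proof. exact: (BL_comp_lip _ _ clamp_lip). Qed.

Lemma BL_bdd f : BL f -> bdd f.
Proof.
move=> /BL_lip1[k k0 /lip1_bdd[M HM]]; exists (k * M) => x.
by have := HM x; rewrite normrM gtr0_norm ?invr_gt0// ler_pdivrMl.
Qed.

Lemma BL_continuous f : BL f -> rho_continuous rho f.
Proof.
move=> [k kf]; apply: (lipschitz_continuous_rho `|k|) => x y.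
apply: (le_trans (kf x y)); apply: (@le_trans _ _ (`|k| * rho1 x y)).
  by rewrite ler_wpM2r ?rho1_ge0// ler_norm.
by rewrite ler_wpM2l// rho1_le.
Qed.

Lemma BL_measurable f : BL f -> measurable_fun setT f.
Proof. by move=> /BL_continuous/continuous_measurable_rho. Qed.

Lemma BL_itg (mu : probability E R) f : BL f -> itg mu f.
Proof. by move=> hf; apply: itg_bdd; [exact: BL_measurable | exact: BL_bdd]. Qed.

Lemma BLM f g : BL f -> BL g -> BL (fun x => f x * g x).
Proof.
move=> hf hg; have [F HF] := BL_bdd _ hf; have [G HG] := BL_bdd _ hg.
case: hf => k kf; case: hg => l lg; exists (F * l + G * k) => x y.
have -> : f x * g x - f y * g y = f x * (g x - g y) + g y * (f x - f y) by ring.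
rewrite (le_trans (ler_normD _ _))// !normrM mulrDl -!mulrA.
by rewrite lerD// ler_pM.
Qed.

End Metric.

Section BoundedConvergence.
Context {R : realType} {d : measure_display} {T : measurableType d}.

Lemma Ex_bounded_cvg (mu : probability T R) (f_ : nat -> T -> R) (f : T -> R) (M : R) :
  (forall n, measurable_fun setT (f_ n)) -> measurable_fun setT f ->
  (forall n x, `|f_ n x| <= M) -> (forall x, f_ n x @[n --> \oo] --> f x) ->
  Ex mu (f_ n) @[n --> \oo] --> Ex mu f.
Proof.
move=> mf_ mf fM cf.
have [|||||fi _ H] := @dominated_convergence _ _ _ mu setT measurableT
  (fun n x => (f_ n x)%:E) (fun x => (f x)%:E) (fun=> M%:E).
- by move=> n; apply/measurable_EFinP.
- exact/measurable_EFinP.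
- by apply: aeW => x _; apply: cvg_EFin; [exact: nearW | exact: cf].
- exact: (itg_cst mu M).
- by apply: aeW => x n _ /=; rewrite lee_fin.
have if_ n : itg mu (f_ n) by apply: itg_bdd => //; exists M.
move: H; rewrite -(ExE mu f fi) (_ : (fun n => _) = (fun n => (Ex mu (f_ n))%:E)).
  by move=> /fine_cvgP[].
by apply/funext => n; rewrite ExE.
Qed.

End BoundedConvergence.

(** * Kantorovich duality *)

Section StepFunctions.
Context {R : realType} {d : measure_display} {T : measurableType d} {I : finType}.
Variable kap : T -> I.
Hypothesis mkap : forall i, measurable [set x | kap x = i].

Lemma itg_sum_fin (J : finType) (mu : probability T R) (F : J -> T -> R) :
  (forall i, itg mu (F i)) -> itg mu (fun x => \sum_i F i x) /\
  Ex mu (fun x => \sum_i F i x) = \sum_i Ex mu (F i).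
Proof.
move=> hF; elim: (index_enum J) => [|j s [IH1 IH2]].
  under eq_fun do rewrite big_nil.
  by rewrite big_nil Ex_cst; split => //; exact: itg_cst.
under eq_fun do rewrite big_cons.
by rewrite big_cons ExD// IH2; split => //; exact: itgD.
Qed.

Lemma step_sum (g : I -> R) x : g (kap x) = \sum_i g i * \1_[set x | kap x = i] x.
Proof.
rewrite (bigD1 (kap x)) //= indicE mem_set// mulr1 big1 ?addr0// => i ix.
by rewrite indicE memNset ?mulr0//= => xi; rewrite -xi eqxx in ix.
Qed.

Lemma step_Ex (mu : probability T R) (g : I -> R) :
  itg mu (fun x => g (kap x)) /\
  Ex mu (fun x => g (kap x)) = \sum_i g i * fine (mu [set x | kap x = i]).
Proof.
under eq_fun do rewrite step_sum.
have [h1 h2] := itg_sum_fin I mu (fun i x => g i * \1_[set x | kap x = i] x)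
  (fun i => itgZ _ _ _ (itg_indic _ _ (mkap i))).
split => //; rewrite h2; apply: eq_bigr => i _.
by rewrite ExZ ?Ex_indic//; exact: itg_indic.
Qed.

End StepFunctions.

Section Density.
Context {R : realType} {d : measure_display} {T : measurableType d}.

Lemma density_probability (m : probability T R) (G : T -> R) :
  itg m G -> (forall z, 0 <= G z) -> Ex m G = 1 ->
  exists P : probability T R, forall C, measurable C ->
    fine (P C) = Ex m (fun z => G z * \1_C z).
Proof.
move=> iG G0 G1.
have mG : measurable_fun setT (fun z => (G z)%:E) by exact/measurable_EFinP/(itg_meas m).
have [||||P HP] := @mk_probability R d T (fun C => (\int[m]_(z in C) (G z)%:E)%E).
- exact: integral_set0.
- by move=> C; apply: integral_ge0 => z _; rewrite lee_fin.
- by apply: semi_sigma_additive_nng_induced => // z; rewrite lee_fin.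
- by rewrite -ExE// G1.
exists P => C mC; rewrite HP /Ex /Rintegral; congr fine.
rewrite [LHS]integral_mkcond epatch_indic; apply: eq_integral => z _ /=.
by rewrite EFinM.
Qed.

End Density.

Section KR.
Context {R : realType} {d : measure_display} {E : measurableType d}.
Variable rho : E -> E -> R.
Hypothesis polish : polish_borel rho.

(** Open sets are stable under intersection and generate the sigma-field, and the indicator of an
    open set is the limit of truncated multiples of the distance to its complement. *)
Lemma prob_eq_BL (mu nu : probability E R) :
  (forall f, BL rho f -> Ex mu f = Ex nu f) -> forall A, measurable A -> mu A = nu A.
Proof.
move=> H; apply: (measure_unique (rho_open rho) (fun=> setT)) => //.
- by case: polish.
- move=> A B oA oB x [Ax Bx]; have [e1 e10 h1] := oA x Ax; have [e2 e20 h2] := oB x Bx.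
  exists (Num.min e1 e2); first by rewrite lt_min e10.
  by move=> y; rewrite lt_min => /andP[/h1 ? /h2 ?].
- by move=> _ x _; exists 1.
- by rewrite bigcup_const.
- move=> G oG; have mG := open_measurable_rho _ polish _ oG.
  pose f n x := clamp (n%:R * distA rho (~` G) x).
  have fBL n : BL rho (f n).
    by apply/BL_clamp/BLZ/lip1_BL; exact: (distA_lip rho polish).
  have fG x : f n x @[n --> \oo] --> (\1_G x : R).
    rewrite indicE; have [/set_mem Gx|/negP nGx] := boolP (x \in G).
      have d0 : 0 < distA rho (~` G) x by exact: distA_gt0.
      apply: cvg_near_cst; have [N [N0 HN]] := inv_natr_small _ d0.
      exists N => // n /= Nn; rewrite /f.
      rewrite clamp1//.
      apply: (@le_trans _ _ (N%:R * distA rho (~` G) x)).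
        by rewrite -ler_pdivrMl ?ltr0n// mulr1.
      by rewrite ler_wpM2r ?(ltW d0)// ler_nat.
    have nG : (~` G) x by move=> Gx; apply: nGx; rewrite inE.
    under eq_fun do rewrite /f distA0// mulr0 clamp0//.
    exact: cvg_cst.
  have cvgf m := Ex_bounded_cvg m f (\1_G) 1 (fun n => BL_measurable _ polish _ (fBL n))
     (measurable_indic mG) _ fG.
  have f1 n x : `|f n x| <= 1.
    by rewrite ger0_norm ?clamp_ge0// clamp_le1.
  have c1 := cvgf f1 mu; have c2 := cvgf f1 nu.
  have E12 : (fun n => Ex mu (f n)) = (fun n => Ex nu (f n)).
    by apply/funext => n; exact: H.
  rewrite E12 in c1; have := cvg_unique (@Rhausdorff R) c1 c2.
  by rewrite !Ex_indic// => h; rewrite -[LHS](prob_fine mu _ mG) -[RHS](prob_fine nu _ mG) h.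
- by move=> _; rewrite [X in (X < _)%E](probability_setT mu) ltry.
Qed.

Variables (q : nat -> E) (e : R) (n : nat).

(** Each point goes to the first ball that contains it. When there is none, [find] returns [n], so
    the last cell collects what the cover misses. *)
Definition cell (x : E) : nat := find (fun j => rho (q j) x < e) (iota 0 n).

Lemma cell_lt x : (cell x < n.+1)%N.
Proof. by rewrite ltnS /cell -{2}(size_iota 0 n); exact: find_size. Qed.

Definition kap (x : E) : 'I_n.+1 := Ordinal (cell_lt x).

Lemma kap_measurable i : measurable [set x | kap x = i].
Proof.
rewrite (_ : [set x | kap x = i] = [set x | cell x = i]); last first.
  apply/seteqP; split => x /=; first by move=> <-.
  by move=> h; apply/val_inj.
rewrite /cell; move: (nat_of_ord i) => {i}i.
elim: (iota 0 n) i => [|j s IH] [|i] /=.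
- by rewrite (_ : [set x | _] = setT)//; apply/seteqP; split.
- by rewrite (_ : [set x | _] = set0)//; apply/seteqP; split.
- rewrite (_ : [set x | _] = [set x | rho (q j) x < e]); first exact: ball_measurable.
  by apply/seteqP; split => x /=; case: ifP.
- rewrite (_ : [set x | _] = ~` [set x | rho (q j) x < e] `&`
     [set x | find (fun j => rho (q j) x < e) s = i]).
    by apply: measurableI; [apply: measurableC; exact: ball_measurable | exact: IH].
  apply/seteqP; split => x /=; first by case: ifP => //= h [<-].
  by move=> [/negP/negbTE -> ->].
Qed.

Lemma kap_dist x : 0 < e -> rho1 rho (q (kap x)) x <= e + (kap x == ord_max)%:R.
Proof.
move=> e0; have [kn|kn] := eqVneq (kap x) ord_max.
  by apply: le_trans (rho1_le1 _ _ _) _; rewrite lerDr ltW.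
rewrite addr0; apply: le_trans (rho1_le _ _ _) _.
have kn' : (cell x < n)%N.
  rewrite ltn_neqAle -ltnS cell_lt andbT; apply: contra kn => /eqP h.
  by apply/eqP/val_inj.
have hs : has (fun j => rho (q j) x < e) (iota 0 n) by rewrite has_find size_iota.
have := nth_find 0%N hs; rewrite -/(cell x) nth_iota// add0n.
exact: ltW.
Qed.

Lemma kap_max (mu : probability E R) : 1 - e <= fine (mu (cover rho q e n)) ->
  fine (mu [set x | kap x = ord_max]) <= e.
Proof.
move=> h; have mc := cover_measurable _ polish q e n.
have sub : [set x | kap x = ord_max] `<=` ~` cover rho q e n.
  move=> x /= kx [j jn xj].
  have /= := congr1 val kx; rewrite /cell => ck.
  have hs : has (fun j => rho (q j) x < e) (iota 0 n).
    by apply/hasP; exists j => //; rewrite mem_iota.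
  by move: hs; rewrite has_find size_iota ck ltnn.
apply: (@le_trans _ _ (fine (mu (~` cover rho q e n)))).
  by apply: prob_le => //; [exact: kap_measurable | exact: measurableC].
by rewrite prob_setC//; lra.
Qed.

(** Each cell is represented by a centre, which reduces duality to finite transport. The dual side
    loses [4 * e] through the discretization of two expectations, the cost of the plan another
    [4 * e] through the cell sizes and the two remainder cells. *)
Lemma KR_approx (mu nu : probability E R) (b : R) : 0 < e ->
  1 - e <= fine (mu (cover rho q e n)) -> 1 - e <= fine (nu (cover rho q e n)) ->
  (forall f, lip1 rho f -> Ex mu f <= Ex nu f + b) ->
  exists2 lam : probability (E * E)%type R, is_coupling mu nu lam &
    (\int[lam]_z (rho1 rho z.1 z.2)%:E <= (b + 8 * e)%:E)%E.
Proof.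
move=> e0 hmu hnu H.
pose A i := [set x | kap x = i].
have mA i : measurable (A i) by exact: kap_measurable.
pose p i := fine (mu (A i)); pose p' i := fine (nu (A i)).
have p0 i : 0 <= p i by rewrite fine_ge0.
have p'0 i : 0 <= p' i by rewrite fine_ge0.
have sumI (m : probability E R) (B : set E) : measurable B ->
    \sum_i fine (m (B `&` A i)) = fine (m B).
  move=> mB; rewrite -(Ex_indic m B mB).
  have [_ h] := itg_sum_fin 'I_n.+1 m (fun i => \1_(B `&` A i))
    (fun i => itg_indic _ _ (measurableI _ _ mB (mA i))).
  have -> : (\1_B : E -> R) = (fun x => \sum_i \1_(B `&` A i) x).
    apply/funext => x; rewrite (bigD1 (kap x)) //= big1 ?addr0.
      have xA : x \in A (kap x) by rewrite inE.
      by rewrite !indicE in_setI xA andbT.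
    move=> i ix; rewrite indicE in_setI; suff -> : (x \in A i) = false by rewrite andbF.
    by rewrite memNset//= => xi; rewrite -xi eqxx in ix.
  by rewrite h; apply: eq_bigr => i _; rewrite Ex_indic//; exact: measurableI.
have sum1 (m : probability E R) : \sum_i fine (m (A i)) = 1.
  have := sumI m setT measurableT; under eq_bigr do rewrite setTI.
  by move=> ->; rewrite [X in fine X](probability_setT m).
(* A point is within [e] of its centre except on the last cell, where the distance is at most [1]
   and the mass at most [e]. *)
have stepE (m : probability E R) (f : E -> R) : lip1 rho f ->
    1 - e <= fine (m (cover rho q e n)) ->
    `|\sum_(i < n.+1) f (q i) * fine (m (A i)) - Ex m f| <= 2 * e.
  move=> lf hm; have [i1 <-] := step_Ex kap kap_measurable m (fun i : 'I_n.+1 => f (q i)).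
  have i2 := lip1_itg _ polish m _ lf.
  have [i3 E3] := step_Ex kap kap_measurable m (fun i : 'I_n.+1 => e + (i == ord_max)%:R).
  rewrite -ExB//; apply: le_trans (Ex_norm_le _ _ _ (itgB _ _ _ i1 i2) i3 _) _.
    by move=> x; apply: le_trans (lf _ _) (kap_dist x e0).
  rewrite E3; under eq_bigr do rewrite mulrDl.
  rewrite big_split /= -mulr_sumr sum1 mulr1 (bigD1 ord_max) //= eqxx mul1r big1 ?addr0.
    by have := kap_max m hm; lra.
  by move=> i /negbTE ->; rewrite mul0r.
have [||||u v Huv|la [la0 lap lap' lac]] :=
  @finite_transport R n.+1 p p' (fun i j => rho1 rho (q i) (q j)) (b + 4 * e).
- exact: p0.
- exact: p'0.
- exact: sum1.
- exact: sum1.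
(* The infimum [f] of the functions [rho1 x (q j) - v j] extends a finite dual pair to the whole
   space: it is [1]-Lipschitz, at least [u] at the centres, and at most [- v] there. *)
- pose S x := [set rho1 rho x (q (nat_of_ord j)) - v j | j in [set: 'I_n.+1]].
  pose f x := inf (S x).
  have lbS x : has_lbound (S x).
    exists (u ord0 - 1) => _ [j _ <-]; have := Huv ord0 j.
    by have := rho1_le1 rho (q (@ord0 n)) (q j); have := rho1_ge0 _ polish x (q j); lra.
  have neS x : S x !=set0 by exists (rho1 rho x (q (@ord0 n)) - v ord0), ord0.
  have fle x j : f x <= rho1 rho x (q (nat_of_ord j)) - v j.
    by apply: ge_inf => //; exists j.
  have lf : lip1 rho f.
    have h x y : f x - f y <= rho1 rho x y.
      rewrite lerBlDl -lerBlDr; apply: lb_le_inf => // _ [j _ <-].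
      by have := fle x j; have := rho1_tri _ polish x y (q j); lra.
    by move=> x y; rewrite ler_norml h andbT lerNl opprB (rho1_sym _ polish); exact: h.
  have fu i : u i <= f (q (nat_of_ord i)).
    by apply: lb_le_inf => // _ [j _ <-]; have := Huv i j; lra.
  have fv j : v j <= - f (q (nat_of_ord j)).
    by have := fle (q j) j; rewrite (rho1_xx _ polish); lra.
  have h1 := stepE mu f lf hmu; have h2 := stepE nu f lf hnu; have h3 := H f lf.
  have h4 : \sum_i p i * u i <= \sum_(i < n.+1) f (q i) * p i.
    by apply: ler_sum => i _; rewrite mulrC ler_wpM2r.
  have h5 : \sum_j p' j * v j <= - \sum_(i < n.+1) f (q i) * p' i.
    rewrite -sumrN; apply: ler_sum => i _; rewrite -mulNr mulrC ler_wpM2r//.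
  by move: h1 h2; rewrite !ler_norml -/(p _) => /andP[_ h1] /andP[h2 _]; rewrite /p /p' in h4 h5 *; lra.
have la_p i j : p i = 0 -> la i j = 0.
  move=> pi0; have := lap i; rewrite pi0 => /psumr_eq0P h; exact: h.
have la_p' i j : p' j = 0 -> la i j = 0.
  move=> pi0; have := lap' j; rewrite pi0 => /psumr_eq0P h; exact: (h (fun i _ => la0 i j)).
(* The finite plan is spread over the cells by a density with respect to the product measure. A zero
   denominator is harmless because [la i j] then vanishes as well. *)
pose w i j := la i j / (p i * p' j).
have wE i j : w i j * (p i * p' j) = la i j.
  have [pi0|pi0] := eqVneq (p i) 0; first by rewrite pi0 mul0r mulr0 la_p.
  have [pj0|pj0] := eqVneq (p' j) 0; first by rewrite pj0 mulr0 mulr0 la_p'.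
  by rewrite /w divfK// mulf_neq0.
have w0 i j : 0 <= w i j by rewrite divr_ge0// mulr_ge0.
pose m : probability (E * E)%type R := (mu \x nu)%E.
have mprod B C : measurable B -> measurable C -> fine (m (B `*` C)) = fine (mu B) * fine (nu C).
  by move=> mB mC; rewrite /m /= product_measure1E// fineM ?fin_num_measure.
pose kap2 (z : E * E) := (kap z.1, kap z.2).
have kap2E i j : [set z | kap2 z = (i, j)] = A i `*` A j.
  by apply/seteqP; split => -[x y] /=; [case | move=> [/= <- <-]].
have mk2 ij : measurable [set z | kap2 z = ij].
  by case: ij => i j; rewrite kap2E; exact: measurableX.
pose G z := w (kap2 z).1 (kap2 z).2.
have [iG EG] := step_Ex kap2 mk2 m (fun ij => w ij.1 ij.2).
have EGC B C : measurable B -> measurable C -> Ex m (fun z => G z * \1_(B `*` C) z) =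
    \sum_i \sum_j w i j * (fine (mu (B `&` A i)) * fine (nu (C `&` A j))).
  move=> mB mC.
  have -> : (fun z => G z * \1_(B `*` C) z) =
      (fun z => \sum_(ij : 'I_n.+1 * 'I_n.+1) w ij.1 ij.2 * \1_((B `&` A ij.1) `*` (C `&` A ij.2)) z).
    apply/funext => z; rewrite /G (step_sum kap2 (fun ij => w ij.1 ij.2) z) mulr_suml.
    apply: eq_bigr => -[i j] _ /=; rewrite -mulrA; congr (_ * _).
    rewrite kap2E !indicE -natrM mulnb -in_setI; congr (_%:R).
    by congr (nat_of_bool (_ \in _)); apply/seteqP; split => -[x y] /=; tauto.
  have iI (ij : 'I_n.+1 * 'I_n.+1) : measurable ((B `&` A ij.1) `*` (C `&` A ij.2)).
    by apply: measurableX; exact: measurableI.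
  have [_ ->] := itg_sum_fin _ m (fun (ij : 'I_n.+1 * 'I_n.+1) z =>
      w ij.1 ij.2 * \1_((B `&` A ij.1) `*` (C `&` A ij.2)) z) (fun ij => itgZ _ _ _ (itg_indic _ _ (iI ij))).
  rewrite pair_big /=; apply: eq_bigr => -[i j] _ /=.
  rewrite ExZ ?Ex_indic//; [|exact: (iI (i, j))|exact: itg_indic _ _ (iI (i, j))].
  by rewrite mprod//; exact: measurableI.
have G1 : Ex m G = 1.
  rewrite EG /= -(sum1 mu) -[RHS](eq_bigr _ (fun i _ => lap i)) pair_big /=.
  by apply: eq_bigr => -[i j] _ /=; rewrite kap2E mprod// wE.
have [lam Hlam] := density_probability m G iG (fun z => w0 _ _) G1.
have lamM B C : measurable B -> measurable C -> fine (lam (B `*` C)) =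
    \sum_i \sum_j w i j * (fine (mu (B `&` A i)) * fine (nu (C `&` A j))).
  by move=> mB mC; rewrite Hlam ?EGC//; exact: measurableX.
have marg1 i (x : R) : 0 <= x <= p i -> \sum_j w i j * (x * p' j) = x.
  move=> /andP[x0 xp]; have [pi0|pi0] := eqVneq (p i) 0.
    have -> : x = 0 by apply/eqP; rewrite eq_le x0 andbT -pi0.
    by apply: big1 => j _; rewrite mul0r mulr0.
  rewrite (eq_bigr (fun j => la i j * (x / p i))); last by move=> j _; rewrite -wE; field.
  by rewrite -mulr_suml lap mulrC divfK.
have marg2 j (x : R) : 0 <= x <= p' j -> \sum_i w i j * (p i * x) = x.
  move=> /andP[x0 xp]; have [pi0|pi0] := eqVneq (p' j) 0.
    have -> : x = 0 by apply/eqP; rewrite eq_le x0 andbT -pi0.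
    by apply: big1 => i _; rewrite mulr0 mulr0.
  rewrite (eq_bigr (fun i => la i j * (x / p' j))); last by move=> i _; rewrite -wE; field.
  by rewrite -mulr_suml lap' mulrC divfK.
have bnd (mm : probability E R) B i : measurable B -> 0 <= fine (mm (B `&` A i)) <= fine (mm (A i)).
  move=> mB; have mBA := measurableI _ _ mB (mA i); rewrite fine_ge0//=.
  by apply: prob_le => //; exact: subIsetr.
exists lam.
  move=> B mB; split.
    rewrite -(prob_fine lam _ (measurableX mB measurableT)) -(prob_fine mu _ mB) lamM//.
    congr EFin; rewrite -(sumI mu B mB); apply: eq_bigr => i _.
    by under eq_bigr do rewrite setTI; exact: marg1 (bnd _ _ _ _).
  rewrite -(prob_fine lam _ (measurableX measurableT mB)) -(prob_fine nu _ mB) lamM//.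
  congr EFin; rewrite -(sumI nu B mB) exchange_big /=; apply: eq_bigr => j _.
  by under eq_bigr do rewrite setTI; exact: marg2 (bnd _ _ _ _).
(* A majorant of the cost that is constant on products of cells, so that its integral is a finite
   sum against [la]. *)
pose g (ij : 'I_n.+1 * 'I_n.+1) : R := rho1 rho (q ij.1) (q ij.2) +
   (2 * e + (ij.1 == ord_max)%:R + (ij.2 == ord_max)%:R).
have [ig Eg] := step_Ex kap2 mk2 lam g.
apply: (@le_trans _ _ (\int[lam]_z (g (kap2 z))%:E)%E).
  apply: ge0_le_integral_lower => z _; rewrite lee_fin ?(rho1_ge0 _ polish)//.
  have := kap_dist z.1 e0; have := kap_dist z.2 e0.
  have := rho1_tri _ polish z.1 (q (kap z.1)) z.2.
  have := rho1_tri _ polish (q (kap z.1)) (q (kap z.2)) z.2.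
  by rewrite (rho1_sym _ polish z.1 (q (kap z.1))) /g /=; lra.
rewrite -ExE// lee_fin Eg.
have lamA i j : fine (lam (A i `*` A j)) = la i j.
  rewrite lamM// (bigD1 i) //= [X in _ + X]big1 ?addr0.
    rewrite (bigD1 j) //= [X in _ + X]big1 ?addr0 ?setIid ?wE//.
    move=> k kj; rewrite (_ : A j `&` A k = set0) ?measure0 ?mulr0//.
    by apply/seteqP; split => x //= [xj xk]; rewrite -xj -xk eqxx in kj.
  move=> k ki; apply: big1 => l _; rewrite (_ : A i `&` A k = set0) ?measure0 ?mul0r ?mulr0//.
  by apply/seteqP; split => x //= [xj xk]; rewrite -xj -xk eqxx in ki.
have -> : \sum_ij g ij * fine (lam [set x | kap2 x = ij]) =
    \sum_i \sum_j la i j * rho1 rho (q i) (q j) + (2 * e + p ord_max + p' ord_max).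
  transitivity (\sum_i \sum_j (la i j * rho1 rho (q i) (q j) + (la i j * (2 * e) +
     (la i j * (i == ord_max)%:R + la i j * (j == ord_max)%:R)))).
    rewrite pair_big /=; apply: eq_bigr => -[i j] _; rewrite kap2E lamA /g /=; ring.
  under eq_bigr do rewrite !big_split /=.
  rewrite !big_split /=; congr (_ + _); rewrite -addrA; congr (_ + _).
    under eq_bigr do rewrite -mulr_suml lap.
    by rewrite -mulr_suml sum1 mul1r.
  congr (_ + _).
    under eq_bigr do rewrite -mulr_suml lap.
    rewrite (bigD1 ord_max) //= eqxx mulr1 big1 ?addr0// => i /negbTE ->; by rewrite mulr0.
  rewrite exchange_big /=.
  under eq_bigr do rewrite -mulr_suml lap'.
  rewrite (bigD1 ord_max) //= eqxx mulr1 big1 ?addr0// => i /negbTE ->; by rewrite mulr0.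
have h1 := kap_max mu hmu; have h2 := kap_max nu hnu.
by move: lac h1 h2; rewrite -/(p _) -/(p' _) /p /p'; lra.
Qed.

End KR.

Section KRtheorem.
Context {R : realType} {d : measure_display} {E : measurableType d}.
Variable rho : E -> E -> R.
Hypothesis polish : polish_borel rho.

Lemma wasserstein_le_dual (mu nu : probability E R) (b : R) :
  (forall f, lip1 rho f -> Ex mu f <= Ex nu f + b) ->
  (wasserstein (rho1 rho) mu nu <= b%:E)%E.
Proof.
move=> H; apply/lee_addgt0Pr => eps eps0.
have [q dq] := dense_seq _ polish.
(* [KR_approx] loses [8 * e]. *)
pose e := eps / 8; have e0 : 0 < e by rewrite divr_gt0.
have [n1 h1] := cover_prob _ polish q mu e e dq e0 e0.
have [n2 h2] := cover_prob _ polish q nu e e dq e0 e0.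
pose n := maxn n1 n2.
have mono (m : probability E R) k : (k <= n)%N ->
    fine (m (cover rho q e k)) <= fine (m (cover rho q e n)).
  move=> kn; have mc := cover_measurable _ polish q e.
  by apply: prob_le => //; exact: cover_mono.
have [lam clam hlam] := KR_approx _ polish q e n mu nu b e0
  (le_trans h1 (mono mu _ (leq_maxl _ _))) (le_trans h2 (mono nu _ (leq_maxr _ _))) H.
apply: (@le_trans _ _ (\int[lam]_z (rho1 rho z.1 z.2)%:E)%E).
  by apply: ereal_inf_lbound; exists lam.
apply: (le_trans hlam); rewrite -EFinD lee_fin lerD2l /e; lra.
Qed.

End KRtheorem.

(** * Limits of Cauchy sequences of probability measures *)

Lemma half_gt0 {R : realType} (e : R) : 0 < e -> 0 < e / 2.
Proof. by move=> e0; rewrite divr_gt0. Qed.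

Section Dini.
Context {R : realType} {d : measure_display} {E : measurableType d}.
Variable rho : E -> E -> R.
Hypothesis polish : polish_borel rho.
Variables (q : nat -> E) (K : set E).
Hypothesis tbK : forall k, exists n, K `<=` cover rho q k.+1%:R^-1 n.

(** Completeness replaces compactness. If no index worked on [K], some ball of each finite cover
    would keep a bad piece; points chosen in the nested pieces form a Cauchy sequence, and
    continuity at its limit gives a contradiction. The limit may lie outside [K], so the pointwise
    hypothesis concerns all of [E]. *)
Lemma dini (S : nat -> E -> R) (t : R) :
  (forall n, rho_continuous rho (S n)) -> (forall n x, S n x <= S n.+1 x) ->
  (forall x, exists n, t < S n x) -> exists n, forall x, K x -> t < S n x.
Proof.
move=> cS ndS St.
have ndS' m n x : (m <= n)%N -> S m x <= S n x.
  by move=> /subnK <-; elim: (n - m)%N => //= k IH; rewrite addSn; exact: le_trans IH (ndS _ _).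
pose bad (A : set E) := A `<=` K /\ forall n, exists2 x, A x & S n x <= t.
apply: contrapT => /forallNP nK.
have badK : bad K.
  split => // n; apply: contrapT => h; apply: (nK n) => x Kx.
  by rewrite ltNge; apply/negP => h2; apply: h; exists x.
pose ball j k := [set x | rho (q j) x < (k : nat).+1%:R^-1].
have step (Ak : set E * nat) : exists j, bad Ak.1 -> bad (Ak.1 `&` ball j Ak.2).
  case: Ak => A k /=; have [[AK bA]|nb] := pselect (bad A); last by exists 0%N.
  apply: contrapT => /forallNP H.
  (* Were every ball good, the largest of the finitely many indices of a cover would be good for all
     of [A]. *)
  have H' j : exists n, forall x, A x -> ball j k x -> t < S n x.
    apply: contrapT => /forallNP h; apply: (H j) => _; split; first by move=> x [/AK].
    move=> n; apply: contrapT => h2; apply: (h n) => x Ax bx.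
    by rewrite ltNge; apply/negP => h3; apply: h2; exists x.
  have [nj Hnj] := choice H'.
  have [N KN] := tbK k.
  have [x Ax Sx] := bA (\max_(j < N) nj j)%N.
  have [j jN xj] := KN x (AK x Ax).
  have := Hnj j x Ax xj; rewrite ltNge => /negP; apply; apply: le_trans Sx; apply: ndS'.
  exact: (leq_bigmax (F := fun j : 'I_N => nj j) (Ordinal jN)).
have [J HJ] := choice step.
pose A := fix A k := if k is k'.+1 then A k' `&` ball (J (A k', k')) k' else K.
have badA k : bad (A k) by elim: k => //= k IH; exact: (HJ (A k, k)).
have subA m n : (m <= n)%N -> A n `<=` A m.
  by move=> /subnK <-; elim: (n - m)%N => //= k IH x [/IH].
have Hex k : exists x, A k x /\ S k x <= t.
  by have [_ /(_ k)[x Ax Sx]] := badA k; exists x.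
have [x Hx] := choice Hex.
have cx : rho_cauchy rho x.
  move=> e e0; have [N [N0 Ne]] := inv_natr_small (e / 2) (half_gt0 _ e0).
  exists N.+1 => m n Nm Nn.
  have inb k : (N.+1 <= k)%N -> rho (q (J (A N, N))) (x k) < N.+1%:R^-1.
    by move=> Nk; have [/(subA _ _ Nk)[_]] := Hx k.
  have h1 := inb _ Nm; have h2 := inb _ Nn.
  have NN : N.+1%:R^-1 <= N%:R^-1 :> R by rewrite lef_pV2 ?posrE ?ltr0n// ler_nat.
  apply: le_lt_trans (rho_tri _ polish _ (q (J (A N, N))) _) _.
  rewrite (rho_sym _ polish (x m)) [e]splitr; apply: ltrD.
    exact: lt_le_trans h1 (le_trans NN Ne).
  exact: lt_le_trans h2 (le_trans NN Ne).
have [l xl] : exists l, rho_cvg rho x l by case: polish => _ + _ _; exact.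
have [n tn] := St l.
have [del del0 Hdel] := cS n l (S n l - t) ltac:(by rewrite subr_gt0).
have [N HN] := xl del del0.
pose k := maxn N n.
have := Hdel (x k); rewrite (rho_sym _ polish) => /(_ (HN k (leq_maxl _ _))).
have [_ h1] := Hx k; have h2 := ndS' n k (x k) (leq_maxr _ _).
rewrite ltr_norml; lra.
Qed.

End Dini.

Section Limit.
Context {R : realType} {d : measure_display} {E : measurableType d}.
Variable rho : E -> E -> R.
Hypothesis polish : polish_borel rho.
Variables (mu_ : nat -> probability E R) (eps_ : nat -> R) (Lam : (E -> R) -> R).
Hypothesis eps0 : eps_ n @[n --> \oo] --> 0.
Hypothesis cauchy : forall f, lip1 rho f -> forall m n,
  `|Ex (mu_ m) f - Ex (mu_ n) f| <= eps_ m + eps_ n.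
Hypothesis LamP : forall f, BL rho f -> Ex (mu_ n) f @[n --> \oo] --> Lam f.

Let BLitg m f : BL rho f -> itg m f. Proof. exact: BL_itg rho polish m f. Qed.

Lemma Lam_unique f (u : nat -> R) l : BL rho f -> (forall n, Ex (mu_ n) f = u n) ->
  u n @[n --> \oo] --> l -> Lam f = l.
Proof.
move=> hf fu ul; have E1 : (fun n => Ex (mu_ n) f) = u by apply/funext.
by have := LamP _ hf; rewrite E1 => h; exact: (cvg_unique (@Rhausdorff R) h ul).
Qed.

Lemma LamD f g : BL rho f -> BL rho g -> Lam (fun x => f x + g x) = Lam f + Lam g.
Proof.
move=> hf hg; apply: (Lam_unique _ (fun n => Ex (mu_ n) f + Ex (mu_ n) g)).
- exact: BLD.
- by move=> n; rewrite ExD//; exact: BLitg.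
- by apply: cvgD; exact: LamP.
Qed.

Lemma LamZ (r : R) f : BL rho f -> Lam (fun x => r * f x) = r * Lam f.
Proof.
move=> hf; apply: (Lam_unique _ (fun n => r * Ex (mu_ n) f)).
- exact: BLZ.
- by move=> n; rewrite ExZ//; exact: BLitg.
- by apply: cvgMr; exact: LamP.
Qed.

Lemma Lam_cst (r : R) : Lam (fun=> r) = r.
Proof.
apply: (Lam_unique _ (fun=> r)); [exact: BL_cst | by move=> n; rewrite Ex_cst | exact: cvg_cst].
Qed.

Lemma Lam_ge_Ex f (r : R) : BL rho f -> (forall n, r <= Ex (mu_ n) f) -> r <= Lam f.
Proof.
move=> hf H; rewrite -(cvg_lim (@Rhausdorff R) (LamP _ hf)).
by apply: limr_ge; [apply/cvg_ex; exists (Lam f); exact: LamP | exact: nearW].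
Qed.

Lemma Lam_ge0 f : BL rho f -> (forall x, 0 <= f x) -> 0 <= Lam f.
Proof. by move=> hf f0; apply: Lam_ge_Ex => // n; exact: Ex_ge0. Qed.

Lemma LamB f g : BL rho f -> BL rho g -> Lam (fun x => f x - g x) = Lam f - Lam g.
Proof.
move=> hf hg; have := LamD _ _ hf (BLZ _ (-1) _ hg); rewrite LamZ// mulN1r => <-.
by congr Lam; apply/funext => x; rewrite mulN1r.
Qed.

Lemma Lam_le f g : BL rho f -> BL rho g -> (forall x, f x <= g x) -> Lam f <= Lam g.
Proof.
move=> hf hg fg; rewrite -subr_ge0 -LamB//; apply: Lam_ge0; first exact: BLB.
by move=> x; rewrite subr_ge0.
Qed.

Lemma BL_sum (n : nat) (F : nat -> E -> R) : (forall i, BL rho (F i)) ->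
  BL rho (fun x => \sum_(i < n) F i x).
Proof.
move=> hF; elim: n => [|n IH].
  by under eq_fun do rewrite big_ord0; exact: BL_cst.
by under eq_fun do rewrite big_ord_recr /=; exact: BLD.
Qed.

Lemma Lam_sum (n : nat) (F : nat -> E -> R) : (forall i, BL rho (F i)) ->
  Lam (fun x => \sum_(i < n) F i x) = \sum_(i < n) Lam (F i).
Proof.
move=> hF; elim: n => [|n IH].
  by under eq_fun do rewrite big_ord0; rewrite big_ord0 Lam_cst.
under eq_fun do rewrite big_ord_recr /=.
by rewrite LamD ?IH ?big_ord_recr//; exact: BL_sum.
Qed.

(** A cover for one late index [N] serves all later ones: a function equal to [1] on balls of radius
    [e / 2] and to [0] off balls of radius [e] has nearly equal expectations under all of them. The
    finitely many earlier measures are covered one by one. *)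
Lemma uniform_cover (q : nat -> E) (e eta : R) :
  (forall x (e : R), 0 < e -> exists n, rho (q n) x < e) -> 0 < e <= 1 -> 0 < eta ->
  exists n, forall m, 1 - eta <= fine (mu_ m (cover rho q e n)).
Proof.
move=> dq /andP[e0 e1] eta0.
have e20 : 0 < e / 2 by rewrite divr_gt0.
(* The test function is Lipschitz only after multiplication by [e / 2]. Two errors of this size,
   divided by [e / 2], leave [eta / 2], and the cover for [N] uses the other half. *)
have eta40 : 0 < eta * e / 8 by rewrite !mulr_gt0// invr_gt0.
have /cvgrPdist_le /(_ _ eta40) [N _ HN] := eps0.
have {}HN m : (N <= m)%N -> eps_ m <= eta * e / 8.
  by move=> /HN /=; rewrite sub0r normrN; exact: le_trans (ler_norm _).
have mc := cover_measurable _ polish q.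
have [n1 hn1] := cover_prob _ polish q (mu_ N) (e / 2) (eta / 2) dq e20 (half_gt0 _ eta0).
have [n2 hn2] : exists n2, forall m, (m < N)%N -> 1 - eta <= fine (mu_ m (cover rho q e n2)).
  elim: (N) => [|k [n IH]]; first by exists 0%N.
  have [n' hn'] := cover_prob _ polish q (mu_ k) e eta dq e0 eta0.
  exists (maxn n n') => m; rewrite ltnS leq_eqVlt => /predU1P[->|mk].
    by apply: le_trans hn' _; apply: prob_le => //; apply: cover_mono; exact: leq_maxr.
  by apply: le_trans (IH _ mk) _; apply: prob_le => //; apply: cover_mono; exact: leq_maxl.
exists (maxn n1 n2) => m; have [mN|Nm] := ltnP m N.
  by apply: le_trans (hn2 _ mN) _; apply: prob_le => //; apply: cover_mono; exact: leq_maxr.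
apply: (@le_trans _ _ (fine (mu_ m (cover rho q e n1)))); last first.
  by apply: prob_le => //; apply: cover_mono; exact: leq_maxl.
pose h x := clamp (1 - (2 / e) * distA rho (cover rho q (e / 2) n1) x).
have bh : BL rho h.
  apply/BL_clamp/BLB; [exact: BL_cst | apply/BLZ/lip1_BL; exact: (distA_lip rho polish)].
have lh : lip1 rho (fun x => (e / 2) * h x).
  move=> x y; rewrite -mulrBr normrM gtr0_norm//.
  apply: (@le_trans _ _ (e / 2 * `|2 / e * distA rho (cover rho q (e / 2) n1) y -
      2 / e * distA rho (cover rho q (e / 2) n1) x|)).
    rewrite ler_pM2l//; apply: le_trans (clamp_lip _ _) _.
    by rewrite (_ : _ - _ = 2 / e * distA rho (cover rho q (e / 2) n1) y -
      2 / e * distA rho (cover rho q (e / 2) n1) x)//; ring.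
  rewrite -mulrBr normrM gtr0_norm ?divr_gt0// mulrA.
  rewrite (_ : e / 2 * (2 / e) = 1) ?mul1r; last by field; exact: lt0r_neq0.
  by rewrite distrC; exact: (distA_lip rho polish).
have up k : Ex (mu_ k) h <= fine (mu_ k (cover rho q e n1)).
  rewrite -Ex_indic//; apply: Ex_le; [exact: BLitg | exact: itg_indic |].
  move=> x; rewrite indicE; have [|/negP nx] := boolP (x \in _); first by rewrite clamp_le1.
  rewrite /h clamp0// subr_le0 -ler_pdivrMl ?divr_gt0// mulr1 invf_div.
  apply: distA_ge; first by lra.
  move=> y [j jn yj]; rewrite /rho1 le_min; apply/andP; split; last by lra.
  rewrite leNgt; apply/negP => xy; apply: nx; rewrite inE; exists j => //.
  by apply: le_lt_trans (rho_tri _ polish _ y _) _; rewrite (rho_sym _ polish y); lra.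
have low : fine (mu_ N (cover rho q (e / 2) n1)) <= Ex (mu_ N) h.
  rewrite -Ex_indic//; apply: Ex_le; [exact: itg_indic | exact: BLitg |].
  move=> x; rewrite indicE; have [/set_mem nx|_] := boolP (x \in _); last by rewrite clamp_ge0.
  by rewrite /h distA0// mulr0 subr0 clamp1.
have := cauchy _ lh m N; rewrite (ExZ _ _ _ (BLitg (mu_ m) _ bh)) (ExZ _ _ _ (BLitg (mu_ N) _ bh)) -mulrBr normrM gtr0_norm//.
have := HN _ Nm; have := HN _ (leqnn N) => h1 h2 h3.
have h4 : `|Ex (mu_ m) h - Ex (mu_ N) h| <= eta / 2.
  rewrite -(ler_pM2l e20); apply: le_trans h3 _; lra.
have := up m; move: h4; rewrite ler_norml => /andP[h4 _]; lra.
Qed.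

(** The set is an intersection of finite covers of radii [1 / k.+1] that miss mass at most
    [eta / 2 ^+ k.+1]; it is totally bounded, which is what [dini] asks of it. *)
Lemma tight (q : nat -> E) (eta : R) :
  (forall x (e : R), 0 < e -> exists n, rho (q n) x < e) -> 0 < eta ->
  exists K : set E, [/\ measurable K, (forall k, exists n, K `<=` cover rho q k.+1%:R^-1 n) &
    forall m, 1 - eta <= fine (mu_ m K)].
Proof.
move=> dq eta0.
have H k : exists n, forall m, 1 - eta / 2 ^+ k.+1 <= fine (mu_ m (cover rho q k.+1%:R^-1 n)).
  apply: uniform_cover => //; last by rewrite divr_gt0// exprn_gt0.
  by rewrite invr_gt0 ltr0n /= invf_le1 ?ltr0n// ler1n.
have [nk Hnk] := choice H.
pose C k := cover rho q k.+1%:R^-1 (nk k).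
have mC k : measurable (C k) by exact: (cover_measurable rho polish).
exists (\bigcap_k C k); split.
- exact: bigcapT_measurable.
- by move=> k; exists (nk k) => x /(_ k Logic.I).
- move=> m; have mK : measurable (\bigcap_k C k) by exact: bigcapT_measurable.
  suff : fine (mu_ m (~` \bigcap_k C k)) <= eta by rewrite prob_setC//; lra.
  rewrite -lee_fin prob_fine ?setC_bigcap//; last by rewrite -setC_bigcap; exact: measurableC.
  apply: le_trans (measure_sigma_subadditive (mu_ m) (F := fun k => ~` C k) _ _ _) _.
  + by move=> k; exact: measurableC.
  + by apply: bigcupT_measurable => k; exact: measurableC.
  + by move=> x [k _ h]; exists k.
  apply: (@le_trans _ _ (\sum_(0 <= k <oo) (eta / 2 ^+ k.+1)%:E)%E).
    apply: lee_nneseries => [k _ _|k _]; first exact: measure_ge0.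
    rewrite -[X in (X <= _)%E](prob_fine (mu_ m) _ (measurableC (mC k))) lee_fin prob_setC//.
    by have := Hnk k m; rewrite -/(C k); lra.
  apply: lime_le.
    by apply: is_cvg_nneseries => k _ _; rewrite lee_fin divr_ge0 ?(ltW eta0) ?exprn_ge0.
  apply: nearW => n; rewrite sumEFin lee_fin big_mkord.
  by apply: sum_geometric_le; exact: ltW.
Qed.

(** The sequence [h] stands for a lower semicontinuous majorant of the indicator of [A]. Exceeding
    every [t < 1] says that its supremum is at least [1] on [A] without naming that supremum, which
    may be infinite. *)
Definition covers (c : R) (A : set E) : Prop := exists h : nat -> E -> R,
  [/\ (forall n, BL rho (h n)), (forall n x, 0 <= h n x), (forall n x, h n x <= h n.+1 x),
      (forall n, Lam (h n) <= c) & forall x, A x -> forall t, t < 1 -> exists n, t < h n x].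

(* Daniell's outer measure: countable subadditivity holds by construction because the diagonal
   sums of the covering sequences are again a covering sequence. *)
Definition mo (A : set E) : R := inf [set c | covers c A].

Lemma covers1 A : covers 1 A.
Proof.
exists (fun _ _ => 1); split => // [n|n|x _ t t1]; [exact: BL_cst | by rewrite Lam_cst | by exists 0%N].
Qed.

Lemma covers_ge0 c A : covers c A -> 0 <= c.
Proof. by move=> [h [h1 h2 _ h4 _]]; apply: le_trans (h4 0%N); exact: Lam_ge0. Qed.

Lemma mo_lb A : has_lbound [set c | covers c A].
Proof. by exists 0 => c; exact: covers_ge0. Qed.

Lemma mo_ge0 A : 0 <= mo A.
Proof. by apply: lb_le_inf; [exists 1; exact: covers1 | move=> c /covers_ge0]. Qed.

Lemma mo_le c A : covers c A -> mo A <= c.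
Proof. by move=> h; apply: ge_inf => //; exact: mo_lb. Qed.

Lemma mo_approx A (e : R) : 0 < e -> exists2 c, covers c A & c < mo A + e.
Proof.
move=> e0; have [|c h1 h2] := @inf_adherent _ [set c | covers c A] e e0; last by exists c.
by split; [exists 1; exact: covers1 | exact: mo_lb].
Qed.

Lemma mo_mono A B : A `<=` B -> mo A <= mo B.
Proof.
move=> AB; apply/ler_addgt0Pr => e e0; have [c [h [h1 h2 h3 h4 h5]] ce] := mo_approx B e e0.
apply: le_trans (ltW ce); apply: mo_le; exists h; split => // x /AB; exact: h5.
Qed.

Lemma mo0 : mo set0 = 0.
Proof.
apply/eqP; rewrite eq_le mo_ge0 andbT; apply: mo_le.
exists (fun _ _ => 0); split => // [n|n]; [exact: BL_cst | by rewrite Lam_cst].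
Qed.

Lemma mo_subadditive : sigma_subadditive (fun A => (mo A)%:E).
Proof.
move=> A; have [Sy|Sf] := eqVneq (\sum_(0 <= i <oo) (mo (A i))%:E)%E +oo%E.
  by rewrite Sy leey.
have ge0 i : (0 <= (mo (A i))%:E)%E by rewrite lee_fin mo_ge0.
have Sfin : (\sum_(0 <= i <oo) (mo (A i))%:E)%E \is a fin_num.
  rewrite ge0_fin_numE ?ltey//; exact: nneseries_ge0.
rewrite -(fineK Sfin) lee_fin; set S := fine _.
have partial n : \sum_(i < n) mo (A i) <= S.
  rewrite -lee_fin fineK// -sumEFin -(big_mkord xpredT (fun i => (mo (A i))%:E)).
  exact: nneseries_lim_ge.
apply/ler_addgt0Pr => e e0.
have ek k : 0 < e / 2 ^+ k.+1 by rewrite divr_gt0// exprn_gt0.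
have Hex i : exists c, covers c (A i) /\ c < mo (A i) + e / 2 ^+ i.+1.
  by have [c] := mo_approx (A i) _ (ek i); exists c.
have [c Hc] := choice Hex.
have [h Hh] := choice (fun i => (Hc i).1).
have hB i n : BL rho (h i n) by have [] := Hh i.
have h0 i n x : 0 <= h i n x by have [] := Hh i.
have hS i n x : h i n x <= h i n.+1 x by have [] := Hh i.
have hc i n : Lam (h i n) <= c i by have [] := Hh i.
apply: mo_le; exists (fun n x => \sum_(i < n) h i n x); split.
- by move=> n; exact: (BL_sum n (fun i => h i n)).
- by move=> n x; apply: sumr_ge0.
- move=> n x; rewrite big_ord_recr /=; apply: ler_wpDr => //.
  by apply: ler_sum.
- move=> n; rewrite (Lam_sum n (fun i => h i n))//.
  apply: (@le_trans _ _ (\sum_(i < n) (mo (A i) + e / 2 ^+ i.+1))).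
    by apply: ler_sum => i _; apply: le_trans (hc _ _) (ltW (Hc i).2).
  by rewrite big_split /=; apply: lerD; [exact: partial | apply: sum_geometric_le; exact: ltW].
- move=> x [i _ Ax] t t1; have [_ _ _ _ /(_ x Ax t t1)[n tn]] := Hh i.
  have mono m k : h i m x <= h i (m + k)%N x.
    by elim: k => [|k IH]; rewrite ?addn0// addnS; exact: le_trans IH (hS _ _ _).
  (* The index must exceed [i] for the [i]-th sequence to occur in the diagonal sum. *)
  exists (n + i.+1)%N; apply: lt_le_trans tn _.
  have iN : (i < n + i.+1)%N by rewrite addnS ltnS leq_addl.
  rewrite (bigD1 (Ordinal iN)) //=; apply: le_trans (mono n i.+1) _.
  by rewrite lerDl; apply: sumr_ge0.
Qed.

(** A covering sequence of [X] is split by Lipschitz functions [g k] increasing to the indicator of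
    [G]. The part on [G] uses the moving product [h n * g n]; the part off [G] uses [1 - g k] with
    [k] frozen where [u k] nearly reaches its supremum, so that the two values add up to at most
    [c + e / 2]. *)
Lemma mo_caratheodory G : rho_open rho G -> forall X, mo (X `&` G) + mo (X `&` ~` G) <= mo X.
Proof.
move=> oG X; apply/ler_addgt0Pr => e e0.
have e20 : 0 < e / 2 by rewrite divr_gt0.
have [c [h [h1 h2 h3 h4 h5]] ce] := mo_approx X _ e20.
pose g (k : nat) x := clamp (k%:R * distA rho (~` G) x).
have gB k : BL rho (g k) by apply/BL_clamp/BLZ/lip1_BL; exact: (distA_lip rho polish).
have gS k x : g k x <= g k.+1 x.
  by apply: clamp_le; rewrite ler_wpM2r ?distA_ge0// ler_nat.
have mono (u : nat -> R) : (forall n, u n <= u n.+1) -> forall m n, (m <= n)%N -> u m <= u n.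
  by move=> uS m n /subnK <-; elim: (n - m)%N => //= k IH; rewrite addSn; exact: le_trans IH (uS _).
pose u n := Lam (fun x => h n x * g n x).
have hgB n k : BL rho (fun x => h n x * g k x) by exact: BLM.
have uS n : u n <= u n.+1.
  apply: Lam_le => // x; apply: ler_pM => //; exact: clamp_ge0.
have uc n : u n <= c.
  apply: le_trans (h4 n); apply: Lam_le => // x; rewrite ler_piMr//; exact: clamp_le1.
pose c1 := sup (range u).
have ub : has_ubound (range u) by exists c => _ [n _ <-].
have uc1 n : u n <= c1 by apply: ub_le_sup => //; exists n.
have [_ [k _ <-] hk] := @sup_adherent R (range u) (e / 2) e20 (conj (ex_intro _ (u 0%N) (ex_intro2 _ _ 0%N Logic.I erefl)) ub).
have G1 : mo (X `&` G) <= c1.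
  apply: mo_le; exists (fun n x => h n x * g n x); split => //.
  - by move=> n x; apply: mulr_ge0 => //; exact: clamp_ge0.
  - by move=> n x; apply: ler_pM => //; exact: clamp_ge0.
  - move=> x [Xx Gx] t t1; have [n0 tn0] := h5 x Xx t t1.
    have d0 : 0 < distA rho (~` G) x by exact: distA_gt0.
    have [N [N0 HN]] := inv_natr_small _ d0.
    exists (maxn n0 N); rewrite /g clamp1 ?mulr1.
      by apply: lt_le_trans tn0 _; apply: (mono (fun n => h n x)) => //; exact: leq_maxl.
    apply: (@le_trans _ _ (N%:R * distA rho (~` G) x)).
      by rewrite -ler_pdivrMl ?ltr0n// mulr1.
    by rewrite ler_wpM2r ?(ltW d0)// ler_nat leq_maxr.
have G2 : mo (X `&` ~` G) <= c - u k.
  apply: mo_le; exists (fun n x => h (k + n)%N x * (1 - g k x)); split.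
  - by move=> n; apply: BLM => //; apply: BLB => //; exact: BL_cst.
  - by move=> n x; rewrite mulr_ge0// subr_ge0 clamp_le1.
  - by move=> n x; rewrite addnS ler_wpM2r// subr_ge0 clamp_le1.
  - move=> n; rewrite (_ : (fun x => _) = (fun x => h (k + n)%N x - h (k + n)%N x * g k x)); last first.
      by apply/funext => x; ring.
    rewrite LamB//; apply: lerB => //; apply: Lam_le => // x.
    apply: ler_wpM2r; first exact: clamp_ge0.
    by apply: (mono (fun n => h n x)) => //; exact: leq_addr.
  - move=> x [Xx nGx] t t1; have [n tn] := h5 x Xx t t1.
    exists n; rewrite /g distA0// mulr0 clamp0// subr0 mulr1.
    by apply: lt_le_trans tn _; apply: (mono (fun n => h n x)) => //; exact: leq_addl.
by move: hk; rewrite -/c1; lra.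
Qed.

(** The only place where mass could be lost in the limit: tightness and [dini] make a single term of
    a covering sequence exceed [1 - e'] on a set of mass at least [1 - e'] under every [mu_ m]. *)
Lemma mo_setT : mo setT = 1.
Proof.
apply/eqP; rewrite eq_le (mo_le _ _ (covers1 _)) /=.
apply: lb_le_inf; first by exists 1; exact: covers1.
move=> c [h [h1 h2 h3 h4 h5]]; apply/ler_addgt0Pr => e e0.
(* Half of [e] gives a squared factor of at least [1 - e], and the cap at [1] keeps the factor
   nonnegative. *)
pose e' := Num.min (e / 2) 1.
have e'0 : 0 < e' by rewrite lt_min divr_gt0//=.
have e'1 : e' <= 1 by rewrite ge_min lexx orbT.
have e'e : e' <= e / 2 by rewrite ge_min lexx.
have [q dq] := dense_seq _ polish.
have [K [mK tbK muK]] := tight q e' dq e'0.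
have [|||n Hn] := dini _ polish q K tbK h (1 - e').
- by move=> n; exact: (BL_continuous rho polish).
- exact: h3.
- by move=> x; apply: h5 => //; lra.
have : (1 - e') * (1 - e') <= Lam (h n).
  apply: Lam_ge_Ex => // m; apply: (@le_trans _ _ ((1 - e') * fine (mu_ m K))).
    by rewrite ler_wpM2l ?subr_ge0.
  rewrite -Ex_indic// -ExZ; last exact: itg_indic.
  apply: Ex_le; [apply: itgZ; exact: itg_indic | exact: BLitg |].
  move=> x; rewrite indicE; have [/set_mem Kx|_] := boolP (x \in K).
    by rewrite mulr1; exact/ltW/Hn.
  by rewrite mulr0.
have := h4 n; nra.
Qed.

Lemma limit_measure : exists pi : probability E R, forall f, BL rho f -> Ex pi f = Lam f.
Proof.
pose om (A : set E) : \bar R := (mo A)%:E.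
pose O1 := isOuterMeasure.Build R E om (congr1 EFin mo0) (fun A => mo_ge0 A)
  (fun A B AB => mo_mono A B AB) mo_subadditive.
pose O : {outer_measure set E -> \bar R} := HB.pack om O1.
have sub : @measurable _ E `<=` caratheodory_measurable O.
  have -> : @measurable _ E = <<s rho_open rho >> by case: polish.
  apply: smallest_sub.
    split.
    - exact: caratheodory_measurable_set0.
    - by move=> A; rewrite setTD; exact: caratheodory_measurable_setC.
    - by move=> F; exact: caratheodory_measurable_bigcup.
  move=> G oG; apply: le_caratheodory_measurable => X.
  by rewrite -EFinD lee_fin; exact: mo_caratheodory.
have [||||pi Hpi] := @mk_probability R d E om.
- by rewrite /om mo0.
- by move=> A; rewrite lee_fin mo_ge0.
- move=> F mF tF mUF; apply: (@caratheodory_measure_sigma_additive _ _ O) => //.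
  + by move=> i; exact: sub.
  + exact: sub.
- by rewrite /om mo_setT.
have piE A : fine (pi A) = mo A by rewrite Hpi.
have up f : BL rho f -> (forall x, 0 <= f x <= 1) -> Ex pi f <= Lam f.
  move=> hf f01; apply: (@le_of_natr _ _ _ 1) => n n0.
  have /andP[_ h] := layer_cake pi f n (BL_measurable _ polish _ hf) f01 n0.
  apply: (le_trans h); rewrite lerD2r /layer_sum.
  (* Each slab is at least [1] where [n * f] is at least [i.+1], hence covers that level set, and
     the slabs sum to at most [n * f]. *)
  pose h_ (i : nat) x := clamp (n%:R * f x - i%:R).
  have hB i : BL rho (h_ i) by apply/BL_clamp/BLB; [exact: BLZ | exact: BL_cst].
  apply: (@le_trans _ _ (\sum_(i < n) Lam (h_ i))).
    apply: ler_sum => i _; rewrite piE; apply: mo_le; exists (fun=> h_ i); split => //.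
      by move=> _ x; exact: clamp_ge0.
    move=> x /= ix t t1; exists 0%N; rewrite /h_ clamp1//.
    by move: ix; rewrite -natr1; lra.
  rewrite -Lam_sum// -LamZ//; apply: Lam_le; [exact: BL_sum | exact: BLZ |].
  move=> x; have /andP[f0 f1] := f01 x; rewrite sum_clamp ?mulr_ge0//.
  by rewrite ge_min lexx.
have eq01 f : BL rho f -> (forall x, 0 <= f x <= 1) -> Ex pi f = Lam f.
  move=> hf f01; apply/eqP; rewrite eq_le up//=.
  (* The reverse inequality is [up] for [1 - f], as both functionals give [1] to the constant
     [1]. *)
  have := up (fun x => 1 - f x) (BLB _ _ _ (BL_cst _ 1) hf).
  rewrite (ExB _ _ _ (itg_cst _ 1) (BLitg _ _ hf)) Ex_cst (LamB _ _ (BL_cst _ 1) hf) Lam_cst.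
  by move=> h; have : forall x, 0 <= 1 - f x <= 1; [move=> x; have := f01 x; lra | move=> /h; lra].
exists pi => f hf; have [M HM] := BL_bdd _ polish _ hf.
pose M' := `|M| + 1; have M'0 : 0 < M' by rewrite ltr_wpDl.
have fM x : `|f x| <= M' by apply: le_trans (HM x) _; apply: le_trans (ler_norm _) _; rewrite lerDl.
pose g x := M'^-1 / 2 * f x + 1 / 2.
have gB : BL rho g by apply: BLD; [exact: BLZ | exact: BL_cst].
have g01 x : 0 <= g x <= 1.
  have := fM x; rewrite ler_norml => /andP[h1 h2].
  have : -1 <= M'^-1 * f x <= 1 by rewrite ler_pdivlMl// ler_pdivrMl// mulr1 mulrN1 h1.
  rewrite /g; set a := M'^-1 * f x => h; rewrite (_ : M'^-1 / 2 * f x = a / 2); last by rewrite /a; ring.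
  lra.
have := eq01 g gB g01; rewrite (ExD _ _ _ (itgZ _ _ _ (BLitg _ _ hf)) (itg_cst _ _)).
rewrite (ExZ _ _ _ (BLitg _ _ hf)) Ex_cst (LamD _ _ (BLZ _ _ _ hf) (BL_cst _ _)) LamZ// Lam_cst.
by move=> /addIr /mulfI; apply; rewrite mulf_neq0// invr_neq0// lt0r_neq0.
Qed.

End Limit.

(** * Mixtures and laws *)

Section Mixture.
Context {R : realType} {d : measure_display} {E : measurableType d}.
Context {d' : measure_display} {T : measurableType d'}.

Lemma Ex_eq_measure (mu nu : probability E R) (f : E -> R) :
  (forall A, measurable A -> mu A = nu A) -> itg mu f -> itg nu f /\ Ex nu f = Ex mu f.
Proof.
move=> H hf; have mf := itg_meas _ _ hf.
have eqi (g : E -> \bar R) : (\int[nu]_x g x = \int[mu]_x g x)%E.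
  by apply: eq_measure_integral => A mA _; rewrite [RHS]H.
split; last by rewrite /Ex /Rintegral eqi.
by case/integrableP: hf => h1 h2; apply/integrableP; split => //; rewrite eqi.
Qed.

Variables (nu : probability T R) (kp : T -> probability E R) (mu : probability E R).
Hypothesis mkp : forall A, measurable A -> measurable_fun setT (fun x => kp x A : \bar R).
Hypothesis muE : forall A, measurable A -> mu A = (\int[nu]_x kp x A)%E.

Lemma mix_measurable_ge0 (f : E -> R) : measurable_fun setT f -> (forall x, 0 <= f x) ->
  measurable_fun setT (fun x => \int[kp x]_y (f y)%:E)%E.
Proof.
move=> mf f0; apply: (measurable_fun_integral_kernel (l := fun x => kp x)).
- exact: mkp.
- by move=> y; rewrite lee_fin.
- exact/measurable_EFinP.
Qed.

Lemma mix_measurable_Ex_ge0 (f : E -> R) : measurable_fun setT f -> (forall x, 0 <= f x) ->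
  measurable_fun setT (fun x => Ex (kp x) f).
Proof.
by move=> mf f0; apply: (measurableT_comp (fine_measurable measurableT)) => //; exact: mix_measurable_ge0.
Qed.

Lemma mix_measurable_bdd (f : E -> R) : measurable_fun setT f -> bdd f ->
  measurable_fun setT (fun x => Ex (kp x) f).
Proof.
move=> mf bf; have [M HM] := bf.
have -> : (fun x => Ex (kp x) f) = (fun x => Ex (kp x) (fun y => f y + M) - M).
  by apply/funext => x; rewrite ExD ?Ex_cst ?addrK//; [exact: itg_bdd | exact: itg_cst].
apply: measurable_funB => //; apply: mix_measurable_Ex_ge0; first exact: measurable_funD.
by move=> y; have := HM y; rewrite ler_norml; lra.
Qed.

Lemma mix_bdd_op (f : E -> R) : bdd f -> measurable_fun setT f -> bdd (fun x => Ex (kp x) f).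
Proof.
move=> [M HM] mf; exists M => x; rewrite -(Ex_cst (kp x) M).
by apply: Ex_norm_le => //; [apply: itg_bdd => //; exists M | exact: itg_cst].
Qed.

Lemma mix_fine A : measurable A -> fine (mu A) = Ex nu (fun x => fine (kp x A)) /\
  itg nu (fun x => fine (kp x A)).
Proof.
move=> mA.
have E1 : (fun x => fine (kp x A)) = (fun x => Ex (kp x) (\1_A)).
  by apply/funext => x; rewrite Ex_indic.
have b1 : bdd (\1_A : E -> R).
  by exists 1 => x; rewrite indicE; case: (_ \in _); rewrite ?normr0 ?normr1.
split; last first.
  rewrite E1; apply: itg_bdd; [apply: mix_measurable_bdd | apply: mix_bdd_op] => //; exact: measurable_indic.
rewrite muE// /Ex /Rintegral; congr fine; apply: eq_integral => x _.
by rewrite prob_fine.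
Qed.

(** For layer sums the identity is the defining property of the mixture, and both sides differ from
    their layer sums by at most [1 / n]. *)
Lemma mix_Ex01 (g : E -> R) : measurable_fun setT g -> (forall x, 0 <= g x <= 1) ->
  Ex mu g = Ex nu (fun x => Ex (kp x) g).
Proof.
move=> mg g01.
have bg : bdd g by exists 1 => x; have /andP[h1 h2] := g01 x; rewrite ger0_norm.
have i1 : itg nu (fun x => Ex (kp x) g).
  by apply: itg_bdd; [apply: mix_measurable_bdd | apply: mix_bdd_op].
have LS n : layer_sum mu g n = Ex nu (fun x => layer_sum (kp x) g n) /\
    itg nu (fun x => layer_sum (kp x) g n).
  have mA (i : 'I_n) : measurable [set x | i.+1%:R <= n%:R * g x].
    by apply: measurable_ge; exact: measurable_funM.
  rewrite /layer_sum; split; last by apply: itg_sum => i; have [] := mix_fine _ (mA i).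
  rewrite Ex_sum; last by move=> i; have [] := mix_fine _ (mA i).
  by apply: eq_bigr => i _; have [] := mix_fine _ (mA i).
apply/eqP; rewrite eq_le; apply/andP; split; apply: (@le_of_natr _ _ _ 1) => n n0;
  have [LS1 LS2] := LS n; have /andP[h1 h2] := layer_cake mu g n mg g01 n0.
- apply: (le_trans h2); rewrite lerD2r LS1 -ExZ//; apply: Ex_le => //; first exact: itgZ.
  by move=> x; have /andP[] := layer_cake (kp x) g n mg g01 n0.
- apply: (@le_trans _ _ (layer_sum mu g n + 1)); last by rewrite lerD2r.
  rewrite LS1 -[X in _ <= _ + X](Ex_cst nu 1) -ExD//; last exact: itg_cst.
  rewrite -ExZ//; apply: Ex_le; [exact: itgZ | apply: itgD => //; exact: itg_cst |].
  by move=> x; have /andP[] := layer_cake (kp x) g n mg g01 n0.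
Qed.

Lemma mix_Ex_bdd (f : E -> R) : measurable_fun setT f -> bdd f ->
  Ex mu f = Ex nu (fun x => Ex (kp x) f).
Proof.
move=> mf bf; have [M0 HM0] := bf.
pose M := `|M0| + 1; have M0' : 0 < M by rewrite ltr_wpDl.
have HM x : `|f x| <= M by apply: le_trans (HM0 x) _; apply: le_trans (ler_norm _) _; rewrite lerDl.
pose g x := (2 * M)^-1 * (f x + M).
have if_ m : itg m f by exact: itg_bdd.
have mg : measurable_fun setT g by apply: measurable_funM => //; exact: measurable_funD.
have g01 x : 0 <= g x <= 1.
  have := HM x; rewrite ler_norml => /andP[h1 h2].
  by rewrite /g ler_pdivlMl ?mulr_gt0// ler_pdivrMl ?mulr_gt0//; lra.
have Eg m : Ex m g = (2 * M)^-1 * (Ex m f + M).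
  by rewrite /g (ExZ _ _ _ (itgD _ _ _ (if_ m) (itg_cst m M))) (ExD _ _ _ (if_ m) (itg_cst m M)) Ex_cst.
have := mix_Ex01 g mg g01; rewrite Eg.
have -> : (fun x => Ex (kp x) g) = (fun x => (2 * M)^-1 * (Ex (kp x) f + M)).
  by apply/funext => x; rewrite Eg.
have i1 : itg nu (fun x => Ex (kp x) f).
  by apply: itg_bdd; [apply: mix_measurable_bdd | apply: mix_bdd_op].
rewrite (ExZ _ _ _ (itgD _ _ _ i1 (itg_cst nu M))) (ExD _ _ _ i1 (itg_cst nu M)) Ex_cst.
by move=> /mulfI /addIr; apply; rewrite invr_neq0// mulf_neq0// lt0r_neq0.
Qed.

Lemma mix_integral_ge0 (f : E -> R) : measurable_fun setT f -> (forall x, 0 <= f x) ->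
  (\int[mu]_y (f y)%:E = \int[nu]_x \int[kp x]_y (f y)%:E)%E.
Proof.
move=> mf f0; pose f_ (n : nat) y := Num.min (f y) n%:R.
have mf_ n : measurable_fun setT (f_ n) by exact: measurable_minr.
have f_0 n y : 0 <= f_ n y by rewrite le_min f0 ler0n.
have bf_ n : bdd (f_ n) by exists n%:R => y; rewrite ger0_norm// ge_min lexx orbT.
have mono y : {homo (fun n => (f_ n y)%:E) : m n / (m <= n)%N >-> (m <= n)%E}.
  by move=> m n mn; rewrite lee_fin le_min !ge_min lexx /= ler_nat mn orbT.
have limf y : (limn (fun n => (f_ n y)%:E) = (f y)%:E)%E.
  apply/cvg_lim => //; apply: cvg_near_cst.
  exists (Num.truncn (f y)).+1 => // n /= hn; rewrite /f_ min_l//.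
  by apply: le_trans (ltW (truncnS_gt _)) _; rewrite ler_nat.
have mc (m : probability E R) : (\int[m]_y (f y)%:E = limn (fun n => (Ex m (f_ n))%:E))%E.
  under eq_integral do rewrite -limf.
  rewrite (@monotone_convergence _ _ _ m _ measurableT (fun n y => (f_ n y)%:E)
    (fun n => (measurable_EFinP _ _).2 (mf_ n)) (fun n y _ => f_0 n y) (fun y _ => mono y)).
  by congr (limn _); apply/funext => n; rewrite ExE//; exact: itg_bdd.
rewrite mc; under [RHS]eq_integral do rewrite mc.
have ige n x : 0 <= Ex (kp x) (f_ n) by exact: Ex_ge0.
have mono' x : {homo (fun n => (Ex (kp x) (f_ n))%:E) : m n / (m <= n)%N >-> (m <= n)%E}.
  move=> m n mn; rewrite lee_fin; apply: Ex_le; [exact: itg_bdd | exact: itg_bdd |].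
  by move=> y; rewrite -lee_fin; exact: mono.
rewrite (@monotone_convergence _ _ _ nu _ measurableT (fun n x => (Ex (kp x) (f_ n))%:E)
  (fun n => (measurable_EFinP _ _).2 (mix_measurable_bdd _ (mf_ n) (bf_ n)))
  (fun n x _ => ige n x) (fun x _ => mono' x)).
congr (limn _); apply/funext => n; rewrite mix_Ex_bdd// ExE//.
by apply: itg_bdd; [exact: mix_measurable_bdd | exact: mix_bdd_op].
Qed.

Lemma mix_Ex_ge0 (f : E -> R) : (forall x, 0 <= f x) -> itg mu f -> (forall x, itg (kp x) f) ->
  itg nu (fun x => Ex (kp x) f) /\ Ex mu f = Ex nu (fun x => Ex (kp x) f).
Proof.
move=> f0 hmu hkp; have mf := itg_meas _ _ hmu.
have E1 : (\int[nu]_x (Ex (kp x) f)%:E = \int[mu]_y (f y)%:E)%E.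
  by rewrite mix_integral_ge0//; apply: eq_integral => x _; rewrite ExE.
have i1 : itg nu (fun x => Ex (kp x) f).
  apply/integrableP; split; first by apply/measurable_EFinP; exact: mix_measurable_Ex_ge0.
  rewrite (_ : (\int[nu]_x _)%E = (\int[nu]_x (Ex (kp x) f)%:E)%E).
    by rewrite E1 -ExE// ltry.
  by apply: eq_integral => x _ /=; rewrite ger0_norm// Ex_ge0.
split => //; apply/EFin_inj; by rewrite !ExE.
Qed.

End Mixture.

Section Pushforward.
Context {R : realType} {d : measure_display} {E : measurableType d}.
Context {d' : measure_display} {Om : measurableType d'}.

Lemma law_of (Pr : probability Om R) (Z : Om -> E) : measurable_fun setT Z ->
  exists nu : probability E R, (forall A, nu A = Pr (Z @^-1` A)) /\
    forall g, itg nu g -> itg Pr (fun w => g (Z w)) /\ Ex Pr (fun w => g (Z w)) = Ex nu g.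
Proof.
move=> mZ.
have mpre A : measurable A -> measurable (Z @^-1` A).
  by move=> mA; rewrite -[X in measurable X]setTI; exact: mZ.
have [||||nu Hnu] := @mk_probability R d E (fun A => Pr (Z @^-1` A)).
- by rewrite preimage_set0 measure0.
- by move=> A; exact: measure_ge0.
- move=> F mF tF mUF; rewrite preimage_bigcup; apply: measure_semi_sigma_additive.
  + by move=> n; exact: mpre.
  + apply/trivIsetP => /= i j _ _ ij; rewrite -preimage_setI.
    by move/trivIsetP : tF => /(_ _ _ _ _ ij) ->//; rewrite preimage_set0.
  + by rewrite -preimage_bigcup; exact: mpre.
- by rewrite preimage_setT [LHS]probability_setT.
exists nu; split => // g hg; have mg := itg_meas _ _ hg.
have ig : itg Pr (fun w => g (Z w)).
  apply/integrableP; split; first by apply/measurable_EFinP; exact: measurableT_comp.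
  have /integrableP[_] := hg; apply: le_lt_trans.
  rewrite le_eqVlt; apply/orP; left; apply/eqP.
  transitivity (\int[pushforward Pr Z]_y `|(g y)%:E|)%E.
    rewrite (ge0_integral_pushforward mZ) ?preimage_setT//.
    by apply/measurable_EFinP; exact: measurableT_comp.
  by apply: eq_measure_integral => A mA _; rewrite [RHS]Hnu.
split => //; rewrite /Ex /Rintegral; congr fine.
transitivity (\int[pushforward Pr Z]_y (g y)%:E)%E.
  rewrite (integral_pushforward mZ) ?preimage_setT//; exact/measurable_EFinP.
by apply: eq_measure_integral => A mA _; rewrite [RHS]Hnu.
Qed.

End Pushforward.

(** * Contraction of Lipschitz bounds *)

Section Split.

Lemma clamp_cases (R : realType) (l p f : R) : 0 <= p ->
  let g := Num.max l (Num.min f (l + p)) in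
  [\/ [/\ f <= l, g = l & `|f - g| = l - f], [/\ l <= f <= l + p, g = f & `|f - g| = 0] |
      [/\ l + p <= f, g = l + p & `|f - g| = f - (l + p)]].
Proof.
move=> p0; cbv zeta; have [lf|fl] := leP f (l + p).
  have [l1|l1] := leP l f; first by constructor 2; rewrite subrr normr0.
  by constructor 1; split; rewrite ?(ltW l1)// ler0_norm ?opprB// subr_le0 ltW.
constructor 3; have lp : l <= l + p by rewrite lerDl.
by rewrite (max_r lp); split; rewrite ?(ltW fl)// ger0_norm// subr_ge0 ltW.
Qed.

Context {R : realType} {d : measure_display} {E : measurableType d}.

(* Truncating [f] to an interval of length [p] leaves a remainder dominated by [A], and the two
   parts share the Lipschitz budget [p * D + A + A] without loss. *)
Lemma split_function (f A : E -> R) (D : E -> E -> R) (p : R) :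
  0 <= p -> measurable_fun setT f -> (forall x, 0 <= A x) -> (forall x y, 0 <= D x y <= 1) ->
  (forall x y, `|f x - f y| <= p * D x y + A x + A y) ->
  exists l (g1 g2 : E -> R), [/\ measurable_fun setT g1, (forall x, l <= g1 x <= l + p),
    (forall x, f x = g1 x + g2 x), (forall x, `|g2 x| <= A x) &
    (forall x y, `|g1 x - g1 y| + `|g2 x| + `|g2 y| <= p * D x y + A x + A y)].
Proof.
move=> p0 mf A0 D01 fA.
have pD x y : 0 <= p * D x y <= p.
  by have /andP[h1 h2] := D01 x y; rewrite mulr_ge0//= ler_piMr.
have [|x y _ _|l Hl] := between_sets E setT (fun x => f x - A x - p) (fun x => f x + A x).
- by exists point.
- by have := fA x y; have := pD x y; rewrite ler_norml; lra.
have {}Hl x : f x - A x - p <= l <= f x + A x by exact: Hl.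
pose g1 x := Num.max l (Num.min (f x) (l + p)).
exists l, g1, (fun x => f x - g1 x); split.
- by apply: measurable_maxr => //; exact: measurable_minr.
- by move=> x; rewrite /g1 le_max lexx /= ge_max lerDl p0 /= ge_min lexx orbT.
- by move=> x; ring.
- move=> x; have := Hl x; have := A0 x.
  by case: (clamp_cases R l p (f x) p0); rewrite -/(g1 x) => -[u1 u2 u3];
    rewrite u3; lra.
- move=> x y; have := Hl x; have := Hl y; have := A0 x; have := A0 y; have := pD x y; have := fA x y.
  rewrite ler_norml => /andP[k1 k2] /andP[k3 k4] k5 k6 /andP[k7 k8] /andP[k9 k10].
  rewrite -[X in X <= _]addrA -lerBrDr.
  case: (clamp_cases R l p (f x) p0); rewrite -/(g1 x) => -[u1 u2 u3];
  case: (clamp_cases R l p (f y) p0); rewrite -/(g1 y) => -[v1 v2 v3];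
  rewrite u3 v3 u2 v2 ler_norml; apply/andP; split; lra.
Qed.

End Split.

(** * The semigroup on functions and one coupled step *)

Section Markov.
Context {R : realType} {d : measure_display} {E : measurableType d}.
Variable P : R -> E -> probability E R.
Hypothesis mtf : markov_tf P.

Lemma P_meas t A : 0 <= t -> measurable A -> measurable_fun setT (fun x => P t x A : \bar R).
Proof. by case: mtf => h _ _; exact: h. Qed.

Lemma P_CK s t x A : 0 <= s -> 0 <= t -> measurable A -> P (s + t) x A = (\int[P s x]_y P t y A)%E.
Proof. by case: mtf => _ _ h; exact: h. Qed.

Definition Op t (f : E -> R) (x : E) : R := Ex (P t x) f.

Definition good (f : E -> R) : Prop := measurable_fun setT f /\ bdd f.

Lemma good_itg mu f : good f -> itg mu f.
Proof. by move=> [h1 h2]; exact: itg_bdd. Qed.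

Lemma goodN f : good f -> good (fun u => - f u).
Proof.
move=> [mf [B HB]]; split; first exact: measurable_funN.
by exists B => u; rewrite normrN.
Qed.

Lemma Op_range t f l p x : good f -> (forall u, l <= f u <= l + p) -> l <= Op t f x <= l + p.
Proof.
move=> gf fl; apply/andP; split.
  by apply: Ex_ge_cst => [|u]; [exact: good_itg | case/andP: (fl u)].
by apply: Ex_le_cst => [|u]; [exact: good_itg | case/andP: (fl u)].
Qed.

Lemma Op_good t f : 0 <= t -> good f -> good (Op t f).
Proof.
move=> t0 [mf bf]; split.
  exact: (mix_measurable_bdd (P t) (fun A mA => P_meas t A t0 mA)).
exact: (mix_bdd_op (P t)).
Qed.

Lemma OpD s t f x : 0 <= s -> 0 <= t -> good f -> Op (s + t) f x = Op s (Op t f) x.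
Proof.
move=> s0 t0 [mf bf].
exact: (mix_Ex_bdd (P s x) (P t) (P (s + t) x) (fun A mA => P_meas t A t0 mA)
  (fun A mA => P_CK s t x A s0 t0 mA)).
Qed.

Lemma OpD_ge0 s t f x : 0 <= s -> 0 <= t -> (forall y, 0 <= f y) ->
  (forall t y, 0 <= t -> itg (P t y) f) ->
  itg (P s x) (Op t f) /\ Op (s + t) f x = Op s (Op t f) x.
Proof.
move=> s0 t0 f0 hf.
exact: (mix_Ex_ge0 (P s x) (P t) (P (s + t) x) (fun A mA => P_meas t A t0 mA)
  (fun A mA => P_CK s t x A s0 t0 mA) f f0 (hf _ _ (addr_ge0 s0 t0)) (fun y => hf _ _ t0)).
Qed.

Section AssumptionA.
Variables (theta : E -> E -> R) (r L : R -> R).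
Hypothesis theta0 : forall x y, 0 <= theta x y.
Hypothesis asA : assumptionA P theta r L.

(** The law of [X t] is exactly [P t x], so [f] and the unbounded error [a] may be integrated along
    it. The law of [Y t] is known only up to [L t * theta x y] in total variation, which permits
    exchange only for functions with range of length [p]; doing so for [f] and for a truncation of
    [a] gives the term [2 * L t]. *)
Lemma gen_coupling_bound t x y (f a : E -> R) (p N l : R) : 0 <= t -> 0 < p -> 0 < N ->
  measurable_fun setT f -> (forall u, l <= f u <= l + p) -> (forall u, 0 <= a u) ->
  itg (P t x) a -> itg (P t y) a ->
  (forall u v, f u - f v <= p * N * theta u v + a u + a v) ->
  Op t f x - Op t f y <= p * (N * r t + 2 * L t) * theta x y + (Op t a x + Op t a y).
Proof.
move=> t0 p0 N0 mf fl a0 iax iay H.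
have [_ _ _ /(_ x y)[dO [Om [Pr [X [Y [[mX lX] mY tvY thXY]]]]]]] := asA.
have [nX [nXE nXg]] := law_of Pr (X t) (mX t t0).
have [nY [nYE nYg]] := law_of Pr (Y t) (mY t t0).
have nXP A : measurable A -> P t x A = nX A.
  move=> mA; rewrite nXE; have := lX [:: (t, A)]; rewrite /= add0r setIT => -> //.
  by rewrite integral_cst// mul1e.
have ma := itg_meas _ _ iax.
(* Cutting at [p] does no harm: where [a] exceeds [p] it already dominates the oscillation of
   [f]. *)
pose a' u := Num.min p (a u).
have ma' : measurable_fun setT a' by exact: measurable_minr.
have a'0p u : 0 <= a' u <= p by rewrite le_min a0 (ltW p0) ge_min lexx.
have ba' : bdd a' by exists p => u; have /andP[h1 h2] := a'0p u; rewrite ger0_norm.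
have bf : bdd f.
  exists (`|l| + p) => u; have := fl u; have := ler_norm l; have := ler_norm (- l).
  by rewrite normrN ler_norml; lra.
have if_ m : itg m f by exact: itg_bdd.
have ia' m : itg m a' by exact: itg_bdd.
have [iax' Eax] := Ex_eq_measure _ _ _ nXP iax.
have [ifx' Efx] := Ex_eq_measure _ _ _ nXP (if_ (P t x)).
have [ifX EfX] := nXg f ifx'; have [iaX EaX] := nXg a iax'.
have [ifY EfY] := nYg f (if_ nY); have [iaY EaY] := nYg a' (ia' nY).
have pN0 : 0 < p * N by exact: mulr_gt0.
pose D w := (p * N)^-1 * (f (X t w) - f (Y t w) - (a (X t w) + a' (Y t w))).
have iD : itg Pr D by apply: itgZ; apply: itgB; [exact: itgB | exact: itgD].
have ED : Ex Pr D = (p * N)^-1 * (Op t f x - Ex nY f - (Op t a x + Ex nY a')).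
  rewrite /D ExZ; last by apply: itgB; [exact: itgB | exact: itgD].
  rewrite ExB; [|exact: itgB|exact: itgD].
  by rewrite ExB// ExD// EfX EaX EfY EaY Efx Eax.
have Dth w : D w <= theta (X t w) (Y t w).
  rewrite /D ler_pdivrMl//; have := H (X t w) (Y t w).
  have := fl (X t w); have := fl (Y t w); have := a0 (X t w).
  have := mulr_ge0 (ltW pN0) (theta0 (X t w) (Y t w)).
  by rewrite /a'; case: (leP p (a (Y t w))) => _; lra.
have ED' : Ex Pr D <= r t * theta x y.
  (* A nonnegative measurable function below [theta (X t w) (Y t w)], to which the bound on the
     integral of the latter passes. *)
  pose D' w := Num.max (D w) 0.
  have iD' : itg Pr D'.
    apply: (itg_le _ _ _ _ _ (itg_abs _ _ iD)).
      by apply: measurable_maxr => //; exact: itg_meas iD.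
    by move=> w; rewrite /D' ger0_norm ?le_max ?lexx ?orbT// ge_max ler_norm normr_ge0.
  apply: (@le_trans _ _ (Ex Pr D')); first by apply: Ex_le => // w; rewrite le_max lexx.
  rewrite -lee_fin ExE//; apply: le_trans (thXY t t0).
  apply: ge0_le_integral_lower => w _; rewrite lee_fin; first by rewrite le_max lexx orbT.
  by rewrite ge_max Dth theta0.
have TV A : measurable A -> fine (nY A) - fine (P t y A) <= L t * theta x y.
  move=> mA; have := tvY t t0.
  have /= : (`|Pr (Y t @^-1` A) - P t y A| <= dTV (fun A => Pr (Y t @^-1` A)) (P t y))%E.
    by apply: ereal_sup_ubound; exists A.
  move=> /le_trans h /h; rewrite -nYE -(prob_fine nY _ mA) -(prob_fine (P t y) _ mA).
  by rewrite -EFinB lee_fin; apply: le_trans (ler_norm _).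
have TVa : Ex nY a' <= Op t a' y + p * (L t * theta x y) by exact: tv_expectation.
have TVf : Ex nY f <= Op t f y + p * (L t * theta x y).
  have := tv_expectation nY (P t y) (L t * theta x y) p (fun u => f u - l) TV.
  rewrite (ExB _ _ _ (if_ nY) (itg_cst _ l)) (ExB _ _ _ (if_ (P t y)) (itg_cst _ l)) !Ex_cst => h.
  have /h : measurable_fun setT (fun u => f u - l) by exact: measurable_funB.
  have pp u : 0 <= f u - l <= p by have := fl u; lra.
  by move=> /(_ pp p0); rewrite /Op; lra.
have aa' : Op t a' y <= Op t a y by apply: Ex_le => // u; rewrite ge_min lexx orbT.
move: ED'; rewrite ED ler_pdivrMl//; lra.
Qed.

Variables (V W : E -> R) (N Tt t0 gam M eps cD : R) (Dset : set E).
Hypotheses (N0 : 0 < N) (Tt0 : 0 <= Tt) (t00 : 0 < t0).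
Let h := t0 + Tt.
Hypothesis close_h : N * r h + 2 * L h <= N / 2.
Hypotheses (W0 : forall x, 0 <= W x) (iW : forall t x, 0 <= t -> itg (P t x) W).
Hypothesis mD : measurable Dset.
Hypothesis cD0 : 0 < cD.
Hypothesis hD : forall x, V x <= M -> (cD%:E <= P t0 x Dset)%E.
Hypothesis thD : forall x y, Dset x -> Dset y -> theta x y <= eps.
Hypothesis epsT : (N * r Tt + 2 * L Tt) * eps <= 1 / 2.
Hypothesis rL0 : 0 <= N * r Tt + 2 * L Tt.
Hypothesis gamE : gam <= 1 / 2 /\ gam <= cD / 2.

Definition dd x y : R := Num.min (N * theta x y) 1.

Lemma dd01 x y : 0 <= dd x y <= 1.
Proof. by rewrite le_min ler01 mulr_ge0 ?(ltW N0)//= ge_min lexx orbT. Qed.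

Let h0 : 0 <= h. Proof. by rewrite addr_ge0// ltW. Qed.

Section OneSided.
Variables (f : E -> R) (p s q : R).
Hypotheses (gf : good f) (p0 : 0 <= p) (s0 : 0 <= s) (q0 : 0 <= q).
Hypothesis fB : forall u v, `|f u - f v| <= p * dd u v + s + q * (W u + W v).

Let A u := s / 2 + q * W u.

(** Truncation reduces everything to [g1], of oscillation at most [p]. The second clause follows
    from the coupling over the whole step; in the third, both laws at time [t0] charge [Dset], where
    [Op Tt g1] oscillates by at most [p / 2] up to the error, which saves [p * cD / 2]. *)
Lemma contr_one_sided x y :
  [/\ Op h f x - Op h f y <= p + s + q * (Op h W x + Op h W y),
      (0 < p -> dd x y < 1 ->
        Op h f x - Op h f y <= p * (dd x y / 2) + s + q * (Op h W x + Op h W y)) &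
      (0 < p -> V x <= M -> V y <= M ->
        Op h f x - Op h f y <= p * (1 - gam) + s + q * (Op h W x + Op h W y))].
Proof.
have A0 u : 0 <= A u by rewrite addr_ge0 ?divr_ge0// mulr_ge0.
have iA t z : 0 <= t -> itg (P t z) A.
  by move=> tt0; apply: itgD; [exact: itg_cst | apply: itgZ; exact: iW].
have EA t z : 0 <= t -> Op t A z = s / 2 + q * Op t W z.
  by move=> tt0; rewrite /Op ExD ?Ex_cst ?ExZ//; [exact: iW | exact: itg_cst | apply: itgZ; exact: iW].
have [u v|l [g1 [g2 [mg1 g1l fg g2A gg]]]] := split_function f A dd p p0 (proj1 gf) A0 dd01.
  by have := fB u v; rewrite /A; lra.
have bg1 : bdd g1.
  exists (`|l| + p) => u; have := g1l u; have := ler_norm l; have := ler_norm (- l).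
  by rewrite normrN ler_norml; lra.
have Gg1 : good g1 by [].
have g2E u : g2 u = f u - g1 u by rewrite fg; ring.
have mg2 : measurable_fun setT g2.
  have -> : g2 = (fun u => f u - g1 u) by apply/funext => u.
  by apply: measurable_funB => //; case: gf.
have ig1 m : itg m g1 by exact: good_itg.
have ig2 t z : 0 <= t -> itg (P t z) g2 by move=> tt0; exact: itg_le mg2 g2A (iA _ _ tt0).
have iag2 t z : 0 <= t -> itg (P t z) (fun u => `|g2 u|) by move=> tt0; apply: itg_abs; exact: ig2.
have Ef z : Op h f z = Op h g1 z + Op h g2 z.
  have -> : f = (fun u => g1 u + g2 u) by apply/funext.
  by rewrite /Op ExD//; exact: ig2.
have ng2 z : `|Op h g2 z| <= Op h (fun u => `|g2 u|) z.
  by apply: Ex_norm_le => //; [exact: ig2 | exact: iag2].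
have g2A' z : Op h (fun u => `|g2 u|) z <= Op h A z.
  by apply: Ex_le => //; [exact: iag2 | exact: iA].
pose a u := A u - `|g2 u|.
have a0 u : 0 <= a u by rewrite subr_ge0.
have ia t z : 0 <= t -> itg (P t z) a by move=> tt0; apply: itgB; [exact: iA | exact: iag2].
have Ea z : Op h a z = Op h A z - Op h (fun u => `|g2 u|) z.
  by rewrite /Op ExB//; [exact: iA | exact: iag2].
have g1a u v : g1 u - g1 v <= p * dd u v + a u + a v.
  by have := gg u v; have := ler_norm (g1 u - g1 v); rewrite /a; lra.
have g1aN u v : g1 u - g1 v <= p * N * theta u v + a u + a v.
  apply: le_trans (g1a u v) _; rewrite !lerD2r -mulrA ler_wpM2l//.
  by rewrite ge_min lexx.
have lift K : Op h g1 x - Op h g1 y <= K + (Op h a x + Op h a y) ->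
    Op h f x - Op h f y <= K + s + q * (Op h W x + Op h W y).
  rewrite !Ef !Ea !EA//; have := ng2 x; have := ng2 y; rewrite !ler_norml => /andP[u1 u2] /andP[u3 u4].
  by lra.
split.
- apply: lift; have := Op_range h g1 l p x Gg1 g1l; have := Op_range h g1 l p y Gg1 g1l.
  by have := Ex_ge0 (P h x) a a0; have := Ex_ge0 (P h y) a a0; rewrite /Op; lra.
- move=> pp dxy; apply: lift.
  have dE : dd x y = N * theta x y by move: dxy; rewrite /dd gt_min ltxx orbF => /ltW hle; rewrite min_l.
  apply: le_trans (gen_coupling_bound h x y g1 a p N l h0 pp N0 mg1 g1l a0 (ia _ _ h0) (ia _ _ h0) g1aN) _.
  rewrite lerD2r dE -mulrA ler_wpM2l//.
  by have := ler_wpM2r (theta0 x y) close_h; lra.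
- move=> pp Vx Vy; apply: lift.
  pose g := Op Tt g1; pose b := Op Tt a.
  have gD u v : Dset u -> Dset v -> g u - b u - p / 2 <= g v + b v.
    move=> Du Dv.
    have := gen_coupling_bound Tt u v g1 a p N l Tt0 pp N0 mg1 g1l a0 (ia _ _ Tt0) (ia _ _ Tt0) g1aN.
    have : p * (N * r Tt + 2 * L Tt) * theta u v <= p / 2.
      rewrite -mulrA ler_wpM2l//; apply: le_trans (_ : (N * r Tt + 2 * L Tt) * eps <= _).
        by apply: ler_wpM2l => //; exact: thD.
      by rewrite -div1r.
    by rewrite /g /b; lra.
  have Gg : good g by exact: Op_good.
  have b0 u : 0 <= b u by exact: Ex_ge0.
  have ib z : itg (P t0 z) b by have [] := OpD_ge0 t0 Tt a z (ltW t00) Tt0 a0 ia.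
  have Eb z : Op h a z = Op t0 b z by have [] := OpD_ge0 t0 Tt a z (ltW t00) Tt0 a0 ia.
  have Eg z : Op h g1 z = Op t0 g z by apply: OpD => //; exact: ltW.
  have gl u : l <= g u <= l + p by exact: Op_range.
  have neD : exists u, Dset u.
    apply: contrapT => nD; have D0 : Dset = set0.
      by apply/seteqP; split => u // Du; apply: nD; exists u.
    have := hD x Vx; by rewrite D0 measure0 lee_fin leNgt cD0.
  have [m0 Hm0] := between_sets E Dset (fun u => g u - b u - p / 2) (fun u => g u + b u) neD gD.
  (* On [Dset] the values of [g] lie in [[m, m + p / 2]] up to [b]. Clipping [m] keeps this window
     inside the range [[l, l + p]]. *)
  pose m := Num.max l (Num.min m0 (l + p / 2)).
  have ml : l <= m <= l + p / 2.
    by rewrite /m le_max lexx /= ge_max lerDl divr_ge0//= ge_min lexx orbT.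
  have Hm u : Dset u -> g u - b u - p / 2 <= m <= g u + b u.
    move=> Du; have := Hm0 u Du; have := gl u; have := b0 u; rewrite /m.
    case: (leP m0 (l + p / 2)) => k1; first by case: (leP l m0) => k2; lra.
    by rewrite max_r; lra.
  have iI z : itg (P t0 z) (\1_Dset : E -> R) by exact: itg_indic.
  have cI z : V z <= M -> cD <= Ex (P t0 z) (\1_Dset : E -> R).
    by move=> Vz; rewrite Ex_indic// -lee_fin prob_fine//; exact: hD.
  have ig z : itg (P t0 z) g by exact: good_itg.
  have Ex1 z : Ex (P t0 z) (\1_Dset : E -> R) <= 1.
    by rewrite Ex_indic// prob_le1.
  have upx : Op t0 g x <= (l + p) + (m + p / 2 - (l + p)) * Ex (P t0 x) (\1_Dset : E -> R) + Op t0 b x.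
    rewrite -(ExZ _ _ _ (iI x)) -[X in X + _ + _](Ex_cst (P t0 x) (l + p)).
    have i1 := itgZ _ (m + p / 2 - (l + p)) _ (iI x); have i2 := itg_cst (P t0 x) (l + p).
    rewrite -(ExD _ _ _ i2 i1) -(ExD _ _ _ (itgD _ _ _ i2 i1) (ib x)).
    apply: Ex_le => //; first by apply: itgD => //; exact: itgD.
    move=> u; rewrite indicE; have [/set_mem Du|_] := boolP (u \in Dset).
      by have := Hm u Du; rewrite mulr1; lra.
    by rewrite mulr0 addr0; have := gl u; have := b0 u; lra.
  have lowy : l + (m - l) * Ex (P t0 y) (\1_Dset : E -> R) - Op t0 b y <= Op t0 g y.
    rewrite -(ExZ _ _ _ (iI y)) -[X in X + _ - _](Ex_cst (P t0 y) l).
    have i1 := itgZ _ (m - l) _ (iI y); have i2 := itg_cst (P t0 y) l.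
    rewrite -(ExD _ _ _ i2 i1) -(ExB _ _ _ (itgD _ _ _ i2 i1) (ib y)).
    apply: Ex_le => //; first by apply: itgB => //; exact: itgD.
    move=> u; rewrite indicE; have [/set_mem Du|_] := boolP (u \in Dset).
      by have := Hm u Du; rewrite mulr1; lra.
    by rewrite mulr0 addr0; have := gl u; have := b0 u; lra.
  rewrite !Eg !Eb.
  have k1 := cI x Vx; have k2 := cI y Vy.
  set ex := Ex (P t0 x) _ in upx k1; set ey := Ex (P t0 y) _ in lowy k2.
  (* The coefficient of the mass of [Dset] is nonpositive in the upper bound and nonnegative in the
     lower one, so both masses may be replaced by [cD]. *)
  have j1 : (m + p / 2 - (l + p)) * ex <= (m + p / 2 - (l + p)) * cD by apply: ler_wnM2l => //; lra.
  have j2 : (m - l) * cD <= (m - l) * ey by apply: ler_wpM2l => //; lra.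
  have j3 : p * gam <= p * (cD / 2) by rewrite ler_pM2l//; case: gamE.
  lra.
Qed.

End OneSided.

Lemma contr_far f (s q : R) x y : good f -> 0 <= s -> 0 <= q ->
  (forall u v, `|f u - f v| <= s + q * (W u + W v)) ->
  `|Op h f x - Op h f y| <= s + q * (Op h W x + Op h W y).
Proof.
move=> gf s0 q0 fB.
have gN := goodN _ gf.
rewrite ler_norml; apply/andP; split.
  have [u v|+ _ _] := contr_one_sided (fun u => - f u) 0 s q gN (lexx 0) s0 q0 _ x y.
    by rewrite -opprD normrN mul0r add0r.
  have EN z : Op h (fun u => - f u) z = - Op h f z by rewrite /Op ExN//; exact: good_itg.
  by rewrite !EN; lra.
have [u v|+ _ _] := contr_one_sided f 0 s q gf (lexx 0) s0 q0 _ x y.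
  by rewrite mul0r add0r.
by lra.
Qed.

(** Where [dd x y < 1] the distance is halved and [gam <= 1 / 2] suffices; where [dd x y = 1] the
    gain comes from the common set [Dset]. *)
Lemma contr_near f (p s q : R) x y : good f -> 0 < p -> 0 <= s -> 0 <= q ->
  (forall u v, `|f u - f v| <= p * dd u v + s + q * (W u + W v)) ->
  `|Op h f x - Op h f y| <= p * dd x y + s + q * (Op h W x + Op h W y) /\
  (V x <= M -> V y <= M ->
    `|Op h f x - Op h f y| <= p * ((1 - gam) * dd x y) + s + q * (Op h W x + Op h W y)).
Proof.
move=> gf p0 s0 q0 fB.
have gN := goodN _ gf.
have fBN u v : `|- f u - - f v| <= p * dd u v + s + q * (W u + W v) by rewrite -opprD normrN.
have [h1 h2 h3] := contr_one_sided f p s q gf (ltW p0) s0 q0 fB x y.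
have [k1 k2 k3] := contr_one_sided (fun u => - f u) p s q gN (ltW p0) s0 q0 fBN x y.
have EN z : Op h (fun u => - f u) z = - Op h f z by rewrite /Op ExN//; exact: good_itg.
rewrite !EN in k1 k2 k3; have [g1 g2] := gamE; have /andP[d0 d1] := dd01 x y.
have [dl|dg] := ltP (dd x y) 1.
  have u1 := h2 p0 dl; have u2 := k2 p0 dl; have pd := mulr_ge0 (ltW p0) d0.
  split => [|_ _]; rewrite ler_norml; apply/andP; split; try lra.
    have := ler_wpM2l pd g1; lra.
  have := ler_wpM2l pd g1; lra.
have -> : dd x y = 1 by apply/eqP; rewrite eq_le d1.
rewrite !mulr1; split => [|Vx Vy]; rewrite ler_norml; first by lra.
by have := h3 p0 Vx Vy; have := k3 p0 Vx Vy; lra.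
Qed.

End AssumptionA.

End Markov.

Section LipschitzGood.
Context {R : realType} {d : measure_display} {E : measurableType d}.
Variable rho : E -> E -> R.
Hypothesis polish : polish_borel rho.

Lemma lip1_good f : lip1 rho f -> good f.
Proof. by move=> lf; split; [exact: (lip1_measurable rho polish) | exact: (lip1_bdd rho)]. Qed.

Lemma lip1_range f : lip1 rho f -> exists l, forall u, l <= f u <= l + 1.
Proof.
move=> lf; have [|u v _ _|l Hl] := between_sets E setT (fun u => f u - 1) f; first by exists point.
  by have := lf u v; have := rho1_le1 rho u v; rewrite ler_norml; lra.
by exists l => u; have := Hl u Logic.I; lra.
Qed.

End LipschitzGood.

(** * Subgeometric rates *)

Section Rates.
Context {R : realType} {E : Type}.
Variables (ph : R -> R) (c : R).
Hypotheses (phC : concave0 ph) (phN : nondecr0 ph) (ph0 : ph 0 = 0) (ph1 : ph 1 = c)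
  (cp : 0 < c) (phL : forall u, 0 <= u -> ph u <= c * u).
Variables (Q : (E -> R) -> E -> R) (good : (E -> R) -> Prop) (dd : E -> E -> R) (W QW : E -> R).
Variables (M gam c0 K1 : R).
Hypotheses (goodQ : forall f, good f -> good (Q f))
  (dd01 : forall x y, 0 <= dd x y <= 1) (dd0 : forall x y, dd x y = 0 -> x = y)
  (W0 : forall x, 0 <= W x) (QW0 : forall x, 0 <= QW x).
Let w x y : R := 1 + (W x + W y).
Let w' x y : R := 1 + (QW x + QW y).
Hypothesis far : forall f (s q : R) x y, good f -> 0 <= s -> 0 <= q ->
  (forall u v, `|f u - f v| <= s + q * (W u + W v)) ->
  `|Q f x - Q f y| <= s + q * (QW x + QW y).
Hypothesis near : forall f (p s q : R) x y, good f -> 0 < p -> 0 <= s -> 0 <= q ->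
  (forall u v, `|f u - f v| <= p * dd u v + s + q * (W u + W v)) ->
  `|Q f x - Q f y| <= p * dd x y + s + q * (QW x + QW y) /\
  (w x y <= M -> `|Q f x - Q f y| <= p * ((1 - gam) * dd x y) + s + q * (QW x + QW y)).
Hypotheses (gam0 : 0 < gam <= 1 / 2) (c00 : 0 < c0) (K10 : 0 <= K1) (M1 : 1 <= M).
Hypothesis drift1 : forall x y, w' x y <= w x y + K1.
Hypothesis drift2 : forall x y, M < w x y -> w' x y <= w x y - c0 / 2 * ph (w x y).

Let w_ge1 x y : 1 <= w x y. Proof. by rewrite lerDl addr_ge0. Qed.
Let w'_ge1 x y : 1 <= w' x y. Proof. by rewrite lerDl addr_ge0. Qed.

Section Fixed.
Variables (a beta eta : R).
Hypothesis a01 : 0 < a < 1.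
Hypotheses (beta0 : 0 < beta) (eta0 : 0 < eta).
Let c1 := c0 / 4.
Hypotheses (eta_c1 : eta <= c1) (eta_beta : eta * c <= beta * c1) (eta1 : eta * c <= 1).
Hypothesis beta_small :
  (1 - gam) `^ a * ((1 + beta * c1) * (1 + beta * (2 / c * (M + K1)))) `^ (1 - a) <= 1.

Local Notation F := (flow ph eta).
Local Notation z := (zk ph eta).
Local Notation r := (rk ph eta).
Local Notation B := (Bk ph eta beta).

Let c10 : 0 < c1. Proof. by rewrite divr_gt0. Qed.
Let a0 : 0 < a. Proof. by case/andP: a01. Qed.
Let a1 : 0 < 1 - a. Proof. by case/andP: a01 => _; rewrite subr_gt0. Qed.
Let r0 k : 0 < r k. Proof. exact: (rk_gt0 _ c). Qed.
Let z1 k : 1 <= z k. Proof. exact: zk_ge1. Qed.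
Let z0 k : 0 < z k. Proof. exact: lt_le_trans ltr01 (z1 k). Qed.
Let B0 k v : 1 <= v -> 0 < B k v.
Proof. by move=> v1; apply: lt_le_trans (r0 k) _; exact: Bk_ge. Qed.

(** The index counts the steps still to come and decreases by one with each application of [Q].
    Starting at [n] makes the weight at least [r n] to the power [1 - a], which becomes the rate
    once the index has reached [0]. *)
Let Psi k x y := dd x y `^ a * B k (w x y) `^ (1 - a).

(** The bound is replaced by an affine majorant touching it at the image [(d0, w' x y)] of the
    current point. The operator carries affine bounds along, and tangency makes the result equal to
    the original bound at that image. *)
Lemma Psi_step f k (Z : R) : good f -> 0 < Z ->
  (forall u v, `|f u - f v| <= Psi k.+1 u v * Z) ->
  forall x y, `|Q f x - Q f y| <= Psi k x y * Z.
Proof.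
move=> gf Z0 fB x y.
have := gam0; have := M1; have := K10 => K10' M1' gam0'.
have [d0|dn0] := eqVneq (dd x y) 0.
  by rewrite (dd0 _ _ d0) subrr normr0 mulr_ge0 ?(ltW Z0)// mulr_ge0 ?powR_ge0.
have /andP[dge dle] := dd01 x y.
have dp : 0 < dd x y by rewrite lt_neqAle eq_sym dn0.
pose mm : R := if w x y <= M then 1 - gam else 1.
have mm0 : 0 < mm by rewrite /mm; case: ifP => _ //; lra.
pose d0 := mm * dd x y; have d00 : 0 < d0 by exact: mulr_gt0.
pose b0 := B k.+1 (w' x y); have b00 : 0 < b0 by exact: B0.
have [sg sg0 Hsg] := Bk_supergradient _ phC phN ph0 eta eta0 beta beta0 k.+1 (w' x y) (w'_ge1 x y).
pose G := Z * (d0 `^ a * b0 `^ (1 - a)).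
have G0 : 0 < G by rewrite !mulr_gt0// powR_gt0.
(* Coefficients of that majorant: the tangent plane in the distance and [B], with [B] replaced by
   its supporting line of slope [sg]. The constant [s] is nonnegative since it is proportional to a
   supporting line at weight [1]. *)
pose p := G * a / d0; pose q := G * (1 - a) / b0 * sg.
pose s := G * (1 - a) / b0 * (b0 + sg * (1 - w' x y)).
have p0 : 0 < p by rewrite divr_gt0// mulr_gt0.
have Gb0 : 0 < G * (1 - a) / b0 by rewrite divr_gt0// mulr_gt0.
have q0 : 0 <= q by rewrite mulr_ge0// ltW.
have s0 : 0 <= s.
  rewrite mulr_ge0 ?(ltW Gb0)//; apply: le_trans (Hsg 1 (lexx 1)).
  by apply: ltW; exact: B0.
have Hf u v : `|f u - f v| <= p * dd u v + s + q * (W u + W v).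
  apply: le_trans (fB u v) _; have /andP[du0 du1] := dd01 u v.
  have bu := B0 k.+1 _ (w_ge1 u v).
  apply: (@le_trans _ _ (G * (a * (dd u v / d0) + (1 - a) * (B k.+1 (w u v) / b0)))).
    rewrite mulrC /G -mulrA ler_pM2l//.
    exact: (powR_amgm a _ _ _ _ a01 du0 (ltW bu) d00 b00).
  have -> : p * dd u v + s + q * (W u + W v) =
     G * (a * (dd u v / d0)) + G * (1 - a) / b0 * (b0 + sg * (w u v - w' x y)).
    by rewrite /p /s /q /w; ring.
  rewrite mulrDr lerD2l.
  have -> : G * ((1 - a) * (B k.+1 (w u v) / b0)) = G * (1 - a) / b0 * B k.+1 (w u v) by ring.
  by rewrite ler_pM2l//; exact: Hsg.
have QfG : `|Q f x - Q f y| <= G.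
  have [n1 n2] := near _ _ _ _ x y gf p0 s0 q0 Hf.
  have : `|Q f x - Q f y| <= p * d0 + s + q * (QW x + QW y).
    by rewrite /d0 /mm; case: ifP => [/n2//|_]; rewrite mul1r.
  suff -> : p * d0 + s + q * (QW x + QW y) = G by [].
  rewrite /p /s /q /w'; field.
  by rewrite !lt0r_neq0.
apply: (le_trans QfG); rewrite /G mulrC ler_pM2r// /Psi /d0 powRM ?(ltW mm0)//.
rewrite [mm `^ a * _]mulrC -mulrA ler_wpM2l ?powR_ge0//.
have Bw := B0 k _ (w_ge1 x y).
(* For small weight the factor from [Bk_near] is offset by the contraction [1 - gam]; for large
   weight the drift alone brings [B] back by one index. *)
rewrite /mm; have [wM|Mw] := leP (w x y) M.
  have := beta_small; set rh := (1 + beta * c1) * _ => bsm.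
  have rh0 : 0 <= rh.
    rewrite /rh mulr_ge0// addr_ge0// mulr_ge0 ?(ltW beta0) ?(ltW c10)//.
    by rewrite mulr_ge0 ?divr_ge0 ?(ltW cp)//; lra.
  have bB : b0 <= rh * B k (w x y).
    apply: (Bk_near _ c phC phN ph0 ph1 cp phL eta eta0 beta c1 beta0) => //; apply: le_trans (drift1 x y) _; lra.
  apply: (@le_trans _ _ ((1 - gam) `^ a * (rh `^ (1 - a) * B k (w x y) `^ (1 - a)))).
    rewrite ler_wpM2l ?powR_ge0// -powRM ?(ltW Bw)//.
    by apply: ge0_ler_powR; rewrite ?nnegrE ?(ltW a1) ?(ltW b00)// mulr_ge0 ?(ltW Bw).
  by rewrite mulrA ler_piMl ?powR_ge0.
rewrite one_powR mul1r; apply: ge0_ler_powR; rewrite ?nnegrE ?(ltW a1) ?(ltW b00) ?(ltW Bw)//.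
apply: (Bk_far _ c phC phN ph0 ph1 cp phL eta eta0 beta c1 beta0 c10) => //; first by exact: le_trans ler01 (w'_ge1 x y).
apply: le_trans (drift2 x y Mw) _; rewrite lerD2l lerN2 ler_wpM2r//.
  by apply: ltW; apply: (ph_gt0 _ c).
by move: eta_c1; rewrite /c1; lra.
Qed.

Lemma iter_good f j : good f -> good (iter j Q f).
Proof. by move=> gf; elim: j => //= j IH; exact: goodQ. Qed.

Lemma phase2 f n x y : good f -> (forall u v, `|f u - f v| <= dd u v) ->
  `|iter n Q f x - iter n Q f y| <= B 0 (w x y) `^ (1 - a) / r n `^ (1 - a).
Proof.
move=> gf fd; pose Z := (r n `^ (1 - a))^-1.
have Z0 : 0 < Z by rewrite invr_gt0 powR_gt0.
have H j : (j <= n)%N -> forall u v, `|iter j Q f u - iter j Q f v| <= Psi (n - j) u v * Z.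
  elim: j => [_|j IH jn] u v.
    rewrite subn0; apply: le_trans (fd u v) _.
    have /andP[d0 d1] := dd01 u v.
    apply: (@le_trans _ _ (dd u v `^ a)).
      have [->|dn0] := eqVneq (dd u v) 0; first by rewrite powR_ge0.
      have dp : 0 < dd u v by rewrite lt_neqAle eq_sym dn0.
      rewrite -{1}(powRr1 d0); apply: ger_powR; first by rewrite dp.
      by case/andP: a01 => _ /ltW.
    rewrite /Psi -mulrA ler_peMr ?powR_ge0// /Z ler_pdivlMr ?powR_gt0// mul1r.
    apply: ge0_ler_powR; rewrite ?nnegrE ?(ltW a1) ?(ltW (r0 n))//.
      exact/ltW/B0.
    exact: Bk_ge.
  have jn' : (n - j)%N = (n - j.+1).+1 by rewrite subnSK.
  apply: (Psi_step _ (n - j.+1)) => //; first exact: iter_good.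
  by rewrite -jn'; apply: IH; exact: ltnW.
have := H n (leqnn n) x y; rewrite subnn => h; apply: (le_trans h).
rewrite /Psi -mulrA ler_piMl//.
  by rewrite mulr_ge0 ?powR_ge0// ltW.
have /andP[d0 d1] := dd01 x y.
rewrite -[X in _ <= X](one_powR a); apply: ge0_ler_powR; rewrite ?nnegrE ?(ltW a0)//.
Qed.

Lemma iter_osc f n x y : good f -> (forall u v, `|f u - f v| <= dd u v) ->
  `|iter n Q f x - iter n Q f y| <= 1.
Proof.
move=> gf fd; elim: n x y => [|n IH] x y /=.
  by apply: le_trans (fd x y) _; case/andP: (dd01 x y).
have := far (iter n Q f) 1 0 x y (iter_good f n gf) ler01 (lexx 0).
by rewrite mul0r addr0; apply => u v; rewrite mul0r addr0.
Qed.

(** On [w <= M] the earlier estimate [phase2] is already a constant times the rate. Elsewhere the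
    trivial bound [1 <= iter m F w / z m] is carried along, each step of drift undoing one
    application of [F], until only [w / z m] remains. *)
Lemma phase1 f n m x y : good f -> (forall u v, `|f u - f v| <= dd u v) ->
  `|iter (n + m) Q f x - iter (n + m) Q f y| <=
  (c + beta * M) `^ (1 - a) / r n `^ (1 - a) + w x y / z m.
Proof.
move=> gf fd; set ep := _ / r n `^ _.
have := gam0; have := M1; have := K10 => K10' M1' gam0'.
have ep0 : 0 <= ep by rewrite divr_ge0 ?powR_ge0.
suff H j : (j <= m)%N -> forall u v,
    `|iter (n + j) Q f u - iter (n + j) Q f v| <= ep + iter (m - j) F (w u v) / z m.
  by have := H m (leqnn m) x y; rewrite subnn.
elim: j => [_|j IH jm] u v.
  rewrite addn0 subn0; apply: le_trans (iter_osc f n u v gf fd) _.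
  rewrite -[X in X <= _]add0r; apply: lerD => //.
  by rewrite ler_pdivlMr// mul1r; apply: flow_iter_mono.
have [wM|Mw] := leP (w u v) M.
  apply: le_trans (phase2 f (n + j.+1) u v gf fd) _.
  rewrite -[X in X <= _]addr0; apply: lerD; last first.
    rewrite divr_ge0 ?(ltW (z0 m))//; apply: le_trans (flow_iter_ge _ phN ph0 _ eta0 _ _ _);
    by apply: le_trans ler01 (w_ge1 u v).
  have Bc : B 0 (w u v) <= c + beta * M.
    rewrite /Bk /rk /zk /= ph1 lerD2l ler_pM2l//; lra.
  apply: ler_pM; rewrite ?invr_ge0 ?powR_ge0//.
    apply: ge0_ler_powR; rewrite ?nnegrE ?(ltW a1) ?(ltW (B0 _ _ (w_ge1 _ _)))//.
    exact: le_trans (ltW (B0 0%N _ (w_ge1 u v))) Bc.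
  rewrite lef_pV2 ?posrE ?powR_gt0//; apply: ge0_ler_powR; rewrite ?nnegrE ?(ltW a1) ?(ltW (r0 _))//.
  by apply: rk_le => //; exact: leq_addr.
have jm' : (m - j)%N = (m - j.+1).+1 by rewrite subnSK.
have [|sg sg0 Hsg] := concave_supergradient (iter (m - j) F) (w' u v) (flow_iter_concave _ phC phN ph0 _ eta0 _)
   (flow_iter_mono _ phN ph0 _ eta0 _).
  exact: lt_le_trans ltr01 (w'_ge1 u v).
have zi : 0 < (z m)^-1 by rewrite invr_gt0.
set b := iter (m - j) F (w' u v) in Hsg.
pose q := sg / z m; pose s := ep + (b + sg * (1 - w' u v)) / z m.
have s0 : 0 <= s.
  rewrite addr_ge0// divr_ge0 ?(ltW (z0 m))//; apply: le_trans (Hsg 1 ler01).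
  exact: le_trans ler01 (flow_iter_ge _ phN ph0 _ eta0 _ _ ler01).
have := far (iter (n + j) Q f) s q u v (iter_good f (n + j) gf) s0 _ _.
rewrite addnS /= => h; apply: le_trans (h _ _) _.
- by rewrite divr_ge0// ltW.
- move=> u1 v1; apply: le_trans (IH (ltnW jm) u1 v1) _.
  have -> : s + q * (W u1 + W v1) = ep + (b + sg * (w u1 v1 - w' u v)) / z m.
    by rewrite /s /q /w; ring.
  rewrite lerD2l ler_pM2r//; apply: Hsg; exact: le_trans ler01 (w_ge1 _ _).
have -> : s + q * (QW u + QW v) = ep + b / z m by rewrite /s /q /w'; ring.
rewrite lerD2l ler_pM2r// /b jm' iterSr.
have w'0 : 0 <= w' u v := le_trans ler01 (w'_ge1 u v).
have w'w := drift2 u v Mw.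
have pw : 0 <= ph (w u v) by apply/ltW/(ph_gt0 _ c).
apply: flow_iter_mono => //; first exact: le_trans w'0 (flow_ge _ phN ph0 _ eta0 _ w'0).
(* The drift gains [2 * c1 * ph w], while one step of the flow costs at most [eta * ph w]. *)
have h1 : w' u v <= w u v by have := mulr_ge0 (ltW c10) pw; rewrite /c1; lra.
have h2 := ler_wpM2l (ltW eta0) (phN _ _ w'0 h1).
have h3 := ler_wpM2r pw eta_c1; have h4 := mulr_ge0 (ltW c10) pw.
by rewrite /flow; move: h3 h4; rewrite /c1; lra.
Qed.

(** Below [z m] concavity gives [w / z m <= ph w / r m], a number at most [1] and hence at most its
    power. Above [z m] that power is at least [1] and the trivial oscillation bound is enough. The
    two phases of [m] steps account for [m + m]. *)
Lemma rate_fixed f m x y : good f -> (forall u v, `|f u - f v| <= dd u v) ->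
  `|iter (m + m) Q f x - iter (m + m) Q f y| <=
  ((c + beta * M) `^ (1 - a) + 1) * (1 + ph (w x y)) `^ (1 - a) / r m `^ (1 - a).
Proof.
have := a01 => a01'; move=> gf fd; set e := `|_|.
have := gam0; have := M1; have := K10 => K10' M1' gam0'.
have h1 : e <= 1 by exact: iter_osc.
have h2 := phase1 f m m x y gf fd; rewrite -/e in h2.
have w1 := w_ge1 x y; have pw : 0 < ph (w x y) by apply: (ph_gt0 _ c).
have rp : 0 < r m `^ (1 - a) by rewrite powR_gt0.
have pw1 : 1 <= (1 + ph (w x y)) `^ (1 - a).
  rewrite -[X in X <= _](one_powR (1 - a)); apply: ge0_ler_powR; rewrite ?nnegrE ?(ltW a1)//; lra.
have key : e <= (c + beta * M) `^ (1 - a) / r m `^ (1 - a) + (ph (w x y) / r m) `^ (1 - a).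
  have [wz|zw] := leP (w x y) (z m).
    apply: (le_trans h2); rewrite lerD2l.
    have rat : w x y / z m <= ph (w x y) / r m.
      rewrite ler_pdivrMr// mulrAC ler_pdivlMr// [X in _ <= X]mulrC.
      by apply: (ph_ratio _ phC ph0) => //; lra.
    apply: (le_trans rat).
    have q0 : 0 < ph (w x y) / r m by rewrite divr_gt0.
    rewrite -[X in X <= _](powRr1 (ltW q0)); apply: ger_powR.
      rewrite q0 /= ler_pdivrMr// mul1r; apply: phN => //; lra.
    lra.
  apply: (le_trans h1); rewrite -[X in X <= _]add0r; apply: lerD; first by rewrite divr_ge0 ?powR_ge0.
  rewrite -[X in X <= _](one_powR (1 - a)); apply: ge0_ler_powR; rewrite ?nnegrE ?(ltW a1)//.
    by rewrite divr_ge0 ?(ltW pw) ?(ltW (r0 m)).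
  by rewrite ler_pdivlMr// mul1r; apply: phN; [exact: ltW | exact: ltW].
apply: (le_trans key); rewrite powRM ?invr_ge0 ?(ltW pw) ?(ltW (r0 m))//.
have Er : (r m)^-1 `^ (1 - a) = (r m `^ (1 - a))^-1.
  by rewrite -powR_inv1 ?(ltW (r0 m))// -powRrM mulN1r powRN.
rewrite Er -mulrDl ler_pM2r ?invr_gt0// mulrDl mul1r.
apply: lerD; first by rewrite ler_peMr ?powR_ge0.
apply: ge0_ler_powR; rewrite ?nnegrE ?(ltW a1) ?(ltW pw)//; lra.
Qed.

End Fixed.

Lemma rate (delta : R) : 0 < delta < 1 -> exists eta C : R, [/\ 0 < eta, eta * c <= 1, 0 < C &
  forall f m x y, good f -> (forall u v, `|f u - f v| <= dd u v) ->
  `|iter (m + m) Q f x - iter (m + m) Q f y| <=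
  C * (1 + ph (w x y)) `^ delta / rk ph eta m `^ delta].
Proof.
move=> /andP[de0 de1]; pose a := 1 - delta.
have := gam0; have := M1; have := K10 => K10' M1' gam0'.
have a01 : 0 < a < 1 by rewrite /a; lra.
have aE : 1 - a = delta by rewrite /a; ring.
pose c1 := c0 / 4; have c10 : 0 < c1 by rewrite divr_gt0.
pose X := 2 / c * (M + K1).
have X0 : 0 <= X by rewrite mulr_ge0 ?divr_ge0 ?(ltW cp)//; lra.
have g1 : 0 < 1 - gam < 1 by lra.
have /andP[g10 g11] := g1.
(* The largest factor that the contraction can absorb: its power [delta] is inverse to the power [a]
   of [1 - gam]. *)
pose y0 := (1 - gam) `^ (- (a / delta)).
have ad0 : 0 < a / delta by rewrite divr_gt0//; lra.
have y01 : 1 < y0.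
  rewrite /y0 powRN -[X in X < _]invr1 ltf_pV2 ?posrE ?powR_gt0//.
  rewrite -[X in _ < X](one_powR (a / delta)).
  by apply: gt0_ltr_powR; rewrite ?nnegrE ?(ltW g10).
(* For [beta <= 1] the product of the two factors in [Bk_near] is at most [1 + beta * S], which
   explains the choice of [beta]. *)
pose S := c1 + X + c1 * X.
have S0 : 0 < S by rewrite /S; have := mulr_ge0 (ltW c10) X0; lra.
pose beta := Num.min 1 ((y0 - 1) / S).
have beta0 : 0 < beta by rewrite lt_min ltr01 divr_gt0// subr_gt0.
have beta1 : beta <= 1 by rewrite ge_min lexx.
have betaS : beta * S <= y0 - 1 by rewrite -ler_pdivlMr// ge_min lexx orbT.
pose eta := Num.min c1 (Num.min (beta * c1) 1 / c).
have eta0 : 0 < eta by rewrite lt_min c10 divr_gt0// lt_min mulr_gt0//=.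
have eta_c1 : eta <= c1 by rewrite ge_min lexx.
have etac : eta * c <= Num.min (beta * c1) 1 by rewrite -ler_pdivlMr// ge_min lexx orbT.
have eta_beta : eta * c <= beta * c1 by apply: (le_trans etac); rewrite ge_min lexx.
have eta1 : eta * c <= 1 by apply: (le_trans etac); rewrite ge_min lexx orbT.
have bs : (1 - gam) `^ a * ((1 + beta * c1) * (1 + beta * X)) `^ (1 - a) <= 1.
  rewrite aE.
  have rh : (1 + beta * c1) * (1 + beta * X) <= y0.
    have := mulr_ge0 (ltW beta0) (mulr_ge0 (ltW c10) X0).
    move: betaS; rewrite /S => k1 k2.
    have k3 : beta * c1 * (beta * X) <= beta * (c1 * X).
      have -> : beta * c1 * (beta * X) = beta * (beta * (c1 * X)) by ring.
      by rewrite ler_piMl.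
    lra.
  apply: (@le_trans _ _ ((1 - gam) `^ a * y0 `^ delta)).
    rewrite ler_wpM2l ?powR_ge0//; apply: ge0_ler_powR; rewrite ?nnegrE ?(ltW de0)//.
      by rewrite mulr_ge0// addr_ge0// mulr_ge0// ltW.
    exact: le_trans ler01 (ltW y01).
  rewrite /y0 -powRrM mulNr divfK ?lt0r_neq0// -powRD ?subrr ?powRr0//.
  by apply/implyP => _; rewrite lt0r_neq0.
exists eta, ((c + beta * M) `^ delta + 1); split => //.
  by rewrite ltr_wpDl ?powR_ge0.
move=> f m x y gf fd; rewrite -aE.
exact: (rate_fixed a beta eta a01 beta0 eta0 eta_c1 eta_beta eta1 bs).
Qed.

End Rates.

(** * Lyapunov drift *)

Lemma lipschitz_measurable (R : realType) (f : R -> R) (k : R) :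
  (forall x y, `|f x - f y| <= k * `|x - y|) -> measurable_fun setT f.
Proof.
move=> fk; apply: continuous_measurable_fun => x; apply/cvgrPdist_lt => e e0.
have k0 : 0 < `|k| + 1 by rewrite ltr_wpDl.
have ek : 0 < e / (`|k| + 1) by rewrite divr_gt0.
near=> y; apply: le_lt_trans (fk x y) _.
have : `|x - y| < e / (`|k| + 1) by near: y; apply: (@cvgr_dist_lt _ _ _ (nbhs x) _ id x) => //; exact: cvg_id.
rewrite ltr_pdivlMr// => h; apply: le_lt_trans h; rewrite mulrC ler_wpM2l//.
by apply: le_trans (ler_norm k) _; rewrite lerDl.
Unshelve. all: by end_near. Qed.

Section Phi.
Context {R : realType}.
Variable phi : R -> R.
Hypotheses (phiC : concave0 phi) (phi_ge0 : forall u, 0 <= u -> 0 <= phi u) (phiN : nondecr0 phi)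
  (phioo : phi u @[u --> +oo] --> +oo) (phi0 : phi 0 = 0).

Lemma phi_unbounded (A : R) : exists2 u, 1 <= u & A <= phi u.
Proof.
have /cvgryPge /(_ A) [M [_ HM]] := phioo.
exists (Num.max M 1 + 1); first by rewrite -[X in X <= _]add0r lerD// le_max ler01 orbT.
by apply: HM; rewrite ltr_pwDr// le_max lexx.
Qed.

Lemma phi_lin u : 1 <= u -> phi u <= phi 1 * u.
Proof.
move=> u1; have := concave_slopes _ _ _ _ phiC (lexx 0) ler01 u1.
by rewrite phi0; lra.
Qed.

Lemma phi1_gt0 : 0 < phi 1.
Proof.
rewrite lt_neqAle phi_ge0 ?ler01// andbT; apply/eqP => h.
by have [u u1] := phi_unbounded 1; have := phi_lin u u1; rewrite -h mul0r; lra.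
Qed.

(** The concave [phi] may be arbitrarily steep at [0]. The minimum with its chord line through [0]
    and [1] is still concave, is Lipschitz with constant [phi 1], and equals [phi] from [1] on. *)
Definition phit u := Num.min (phi u) (phi 1 * u).

Lemma phitE u : 1 <= u -> phit u = phi u.
Proof. by move=> u1; rewrite /phit min_l// phi_lin. Qed.

Lemma phit_le u : phit u <= phi u. Proof. by rewrite ge_min lexx. Qed.

Lemma phit_lin u : phit u <= phi 1 * u. Proof. by rewrite ge_min lexx orbT. Qed.

Lemma phit_concave : concave0 phit.
Proof.
move=> a b l a0 b0 l01; have /andP[l0 l1] := l01; have l1' : 0 <= 1 - l by lra.
have h1 := ler_wpM2l l0 (phit_le a); have h2 := ler_wpM2l l1' (phit_le b).
have h3 := ler_wpM2l l0 (phit_lin a); have h4 := ler_wpM2l l1' (phit_lin b).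
have h5 := phiC a b l a0 b0 l01.
by rewrite {3}/phit le_min; apply/andP; split; lra.
Qed.

Lemma phit_nondecr : nondecr0 phit.
Proof.
move=> a b a0 ab; rewrite {2}/phit le_min (le_trans (phit_le a) (phiN _ _ a0 ab)) /=.
by apply: le_trans (phit_lin a) _; rewrite ler_wpM2l// ltW// phi1_gt0.
Qed.

Lemma phit0 : phit 0 = 0. Proof. by rewrite /phit phi0 mulr0 minxx. Qed.

Lemma phit1 : phit 1 = phi 1. Proof. by rewrite phitE. Qed.

Lemma phit_ge0 u : 0 <= u -> 0 <= phit u.
Proof. by move=> u0; rewrite le_min phi_ge0//= mulr_ge0// ltW// phi1_gt0. Qed.

Lemma phit_lipschitz a b : 0 <= a -> 0 <= b -> `|phit a - phit b| <= phi 1 * `|a - b|.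
Proof.
move=> a0 b0.
have H u v : 0 <= u -> u <= v -> phit v <= phit u + phi 1 * (v - u).
  exact: (ph_lip _ _ phit_concave phit_nondecr phit0 (fun u _ => phit_lin u)).
have [ab|ba] := leP a b.
  have := H _ _ a0 ab; have := phit_nondecr _ _ a0 ab.
  by rewrite (ler0_norm (_ : a - b <= 0)) ?ler_norml; lra.
have := H _ _ b0 (ltW ba); have := phit_nondecr _ _ b0 (ltW ba).
by rewrite (ger0_norm (_ : 0 <= a - b)) ?ler_norml; lra.
Qed.

Lemma phit_comp_measurable (d : measure_display) (T : measurableType d) (V : T -> R) :
  measurable_fun setT V -> (forall x, 0 <= V x) -> measurable_fun setT (fun x => phit (V x)).
Proof.
move=> mV V0.
have -> : (fun x => phit (V x)) = (fun u => phit (Num.max 0 u)) \o V.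
  by apply/funext => x /=; rewrite max_r.
apply: measurableT_comp => //; apply: (lipschitz_measurable _ _ (phi 1)) => x y.
have m0 u : 0 <= Num.max 0 u :> R by rewrite le_max lexx.
apply: le_trans (phit_lipschitz _ _ (m0 x) (m0 y)) _.
rewrite ler_wpM2l ?(ltW phi1_gt0)//.
case: (leP 0 x) => hx; case: (leP 0 y) => hy; case: (ger0P (x - y)) => hxy;
  rewrite ?ler_norml; lra.
Qed.

Lemma inv_phi_measurable : measurable_fun setT (fun u : R => (phi (Num.max 1 u))^-1).
Proof.
have p1 := phi1_gt0.
apply: (lipschitz_measurable _ _ (phi 1)^-1) => x y.
set x' := Num.max 1 x; set y' := Num.max 1 y.
have x1 : 1 <= x' by rewrite le_max lexx.
have y1 : 1 <= y' by rewrite le_max lexx.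
have px : phi 1 <= phi x' by exact: phiN.
have py : phi 1 <= phi y' by exact: phiN.
have px0 := lt_le_trans p1 px; have py0 := lt_le_trans p1 py.
have -> : (phi x')^-1 - (phi y')^-1 = (phi y' - phi x') / (phi x' * phi y').
  by field; rewrite !lt0r_neq0.
rewrite normrM normfV (gtr0_norm (mulr_gt0 px0 py0)) ler_pdivrMr ?mulr_gt0//.
have h1 : `|phi y' - phi x'| <= phi 1 * `|x' - y'|.
  by rewrite distrC -(phitE x' x1) -(phitE y' y1); apply: phit_lipschitz; lra.
have h2 : `|x' - y'| <= `|x - y|.
  rewrite /x' /y'; case: (leP 1 x) => hx; case: (leP 1 y) => hy; case: (ger0P (x - y)) => hxy;
  rewrite ?ler_norml; lra.
apply: (le_trans h1); apply: (@le_trans _ _ (phi 1 * `|x - y|)); first by rewrite ler_pM2l.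
rewrite [X in _ <= X](_ : _ = `|x - y| * ((phi x' * phi y') / phi 1)); last by ring.
rewrite mulrC ler_wpM2l// ler_pdivlMr//.
by apply: ler_pM => //; exact: ltW.
Qed.

Lemma Hphi_incr a b : 1 <= a -> a <= b ->
  (Hphi phi a + ((b - a) / phi b)%:E <= Hphi phi b)%E.
Proof.
move=> a1 ab; have p1 := phi1_gt0.
have eqv v : Hphi phi v = (\int[@lebesgue_measure R]_(u in [set` `[1%R, v]]) ((phi (Num.max 1 u))^-1)%R%:E)%E.
  rewrite /Hphi (_ : [set u : R | 1 <= u <= v] = [set` `[1, v]]); last first.
    by apply/seteqP; split => u /=; rewrite in_itv.
  by apply: eq_integral => u; rewrite inE /= in_itv /= => /andP[u1 _]; rewrite max_r.
have split_itv : [set` `[1, b]] = [set` `[1, a]] `|` [set` `]a, b]] :> set R.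
  apply/seteqP; split => u /=; rewrite !in_itv /=.
    by move=> /andP[u1 ub]; have [ua|au] := leP u a; [left; rewrite u1 | right].
  by case=> /andP[h1 h2]; rewrite ?h1 ?h2 ?andbT//=; lra.
have ge0 (u : R) : 0 <= (phi (Num.max 1 u))^-1.
  by rewrite invr_ge0 phi_ge0// le_max ler01.
rewrite !eqv split_itv ge0_integral_setU//=; last 3 first.
- by apply/measurable_EFinP; apply: measurable_funTS; exact: inv_phi_measurable.
- by move=> u _; rewrite lee_fin.
- by rewrite disj_set2E; apply/eqP/seteqP; split => u //= -[]; rewrite !in_itv /=; lra.
apply: leeD => //.
apply: (@le_trans _ _ (\int[@lebesgue_measure R]_(u in [set` `]a, b]]) ((phi b)^-1)%R%:E)%E).
  rewrite integral_cst//= lebesgue_measure_itv /= lte_fin.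
  case: ltP => ab'; first by rewrite -EFinB -EFinM lee_fin mulrC.
  by rewrite mule0 (_ : b = a) ?subrr ?mul0r//; apply/eqP; rewrite eq_le ab ab'.
apply: ge0_le_integral_lower => u /=; rewrite in_itv /= => /andP[au ub]; rewrite lee_fin.
  by rewrite invr_ge0 phi_ge0//; lra.
have u1 : 1 <= u by lra.
rewrite max_r// lef_pV2 ?posrE//.
- by apply: phiN => //; lra.
- by apply: lt_le_trans p1 _; apply: phiN => //; lra.
- by apply: lt_le_trans p1 _; exact: phiN.
Qed.

End Phi.

Section Drift.
Context {R : realType} {d : measure_display} {E : measurableType d}.
Variable P : R -> E -> probability E R.
Hypothesis mtf : markov_tf P.
Variables (V : E -> R) (phi : R -> R) (K : R).
Hypotheses (mV : measurable_fun setT V) (V0 : forall x, 0 <= V x) (K0 : 0 < K).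
Hypotheses (phiC : concave0 phi) (phi_ge0 : forall u, 0 <= u -> 0 <= phi u) (phiN : nondecr0 phi)
  (phioo : phi u @[u --> +oo] --> +oo) (phi0 : phi 0 = 0).
Hypothesis lyap : (forall t x, 0 <= t ->
     (\int[P t x]_y (V y)%:E
      + \int[@lebesgue_measure R]_(s in [set s : R | (0 <= s <= t)%R])
            (\int[P s x]_y (phi (V y))%:E)
      <= (V x + K * t)%:E)%E).

Let c := phi 1.
Let ph := phit phi.
Let c0 : 0 < c. Proof. exact: phi1_gt0. Qed.
Let pC : concave0 ph. Proof. exact: phit_concave. Qed.
Let pN : nondecr0 ph. Proof. exact: phit_nondecr. Qed.
Let p0 : ph 0 = 0. Proof. exact: phit0. Qed.
Let pL u : 0 <= u -> ph u <= c * u. Proof. by move=> _; exact: phit_lin. Qed.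
Let pge u : 0 <= u -> 0 <= ph u. Proof. exact: phit_ge0. Qed.
Let mpV : measurable_fun setT (fun x => ph (V x)). Proof. exact: phit_comp_measurable. Qed.

Lemma V_integral_le t x : 0 <= t -> (\int[P t x]_y (V y)%:E <= (V x + K * t)%:E)%E.
Proof.
move=> t0; apply: le_trans (lyap t x t0); apply: leeDl.
apply: integral_ge0 => s _; apply: integral_ge0 => y _; rewrite lee_fin phi_ge0//.
Qed.

Lemma V_itg t x : 0 <= t -> itg (P t x) V.
Proof.
move=> t0; apply/integrableP; split; first exact/measurable_EFinP.
rewrite (_ : (\int[P t x]_y _)%E = (\int[P t x]_y (V y)%:E)%E).
  by apply: le_lt_trans (V_integral_le t x t0) _; rewrite ltry.
by apply: eq_integral => y _ /=; rewrite ger0_norm.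
Qed.

Lemma V_Ex_le t x : 0 <= t -> Ex (P t x) V <= V x + K * t.
Proof. by move=> t0; rewrite -lee_fin ExE ?V_integral_le//; exact: V_itg. Qed.

Lemma phV_itg t x : 0 <= t -> itg (P t x) (fun y => ph (V y)).
Proof.
move=> t0; apply: (itg_le _ _ (fun y => c * V y)) => //; last by apply: itgZ; exact: V_itg.
by move=> y; rewrite ger0_norm ?pge// pL.
Qed.

(** Jensen's inequality through a supergradient of slope at most [c], combined with the growth of
    the mean of [V] by at most [K * t]. *)
Lemma phV_growth s t x : 0 <= s -> 0 <= t ->
  Ex (P (s + t) x) (fun y => ph (V y)) <= Ex (P s x) (fun y => ph (V y)) + c * K * t.
Proof.
move=> s0 t0.
have [i1 E1] := OpD_ge0 P mtf s t (fun y => ph (V y)) x s0 t0 (fun y => pge _ (V0 y))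
  (fun t y t0 => phV_itg t y t0).
move: E1; rewrite /Op => ->.
rewrite -[X in _ <= _ + X](Ex_cst (P s x)) -ExD; [|exact: phV_itg|exact: itg_cst].
apply: Ex_le => //; first by apply: itgD; [exact: phV_itg | exact: itg_cst].
move=> y; have [sl /andP[sl0 slc] Hsl] := ph_supergradient _ c pC pN p0 c0 pL (V y) (V0 y).
have iV := V_itg t y t0.
apply: (@le_trans _ _ (Ex (P t y) (fun z => (ph (V y) - sl * V y) + sl * V z))).
  apply: Ex_le; [exact: phV_itg | apply: itgD; [exact: itg_cst | exact: itgZ] |].
  by move=> z; have := Hsl (V z) (V0 z); lra.
rewrite ExD; [|exact: itg_cst | exact: itgZ]; rewrite Ex_cst ExZ//.
have h1 := ler_wpM2l sl0 (V_Ex_le t y t0).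
have h2 := ler_wpM2r (mulr_ge0 (ltW K0) t0) slc.
lra.
Qed.

(* [s |-> P_s (ph V) x] grows at most linearly, hence the time integral over [0, h] dominates
   [h] times its final value up to a constant. *)
Lemma discrete_drift h x : 0 < h ->
  Ex (P h x) V + h * Ex (P h x) (fun y => ph (V y)) <= V x + (K * h + c * K * h * h).
Proof.
move=> h0; have h0' := ltW h0.
set g := Ex (P h x) (fun y => ph (V y)).
(* The truncation keeps the lower bound on the time integrand nonnegative, as comparison of lower
   integrals requires. *)
pose q := Num.max 0 (g - c * K * h).
have q0 : 0 <= q by rewrite le_max lexx.
have key : ((h * q)%:E <= \int[@lebesgue_measure R]_(s in [set s : R | (0 <= s <= h)%R])
            (\int[P s x]_y (phi (V y))%:E))%E.
  apply: (@le_trans _ _ (\int[@lebesgue_measure R]_(s in [set s : R | (0 <= s <= h)%R]) q%:E)%E).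
    rewrite (_ : [set s : R | 0 <= s <= h] = [set` `[0, h]]); last first.
      by apply/seteqP; split => u /=; rewrite in_itv.
    by rewrite integral_cst//= lebesgue_measure_itv /= lte_fin h0 -EFinB -EFinM lee_fin subr0 mulrC.
  apply: ge0_le_integral_lower => s /= /andP[s0 sh]; first by rewrite lee_fin.
  apply: (@le_trans _ _ (\int[P s x]_y (ph (V y))%:E)%E).
    rewrite -ExE; last exact: phV_itg.
    rewrite lee_fin /q ge_max Ex_ge0 /=; last by move=> y; exact: pge.
    have sh' : 0 <= h - s by lra.
    have := phV_growth s (h - s) x s0 sh'; rewrite (_ : s + (h - s) = h); last by ring.
    rewrite -/g => k; have := mulr_ge0 (mulr_ge0 (ltW c0) (ltW K0)) s0; lra.
  by apply: ge0_le_integral_lower => y _; rewrite lee_fin ?pge//; exact: phit_le.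
have := lyap h x h0'; rewrite -ExE; last exact: V_itg.
move=> k; have {}k : ((Ex (P h x) V)%:E + (h * q)%:E <= (V x + K * h)%:E)%E.
  by apply: le_trans k; apply: leeD.
rewrite -EFinD lee_fin in k.
have : h * (g - c * K * h) <= h * q by rewrite ler_pM2l// le_max lexx orbT.
lra.
Qed.

End Drift.

(** * Invariant measure *)

Section RealSequences.
Context {R : realType}.

Lemma cauchy_rate_cvg (u e : nat -> R) : (forall m n, `|u m - u n| <= e m + e n) ->
  e n @[n --> \oo] --> 0 -> cvgn u.
Proof.
move=> ue e0; apply/cauchy_cvgP/cauchy_exP => eps eps0.
have e20 : 0 < eps / 4 by rewrite divr_gt0.
have /cvgrPdist_le /(_ _ e20) [N _ HN] := e0.
have He n : (N <= n)%N -> e n <= eps / 4.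
  by move=> /HN /=; rewrite sub0r normrN; exact: le_trans (ler_norm _).
exists (u N); exists N => // n Nn /=; rewrite /ball /=.
by apply: le_lt_trans (ue _ _) _; have := He _ Nn; have := He _ (leqnn N); lra.
Qed.

(* Comparing both sequences with their Cesaro means removes the need for a bound on
   [|a p - a (p + j)|] that is uniform in [j]. *)
Lemma cesaro_cauchy (a : nat -> R) (p q : nat) (ep eq : R) :
  (forall i j, `|a i - a j| <= 1) ->
  (forall m, (0 < m)%N -> \sum_(j < m) `|a p - a (p + j)%N| <= m%:R * ep) ->
  (forall m, (0 < m)%N -> \sum_(j < m) `|a q - a (q + j)%N| <= m%:R * eq) ->
  `|a p - a q| <= ep + eq.
Proof.
move=> a1 Hp Hq; apply: (@le_of_natr _ _ _ (p + q)%:R) => m m0.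
have shift k : `|\sum_(j < m) a (k + j)%N - \sum_(j < m) a j| <= k%:R.
  elim: k => [|k IH].
    by rewrite (eq_bigr (fun j : 'I_m => a j)) ?subrr ?normr0.
  have E1 : \sum_(j < m) a (k.+1 + j)%N = \sum_(j < m) a (k + j)%N + (a (k + m)%N - a k).
    have E0 : \sum_(j < m.+1) a (k + j)%N = a k + \sum_(j < m) a (k.+1 + j)%N.
      rewrite big_ord_recl addn0; congr (_ + _); apply: eq_bigr => i _.
      by rewrite /= /bump /= add1n addnS addSn.
    by move: E0; rewrite big_ord_recr /=; lra.
  rewrite E1 addrAC -natr1; apply: le_trans (ler_normD _ _) _; apply: lerD => //.
have -> : m%:R * `|a p - a q| = `|\sum_(j < m) (a p - a (p + j)%N) -
   \sum_(j < m) (a q - a (q + j)%N) + ((\sum_(j < m) a (p + j)%N - \sum_(j < m) a j) -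
   (\sum_(j < m) a (q + j)%N - \sum_(j < m) a j))|.
  rewrite !sumrB !sumr_const !card_ord -[m%:R in LHS]ger0_norm ?ler0n// -normrM; congr `|_|.
  by rewrite -[a p *+ m]mulr_natl -[a q *+ m]mulr_natl; ring.
apply: le_trans (ler_normD _ _) _; rewrite natrD mulrDr; apply: lerD.
  apply: le_trans (ler_normB _ _) _; apply: lerD.
    exact: le_trans (ler_norm_sum _ _ _) (Hp m m0).
  exact: le_trans (ler_norm_sum _ _ _) (Hq m m0).
by apply: le_trans (ler_normB _ _) _; apply: lerD.
Qed.

End RealSequences.

Section Mixtures.
Context {R : realType} {d : measure_display} {E : measurableType d}.
Context {d' : measure_display} {T : measurableType d'}.

Lemma mixture_exists (nu : probability T R) (kp : T -> probability E R) :
  (forall A, measurable A -> measurable_fun setT (fun x => kp x A : \bar R)) ->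
  exists mu : probability E R, forall A, mu A = (\int[nu]_x kp x A)%E.
Proof.
move=> mkp; have [||||mu Hmu] := @mk_probability R d E (fun A => (\int[nu]_x kp x A)%E).
- by apply: integral0_eq => x _; rewrite measure0.
- by move=> A; apply: integral_ge0 => x _; exact: measure_ge0.
- move=> F mF tF mUF.
  rewrite (_ : (\int[nu]_x kp x (\bigcup_n F n))%E =
     (\sum_(0 <= n <oo) \int[nu]_x kp x (F n))%E); last first.
    rewrite -integral_nneseries//; last by move=> n; exact: mkp.
    by apply: eq_integral => x _; rewrite [LHS]measure_semi_bigcup.
  by apply: is_cvg_nneseries => n _ _; apply: integral_ge0 => x _; exact: measure_ge0.
- rewrite (eq_integral (fun=> 1%E)); last by move=> x _; exact: probability_setT.
  by rewrite integral_cst// mul1e [LHS]probability_setT.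
by exists mu.
Qed.

End Mixtures.

(** * Weak limits tested on bounded continuous functions *)

Section Portmanteau.
Context {R : realType} {d : measure_display} {E : measurableType d}.
Variable rho : E -> E -> R.
Hypothesis polish : polish_borel rho.
Variables (mu_ : nat -> probability E R) (pi : probability E R).
Hypothesis weak : forall f, BL rho f -> Ex (mu_ n) f @[n --> \oo] --> Ex pi f.

(* The infimal convolutions [inf_y (g y + j * rho1 x y)] are Lipschitz and increase to [g]. *)
Lemma lower_portmanteau g (M l : R) : rho_continuous rho g -> (forall x, `|g x| <= M) ->
  Ex (mu_ n) g @[n --> \oo] --> l -> Ex pi g <= l.
Proof.
move=> cg gM gl.
have mg := continuous_measurable_rho _ polish _ cg.
pose S (j : nat) x := [set g y + j%:R * rho1 rho x y | y in [set: E]].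
pose gj j x := inf (S j x).
have lbS j x : has_lbound (S j x).
  exists (- M) => _ [y _ <-]; have := gM y; rewrite ler_norml => /andP[h _].
  by rewrite ler_wpDr// mulr_ge0// (rho1_ge0 _ polish).
have neS j x : S j x !=set0 by exists (g x + j%:R * rho1 rho x x), x.
have gj_le j x y : gj j x <= g y + j%:R * rho1 rho x y.
  by apply: ge_inf => //; exists y.
have gj_ge j x v : (forall y, v <= g y + j%:R * rho1 rho x y) -> v <= gj j x.
  by move=> H; apply: lb_le_inf => // _ [y _ <-].
have gjg j x : gj j x <= g x by have := gj_le j x x; rewrite (rho1_xx _ polish) mulr0 addr0.
have gjM j x : `|gj j x| <= M.
  have := gM x; rewrite !ler_norml => /andP[h1 h2]; apply/andP; split; last exact: le_trans (gjg _ _) h2.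
  apply: gj_ge => y; have := gM y; rewrite ler_norml => /andP[h _].
  by rewrite ler_wpDr// mulr_ge0// (rho1_ge0 _ polish).
have gjB j : BL rho (gj j).
  exists j%:R.
  have H x y : gj j x - gj j y <= j%:R * rho1 rho x y.
    rewrite lerBlDl -lerBlDr; apply: gj_ge => v.
    have := gj_le j x v; have := ler_wpM2l (ler0n _ j) (rho1_tri _ polish x y v); lra.
  by move=> x y; rewrite ler_norml H andbT lerNl opprB (rho1_sym _ polish); exact: H.
have M0 : 0 <= M by apply: le_trans (gM point).
have gjc x : gj j x @[j --> \oo] --> g x.
  apply/cvgrPdist_le => e e0; have [del del0 Hdel] := cg x e e0.
  pose del' := Num.min del 1; have del'0 : 0 < del' by rewrite lt_min del0 ltr01.
  have M2 : 0 < 2 * M + 1 by lra.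
  have [N [N0 HN]] := inv_natr_small (del' / (2 * M + 1)) (divr_gt0 del'0 M2).
  exists N => // j /= Nj; rewrite ger0_norm ?subr_ge0// lerBlDr -lerBlDl.
  apply: gj_ge => y; have [dy|dy] := leP del' (rho1 rho x y).
    have h1 : 2 * M + 1 <= j%:R * del'.
      move: HN; rewrite ler_pdivlMr; last lra.
      rewrite ler_pdivrMl ?ltr0n// => h; apply: (le_trans h).
      by rewrite ler_wpM2r ?(ltW del'0)// ler_nat.
    have h2 := ler_wpM2l (ler0n R j) dy.
    by have := gM x; have := gM y; rewrite !ler_norml; lra.
  have rd : rho x y < del.
    move: dy; rewrite /rho1 /del' gt_min !lt_min ltxx andbF orbF => /andP[].
    by [].
  have := Hdel y rd; rewrite ltr_norml => /andP[_ h].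
  have := mulr_ge0 (ler0n R j) (rho1_ge0 _ polish x y); lra.
have c1 := Ex_bounded_cvg pi gj g M (fun j => BL_measurable _ polish _ (gjB j)) mg gjM gjc.
rewrite -(cvg_lim (@Rhausdorff R) c1); apply: limr_le; first by apply/cvg_ex; exists (Ex pi g).
apply: nearW => j.
have c2 := weak _ (gjB j).
rewrite -(cvg_lim (@Rhausdorff R) c2) -(cvg_lim (@Rhausdorff R) gl).
apply: ler_lim; [by apply/cvg_ex; exists (Ex pi (gj j)) | by apply/cvg_ex; exists l |].
apply: nearW => n; apply: Ex_le => //; first by exact: (BL_itg rho polish).
by apply: itg_bdd => //; exists M.
Qed.

(** The Feller property yields only continuity of [Op t f], so convergence on Lipschitz functions
    has to be extended before invariance can be tested. *)
Lemma portmanteau g (M l : R) : rho_continuous rho g -> (forall x, `|g x| <= M) ->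
  Ex (mu_ n) g @[n --> \oo] --> l -> Ex pi g = l.
Proof.
move=> cg gM gl; have mg := continuous_measurable_rho _ polish _ cg.
have ig m : itg m g by apply: itg_bdd => //; exists M.
apply/eqP; rewrite eq_le (lower_portmanteau g M l)//= -lerN2 -ExN//.
apply: (lower_portmanteau _ M (- l)).
- move=> x e e0; have [del del0 H] := cg x e e0; exists del => // y /H.
  by rewrite -opprD normrN.
- by move=> x; rewrite normrN.
- rewrite (_ : (fun n => _) = (fun n => - Ex (mu_ n) g)); first exact: cvgN.
  by apply/funext => n; rewrite ExN.
Qed.

End Portmanteau.

(** * Existence, uniqueness and moments of the invariant measure *)

Section Ergodic.
Context {R : realType} {d : measure_display} {E : measurableType d}.
Variable rho : E -> E -> R.
Hypothesis polish : polish_borel rho.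
Variable P : R -> E -> probability E R.
Hypotheses (mtf : markov_tf P) (fel : feller rho P).
Variables (h c0 K3 : R) (W phW : E -> R) (eps : nat -> R).
Hypotheses (h0 : 0 < h) (c00 : 0 < c0) (K30 : 0 <= K3) (W0 : forall x, 0 <= W x)
  (phW0 : forall x, 0 <= phW x)
  (iW : forall t x, 0 <= t -> itg (P t x) W) (iphW : forall t x, 0 <= t -> itg (P t x) phW)
  (driftW : forall x, Op P h W x <= W x - c0 * phW x + K3)
  (eps_ge0 : forall k, 0 <= eps k) (epscv : eps k @[k --> \oo] --> 0)
  (osc : forall f k x y, lip1 rho f ->
    `|Op P ((2 * k)%:R * h) f x - Op P ((2 * k)%:R * h) f y| <= eps k * (1 + phW x + phW y)).

Let mW : measurable_fun setT W. Proof. by exact: itg_meas (iW 0 point (lexx 0)). Qed.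
Let mphW : measurable_fun setT phW. Proof. by exact: itg_meas (iphW 0 point (lexx 0)). Qed.
Let th0 n : 0 <= n%:R * h. Proof. by rewrite mulr_ge0 ?ler0n// ltW. Qed.

Let lip_good f : lip1 rho f -> good f := lip1_good rho polish f.

(** The drift inequality telescopes along the chain; it bounds the time average of [phW], although
    no uniform bound at individual times is available. *)
Lemma cesaro_phW m x : (0 < m)%N ->
  \sum_(j < m) Op P (j%:R * h) phW x <= m%:R * ((Op P 0 W x + K3) / c0).
Proof.
move=> m0.
have H k : c0 * \sum_(j < k) Op P (j%:R * h) phW x + Op P (k%:R * h) W x <= Op P 0 W x + k%:R * K3.
  elim: k => [|k IH]; first by rewrite big_ord0 mulr0 !mul0r add0r addr0.
  rewrite big_ord_recr /= mulrDr.
  have [i1 E1] := OpD_ge0 P mtf (k%:R * h) h W x (th0 k) (ltW h0) W0 (fun t y t0 => iW t y t0).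
  rewrite (_ : k.+1%:R * h = k%:R * h + h); last by rewrite -natr1; ring.
  rewrite E1.
  have : Op P (k%:R * h) (Op P h W) x <= Op P (k%:R * h) W x - c0 * Op P (k%:R * h) phW x + K3.
    have i2 := iW (k%:R * h) x (th0 k); have i3 := itgZ _ c0 _ (iphW (k%:R * h) x (th0 k)).
    rewrite /Op -(ExZ _ _ _ (iphW (k%:R * h) x (th0 k))) -(ExB _ _ _ i2 i3).
    rewrite -[X in _ <= _ + X](Ex_cst (P (k%:R * h) x)) -ExD; [|exact: itgB|exact: itg_cst].
    apply: Ex_le => //; first by apply: itgD; [exact: itgB | exact: itg_cst].
  by rewrite -natr1; lra.
have := H m; have : 0 <= Op P (m%:R * h) W x by exact: Ex_ge0.
have : Op P 0 W x <= m%:R * Op P 0 W x.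
  by rewrite ler_peMl ?Ex_ge0// ler1n.
rewrite mulrA ler_pdivlMr//; lra.
Qed.

Let x0 : E := point.
Let mu_ k := P ((2 * k)%:R * h) x0.
Let Cst := 1 + phW x0 + (Op P 0 W x0 + K3) / c0.
Let eps' k := eps k * Cst.

(** By the semigroup property, [a (2 * k + j)] is the mean of [Op ((2 * k) * h) f] over the position
    at time [j * h]. The oscillation bound therefore integrates to the mean of [phW] at that time,
    and the average over [j] is bounded. *)
Lemma uniform_cauchy f : lip1 rho f -> forall k l, `|Ex (mu_ k) f - Ex (mu_ l) f| <= eps' k + eps' l.
Proof.
move=> lf k l; have gf := lip_good _ lf.
pose a n := Op P (n%:R * h) f x0.
have main k' m : (0 < m)%N -> \sum_(j < m) `|a (2 * k')%N - a (2 * k' + j)%N| <= m%:R * eps' k'.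
  move=> m0; set g := Op P ((2 * k')%:R * h) f.
  have gg : good g by apply: Op_good.
  apply: (@le_trans _ _ (\sum_(j < m) eps k' * (1 + phW x0 + Op P (j%:R * h) phW x0))).
    apply: ler_sum => j _.
    have -> : a (2 * k' + j)%N = Op P (j%:R * h) g x0.
      by rewrite /a (_ : (2 * k' + j)%:R * h = j%:R * h + (2 * k')%:R * h) ?OpD// natrD; ring.
    have -> : a (2 * k')%N - Op P (j%:R * h) g x0 = Ex (P (j%:R * h) x0) (fun y => g x0 - g y).
      by rewrite ExB ?Ex_cst//; [exact: itg_cst | exact: good_itg].
    have i1 := iphW (j%:R * h) x0 (th0 j).
    have -> : eps k' * (1 + phW x0 + Op P (j%:R * h) phW x0) =
        Ex (P (j%:R * h) x0) (fun y => eps k' * (1 + phW x0 + phW y)).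
      have i2 := itg_cst (P (j%:R * h) x0) (1 + phW x0).
      by rewrite (ExZ _ _ _ (itgD _ _ _ i2 i1)) (ExD _ _ _ i2 i1) Ex_cst.
    apply: Ex_norm_le.
    - by apply: itgB; [exact: itg_cst | exact: good_itg].
    - by apply: itgZ; apply: itgD => //; exact: itg_cst.
    - by move=> y; exact: osc.
  rewrite -mulr_sumr big_split /= sumr_const card_ord -[_ *+ m]mulr_natl.
  by have := ler_wpM2l (eps_ge0 k') (cesaro_phW m x0 m0); rewrite /eps' /Cst; lra.
have := cesaro_cauchy a (2 * k) (2 * l) (eps' k) (eps' l) _ (main k) (main l).
apply => i j.
have [m Hm] := lip1_range rho f lf.
have an n : m <= a n <= m + 1 by exact: Op_range.
by have := an i; have := an j; rewrite ler_norml; lra.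
Qed.

Lemma eps'_cvg : eps' k @[k --> \oo] --> 0.
Proof. by rewrite -(mul0r Cst); apply: cvgMl. Qed.

Lemma BL_cvg f : BL rho f -> cvgn (fun k => Ex (mu_ k) f).
Proof.
move=> bf; have [k k0 lf] := BL_lip1 _ polish _ bf.
apply: (cauchy_rate_cvg _ (fun n => k * eps' n)); last first.
  by rewrite -(mulr0 k); apply: cvgMr; exact: eps'_cvg.
move=> m n; have := uniform_cauchy _ lf m n.
have ib m' := BL_itg rho polish m' f bf.
rewrite (ExZ _ _ _ (ib (mu_ m))) (ExZ _ _ _ (ib (mu_ n))) -mulrBr normrM gtr0_norm ?invr_gt0// ler_pdivrMl//.
by rewrite mulrDr.
Qed.

(** The limit is taken from one starting point; the oscillation bound makes it the same from every
    other, which is used both for invariance and for uniqueness. *)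
Lemma invariant_measure : exists pi : probability E R,
  invariant_prob P pi /\ (forall f, lip1 rho f -> forall x,
    Op P ((2 * k)%:R * h) f x @[k --> \oo] --> Ex pi f).
Proof.
pose Lam f := limn (fun k => Ex (mu_ k) f).
have LamP f : BL rho f -> Ex (mu_ n) f @[n --> \oo] --> Lam f by move=> /BL_cvg.
have [pi Hpi] := limit_measure rho polish mu_ eps' Lam eps'_cvg uniform_cauchy LamP.
have weak f : BL rho f -> Ex (mu_ n) f @[n --> \oo] --> Ex pi f by move=> bf; rewrite Hpi//; exact: LamP.
have pw f : lip1 rho f -> forall x, Op P ((2 * k)%:R * h) f x @[k --> \oo] --> Ex pi f.
  move=> lf x; have c1 := weak _ (lip1_BL _ _ lf).
  rewrite -[X in _ --> X]addr0 (_ : (fun k => _) = (fun k => Ex (mu_ k) f +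
    (Op P ((2 * k)%:R * h) f x - Ex (mu_ k) f))); last by apply/funext => k; ring.
  apply: cvgD => //; apply: norm_cvg0.
  apply: (@squeeze_cvgr _ _ _ _ (fun=> 0) (fun k => eps k * (1 + phW x + phW x0))).
  - by apply: nearW => k; rewrite normr_ge0 /=; exact: osc.
  - exact: cvg_cst.
  - by rewrite -(mul0r (1 + phW x + phW x0)); apply: cvgMl.
exists pi; split => // t A t0 mA.
have [m Hm] := mixture_exists pi (P t) (fun A mA => P_meas P mtf t A t0 mA).
have mm : forall f, BL rho f -> Ex m f = Ex pi f.
  have L1 f : lip1 rho f -> Ex m f = Ex pi f.
    move=> lf; have gf := lip_good _ lf.
    have -> : Ex m f = Ex pi (Op P t f).
      exact: (mix_Ex_bdd pi (P t) m (fun A mA => P_meas P mtf t A t0 mA) (fun A _ => Hm A) f gf.1 gf.2).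
    have [cg [M HM]] := fel t f t0 (lip1_continuous rho polish _ lf) gf.2.
    apply: (portmanteau rho polish mu_ pi weak _ M) => //.
    have [F HF] := gf.2.
    (* Commuting [P t] with the chain turns the limit of [Ex (mu_ k) (Op P t f)] into an expectation
       under [P t x0] of functions that converge to the constant [Ex pi f]. *)
    have := Ex_bounded_cvg (P t x0) (fun k => Op P ((2 * k)%:R * h) f) (fun=> Ex pi f) F
      (fun k => (Op_good P mtf _ f (th0 _) gf).1) (measurable_cst _) _ (pw f lf).
    rewrite Ex_cst (_ : (fun k => Ex (P t x0) _) = (fun k => Ex (mu_ k) (Op P t f))); last first.
      apply/funext => k; rewrite -/(Op P t _ x0) -(OpD P mtf)// addrC OpD//.
    apply => k y; rewrite -(Ex_cst (P ((2 * k)%:R * h) y) F).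
    by apply: Ex_norm_le => //; [exact: good_itg | exact: itg_cst].
  move=> f bf; have [k k0 lf] := BL_lip1 _ polish _ bf.
  have ib m' := BL_itg rho polish m' f bf.
  have := L1 _ lf; rewrite (ExZ _ _ _ (ib m)) (ExZ _ _ _ (ib pi)) => /mulfI; apply.
  by rewrite invr_neq0// lt0r_neq0.
by rewrite -Hm; exact: (prob_eq_BL rho polish).
Qed.

Lemma inv_Op pi t f : invariant_prob P pi -> 0 <= t -> good f -> Ex pi (Op P t f) = Ex pi f.
Proof.
move=> ipi t0 gf; apply/esym.
exact: (mix_Ex_bdd pi (P t) pi (fun A mA => P_meas P mtf t A t0 mA)
  (fun A mA => esym (ipi t A t0 mA)) f gf.1 gf.2).
Qed.

(** Integrating the pointwise convergence against [mu] by bounded convergence leaves [Ex mu f]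
    unchanged at every time. *)
Lemma invariant_unique pi mu :
  (forall f, lip1 rho f -> forall x, Op P ((2 * k)%:R * h) f x @[k --> \oo] --> Ex pi f) ->
  invariant_prob P mu -> forall A, measurable A -> mu A = pi A.
Proof.
move=> pw imu; apply: (prob_eq_BL rho polish).
have L1 f : lip1 rho f -> Ex mu f = Ex pi f.
  move=> lf; have gf := lip_good _ lf; have [F HF] := gf.2.
  have := Ex_bounded_cvg mu (fun k => Op P ((2 * k)%:R * h) f) (fun=> Ex pi f) F
      (fun k => (Op_good P mtf _ f (th0 _) gf).1) (measurable_cst _) _ (pw f lf).
  rewrite Ex_cst (_ : (fun k => Ex mu _) = (fun k => Ex mu f)); last first.
    by apply/funext => k; exact: inv_Op.
  move=> H; have {}H : (fun _ : nat => Ex mu f) @ \oo --> Ex pi f.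
    apply: H => k y; rewrite -(Ex_cst (P ((2 * k)%:R * h) y) F).
    by apply: Ex_norm_le => //; [exact: good_itg | exact: itg_cst].
  exact: (cvg_unique (@Rhausdorff R) (@cvg_cst _ _ _ _ _) H).
move=> f bf; have [k k0 lf] := BL_lip1 _ polish _ bf.
have ib m' := BL_itg rho polish m' f bf.
have := L1 _ lf; rewrite (ExZ _ _ _ (ib mu)) (ExZ _ _ _ (ib pi)) => /mulfI; apply.
by rewrite invr_neq0// lt0r_neq0.
Qed.

(* Applying the drift to the truncations [W /\ n] avoids assuming that [W] is integrable. *)
Lemma invariant_moment pi : invariant_prob P pi -> itg pi phW /\ Ex pi phW <= K3 / c0.
Proof.
move=> ipi.
pose Wn (n : nat) x := Num.min (W x) n%:R.
have gWn n : good (Wn n).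
  split; first exact: measurable_minr.
  by exists n%:R => x; rewrite ger0_norm ?le_min ?W0 ?ler0n// ge_min lexx orbT.
pose D n : set E := [set x | W x <= n%:R].
have mD n : measurable (D n).
  rewrite (_ : D n = [set x | - n%:R <= - W x]); last by apply/seteqP; split => x /=; rewrite lerN2.
  by apply: measurable_ge; exact: measurable_funN.
pose g n x := phW x * \1_(D n) x.
have mg n : measurable_fun setT (g n) by apply: measurable_funM => //; exact: measurable_indic.
have g0 n x : 0 <= g n x by rewrite mulr_ge0.
have pt n x : c0 * g n x <= Wn n x - Op P h (Wn n) x + K3.
  have up1 : Op P h (Wn n) x <= Op P h W x.
    by apply: Ex_le; [exact: good_itg | exact/iW/ltW | move=> y; rewrite ge_min lexx].
  have up2 : Op P h (Wn n) x <= n%:R.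
    by apply: Ex_le_cst; [exact: good_itg | move=> y; rewrite ge_min lexx orbT].
  have dr := driftW x; rewrite /g indicE; have [/set_mem Dx|/negP nDx] := boolP (x \in D n).
    by rewrite mulr1 /Wn min_l//; lra.
  rewrite !mulr0 /Wn min_r; first by have := K30; lra.
  by rewrite leNgt; apply/negP => hlt; apply: nDx; rewrite inE; exact: ltW.
have ig n : itg pi (g n).
  apply: (itg_le _ _ (fun x => c0^-1 * (Wn n x - Op P h (Wn n) x + K3))) => //.
    by move=> x; rewrite ger0_norm// ler_pdivlMl.
  apply: itgZ; apply: itgD; last exact: itg_cst.
  by apply: itgB; apply: good_itg => //; apply: Op_good => //; exact: ltW.
have bound n : Ex pi (g n) <= K3 / c0.
  rewrite ler_pdivlMr// mulrC -ExZ//.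
  have i1 := good_itg pi _ (gWn n); have i2 := good_itg pi _ (Op_good P mtf h _ (ltW h0) (gWn n)).
  apply: le_trans (Ex_le _ _ _ (itgZ _ _ _ (ig n)) (itgD _ _ _ (itgB _ _ _ i1 i2) (itg_cst _ K3)) (pt n)) _.
  rewrite (ExD _ _ _ (itgB _ _ _ i1 i2) (itg_cst _ K3)) (ExB _ _ _ i1 i2) Ex_cst inv_Op ?(ltW h0)//.
  by rewrite subrr add0r.
have mono x : {homo (fun n => (g n x)%:E) : m n / (m <= n)%N >-> (m <= n)%E}.
  move=> m n mn; rewrite lee_fin ler_wpM2l// !indicE ler_nat.
  case: (boolP (x \in D m)) => // /set_mem Dx; rewrite lt0b mem_set//.
  by apply: (le_trans Dx); rewrite ler_nat.
have limg x : (limn (fun n => (g n x)%:E) = (phW x)%:E)%E.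
  apply/cvg_lim => //; apply: cvg_near_cst.
  exists (Num.truncn (W x)).+1 => // n /= hn; rewrite /g indicE mem_set ?mulr1//.
  by apply: le_trans (ltW (truncnS_gt _)) _; rewrite ler_nat.
have E1 : (\int[pi]_x (phW x)%:E = limn (fun n => (Ex pi (g n))%:E))%E.
  under eq_integral do rewrite -limg.
  rewrite (@monotone_convergence _ _ _ pi _ measurableT (fun n x => (g n x)%:E)
    (fun n => (measurable_EFinP _ _).2 (mg n)) (fun n y _ => g0 n y) (fun y _ => mono y)).
  by congr (limn _); apply/funext => n; rewrite ExE.
have E2 : (\int[pi]_x (phW x)%:E <= (K3 / c0)%:E)%E.
  rewrite E1; apply: lime_le.
    apply: ereal_nondecreasing_is_cvgn => m n mn; rewrite lee_fin; apply: Ex_le => // x.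
    by rewrite -lee_fin; exact: mono.
  by apply: nearW => n; rewrite lee_fin.
have i : itg pi phW.
  apply/integrableP; split; first exact/measurable_EFinP.
  rewrite (_ : (\int[pi]_x _)%E = (\int[pi]_x (phW x)%:E)%E).
    by apply: le_lt_trans E2 _; rewrite ltry.
  by apply: eq_integral => x _ /=; rewrite ger0_norm.
by split => //; rewrite -lee_fin ExE.
Qed.

End Ergodic.

(** * Choice of the constants *)

Section Setup.
Context {R : realType} {d : measure_display} {E : measurableType d}.
Variables (rho : E -> E -> R) (P : R -> E -> probability E R)
  (V : E -> R) (phi : R -> R) (K : R) (theta : E -> E -> R) (r L : R -> R) (t0 : R).
Hypotheses (polish : polish_borel rho) (mtf : markov_tf P)
  (mV : measurable_fun setT V) (V0 : forall x, 0 <= V x)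
  (phiC : concave0 phi) (phi_ge0 : forall u, 0 <= u -> 0 <= phi u) (phiN : nondecr0 phi)
  (phioo : phi u @[u --> +oo] --> +oo) (phi0 : phi 0 = 0) (K0 : 0 < K).
Hypothesis lyap : (forall t x, 0 <= t ->
     (\int[P t x]_y (V y)%:E
      + \int[@lebesgue_measure R]_(s in [set s : R | (0 <= s <= t)%R])
            (\int[P s x]_y (phi (V y))%:E)
      <= (V x + K * t)%:E)%E).
Hypotheses (prem : premetric rho theta) (rho_theta : forall x y, rho1 rho x y <= theta x y)
  (asA : assumptionA P theta r L) (t00 : 0 < t0)
  (asB : forall M : R, 0 < M -> assumptionB1 P theta [set x | V x <= M] t0).

Let c := phi 1.
Let ph := phit phi.
Let cp : 0 < c. Proof. exact: phi1_gt0. Qed.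
Let pC : concave0 ph. Proof. exact: phit_concave. Qed.
Let pN : nondecr0 ph. Proof. exact: phit_nondecr. Qed.
Let p0 : ph 0 = 0. Proof. exact: phit0. Qed.
Let p1 : ph 1 = c. Proof. exact: phit1. Qed.
Let pL u : 0 <= u -> ph u <= c * u. Proof. by move=> _; exact: phit_lin. Qed.
Let pge u : 0 <= u -> 0 <= ph u. Proof. exact: phit_ge0. Qed.
Let theta_ge0 x y : 0 <= theta x y. Proof. by case: prem. Qed.

Lemma Op0 f x : good f -> Op P 0 f x = f x.
Proof.
move=> [mf bf]; rewrite /Op /Ex /Rintegral.
rewrite (@eq_measure_integral _ _ _ _ (dirac x)); last first.
  by move=> A mA _; case: mtf => _ h _; exact: h.
rewrite integral_dirac//; last exact/measurable_EFinP.
by rewrite diracT mul1e.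
Qed.

Lemma iter_Op h n f x : 0 <= h -> good f -> iter n (Op P h) f x = Op P (n%:R * h) f x.
Proof.
move=> h0 gf; elim: n x => [|n IH] x /=; first by rewrite mul0r Op0.
rewrite (_ : iter n (Op P h) f = Op P (n%:R * h) f); last by apply/funext.
rewrite (_ : n.+1%:R * h = h + n%:R * h); last by rewrite -natr1; ring.
by rewrite OpD// mulr_ge0.
Qed.

(** The coupling bound with [p = N = 1] and no error term. It turns a function that is Lipschitz for
    [rho1] into one that is Lipschitz for [dd] after any remainder time. *)
Lemma lip1_Op_theta f t x y : lip1 rho f -> 0 <= t ->
  `|Op P t f x - Op P t f y| <= Num.min ((r t + 2 * L t) * theta x y) 1.
Proof.
move=> lf tt0.
have gf := lip1_good rho polish f lf.
have [l fl] := lip1_range rho f lf.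
have H (g : E -> R) (l' : R) x' y' : measurable_fun setT g -> (forall u, l' <= g u <= l' + 1) ->
    (forall u v, g u - g v <= theta u v) ->
    Op P t g x' - Op P t g y' <= (r t + 2 * L t) * theta x' y'.
  move=> mg gl gth.
  have ic z : itg (P t z) (fun=> 0 : R) by exact: itg_cst.
  have := gen_coupling_bound P theta r L theta_ge0 asA t x' y' g (fun=> 0) 1 1 l' tt0 ltr01 ltr01
    mg gl (fun=> lexx 0) (ic x') (ic y').
  rewrite /Op !Ex_cst !mul1r !addr0; apply => u v; rewrite !addr0 mul1r; exact: gth.
have flt u v : `|f u - f v| <= theta u v by apply: le_trans (lf u v) (rho_theta u v).
have h1 := H f l x y gf.1 fl (fun u v => le_trans (ler_norm _) (flt u v)).
have mN : measurable_fun setT (fun u => - f u) by apply: measurable_funN; exact: gf.1.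
have h2 : - (Op P t f x - Op P t f y) <= (r t + 2 * L t) * theta x y.
  have EN z : Op P t (fun u => - f u) z = - Op P t f z by rewrite /Op ExN//; exact: good_itg.
  have := H (fun u => - f u) (- l - 1) x y mN _ _; rewrite !EN => hN.
  suff : - Op P t f x - - Op P t f y <= (r t + 2 * L t) * theta x y by lra.
  apply: hN => [u|u v]; first by have := fl u; lra.
  by apply: le_trans (flt u v); rewrite -opprD -normrN; exact: ler_norm.
have aE z : l <= Op P t f z <= l + 1 by exact: Op_range.
rewrite le_min !ler_norml; have := aE x; have := aE y => k1 k2.
by apply/andP; split; apply/andP; split; lra.
Qed.

(** Only [eta] and [C] depend on [delta]: the invariant measure is built with one exponent and the
    rate proved with another, for the same step [h] and weight [W]. *)
Lemma ergodic_setup : exists (h c0 K3 kappa : R) (W : E -> R),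
  [/\ 0 < h, 0 < c0, 0 <= K3 & 0 <= kappa] /\
  [/\ (forall x, 0 <= W x), (forall t x, 0 <= t -> itg (P t x) W),
      (forall t x, 0 <= t -> itg (P t x) (fun y => ph (W y))),
      (forall x, Op P h W x <= W x - c0 * ph (W x) + K3) &
      forall x, ph (W x) <= kappa * phi (V x)] /\
  (forall delta, 0 < delta < 1 -> exists eta C : R, [/\ 0 < eta, eta * c <= 1, 0 < C &
     forall f s m x y, lip1 rho f -> 0 <= s <= 2 * h ->
       `|Op P ((2 * m)%:R * h + s) f x - Op P ((2 * m)%:R * h + s) f y| <=
       C * (1 + ph (1 + (W x + W y))) `^ delta / rk ph eta m `^ delta]).
Proof.
have [[r_ge0 r_mono] rcv [L_ge0 L_bd] _] := asA.
have [Tt Tt0 rT] : exists2 Tt, 0 <= Tt & r Tt <= 1 / 4.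
  have q0 : 0 < 1 / 4 :> R by lra.
  have /cvgrPdist_le /(_ _ q0) [B [_ HB]] := rcv.
  have BT : B < Num.max B 0 + 1 by rewrite ltr_pwDr// le_max lexx.
  exists (Num.max B 0 + 1); first by rewrite addr_ge0// le_max lexx orbT.
  by have := HB _ BT; rewrite /= sub0r normrN; exact: le_trans (ler_norm _).
pose h := t0 + Tt.
have h0 : 0 < h by rewrite ltr_wpDr.
have h0' := ltW h0.
have rh : r h <= 1 / 4 by apply: le_trans rT; apply: r_mono => //; rewrite lerDr ltW.
have [Lb HLb] := L_bd (2 * h).
have Lb0 : 0 <= Lb.
  by apply: le_trans (L_ge0 0 (lexx 0)) _; apply: HLb; rewrite lexx mulr_ge0.
(* The term [8 * L h] gives [2 * L h <= N / 4], to be added to [N * r h <= N / 4]; the terms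
   [r 0 + 2 * Lb] bound [r s + 2 * L s] for remainder times [s <= 2 * h]. *)
pose N := 1 + 8 * L h + r 0 + 2 * Lb.
have Lh := L_ge0 h h0'; have r00 := r_ge0 0 (lexx 0).
have N1 : 1 <= N by rewrite /N; lra.
have N0 : 0 < N by lra.
have rh0 := r_ge0 h h0'.
have close_h : N * r h + 2 * L h <= N / 2.
  have := ler_wpM2l (ltW N0) rh; have : 8 * L h <= N by rewrite /N; lra.
  lra.
(* The discrete drift estimate bounds exactly the mean of this function after time [h]. *)
pose W x := V x + h * ph (V x).
have phV0 x : 0 <= ph (V x) by exact: pge.
have W0 x : 0 <= W x by rewrite addr_ge0// mulr_ge0.
have VW x : V x <= W x by rewrite lerDl mulr_ge0.
have iV t x : 0 <= t -> itg (P t x) V by exact: (V_itg P V phi K).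
have iphV t x : 0 <= t -> itg (P t x) (fun y => ph (V y)).
  by exact: (phV_itg P V phi K).
have iW t x : 0 <= t -> itg (P t x) W.
  by move=> tt; apply: itgD; [exact: iV | apply: itgZ; exact: iphV].
have mW : measurable_fun setT W by exact: itg_meas (iW 0 point (lexx 0)).
have mphW : measurable_fun setT (fun x => ph (W x)) by exact: (phit_comp_measurable phi).
have iphW t x : 0 <= t -> itg (P t x) (fun y => ph (W y)).
  move=> tt; apply: (itg_le _ _ (fun y => c * W y)) => //.
    by move=> y; rewrite ger0_norm ?pge// pL.
  by apply: itgZ; exact: iW.
pose K2 := K * h + c * K * h * h.
have K20 : 0 <= K2 by rewrite addr_ge0// !mulr_ge0// ltW.
(* Passing from [V] to [W] increases [ph] at most by this factor, so the drift [h * ph (V x)]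
   dominates [h / k1 * ph (W x)]. *)
pose k1 := 1 + c * h; have k10 : 0 < k1 by rewrite ltr_pwDl// mulr_ge0// ltW.
have phWV x : ph (W x) <= k1 * ph (V x).
  have := ph_lip _ c pC pN p0 pL (V x) (W x) (V0 x) (VW x); rewrite /W /k1; lra.
pose c0 := h / k1; have c00 : 0 < c0 by rewrite divr_gt0.
have drift x : Op P h W x <= W x - c0 * ph (W x) + K2.
  have -> : Op P h W x = Ex (P h x) V + h * Ex (P h x) (fun y => ph (V y)).
    by rewrite /Op ExD ?ExZ//; [exact: iphV | exact: iV | apply: itgZ; exact: iphV].
  have dd1 := discrete_drift P mtf V phi K mV V0 K0 phiC phi_ge0 phiN phioo phi0 lyap h x h0.
  have : c0 * ph (W x) <= h * ph (V x).
    rewrite /c0 -mulrA ler_pM2l// ler_pdivrMl//; exact: phWV.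
  by move: dd1; rewrite -/c -/ph -/K2 /W; lra.
(* The drift constants of the two points, plus [c0 * ph 1] for the summand [1] of the weight. *)
pose K1 := 2 * K2 + c0 * c.
have K10 : 0 <= K1 by rewrite addr_ge0// mulr_ge0// ltW.
(* Beyond [M], half of the drift absorbs [K1]. *)
have [M M1 HM] := phi_unbounded phi phioo (2 * K1 / c0).
have phM : K1 <= c0 / 2 * ph M.
  rewrite /ph phitE//; move: HM; rewrite ler_pdivrMr//; lra.
pose w x y := 1 + (W x + W y); pose w' x y := 1 + (Op P h W x + Op P h W y).
have w1 x y : 1 <= w x y by rewrite lerDl addr_ge0.
have phw x y : ph (w x y) <= c + ph (W x) + ph (W y).
  have := ph_subadd _ pC pN p0 1 (W x + W y) ler01 (addr_ge0 (W0 x) (W0 y)).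
  by have := ph_subadd _ pC pN p0 (W x) (W y) (W0 x) (W0 y); rewrite /w p1; lra.
have dr x y : w' x y <= w x y - c0 * ph (w x y) + K1.
  have := drift x; have := drift y; have := ler_wpM2l (ltW c00) (phw x y).
  by rewrite /w' /w /K1; lra.
have drift1 x y : w' x y <= w x y + K1.
  by have := dr x y; have := mulr_ge0 (ltW c00) (pge _ (le_trans ler01 (w1 x y))); lra.
have drift2 x y : M < w x y -> w' x y <= w x y - c0 / 2 * ph (w x y).
  move=> Mw; have := dr x y.
  have := ler_wpM2l (ltW (half_gt0 _ c00)) (pN _ _ (le_trans ler01 M1) (ltW Mw)); lra.
have rT0 := r_ge0 Tt Tt0; have LT0 := L_ge0 Tt Tt0.
pose sT := N * r Tt + 2 * L Tt.
have sT0 : 0 <= sT by rewrite addr_ge0// mulr_ge0// ltW.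
pose eps := (1 / 2) / (sT + 1).
have sT1 : 0 < sT + 1 by lra.
have eps0 : 0 < eps by rewrite divr_gt0//; lra.
have epsT : sT * eps <= 1 / 2.
  rewrite /eps mulrA ler_pdivrMr// ; lra.
have M0 : 0 < M by lra.
have [Dset [mD [cD cD0 hD] thD]] := asB M M0 eps eps0.
pose gam := Num.min (1 / 2) (cD / 2).
have gam0 : 0 < gam <= 1 / 2 by rewrite lt_min half_gt0//= ?ge_min ?lexx ?andbT//; lra.
have gamE : gam <= 1 / 2 /\ gam <= cD / 2 by rewrite !ge_min !lexx orbT.
exists h, c0, K2, k1, W; split; first by split => //; exact: ltW.
split.
  split => // x; apply: le_trans (phWV x) _; rewrite ler_pM2l//; exact: phit_le.
move=> delta dl.
have dth01 := dd01 theta theta_ge0 N N0.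
have dd0 x y : dd theta N x y = 0 -> x = y.
  case: prem => _ _ th0; rewrite /dd; case: leP => _ h1; last by move: (oner_neq0 R); rewrite h1 eqxx.
  by apply/th0; move/eqP: h1; rewrite mulf_eq0 (gt_eqF N0) => /eqP.
have nearH f p s q x y : good f -> 0 < p -> 0 <= s -> 0 <= q ->
   (forall u v, `|f u - f v| <= p * dd theta N u v + s + q * (W u + W v)) ->
   `|Op P h f x - Op P h f y| <= p * dd theta N x y + s + q * (Op P h W x + Op P h W y) /\
   (1 + (W x + W y) <= M ->
      `|Op P h f x - Op P h f y| <= p * ((1 - gam) * dd theta N x y) + s + q * (Op P h W x + Op P h W y)).
  move=> gf pp s0 q0 fB.
  have [n1 n2] := contr_near P mtf theta r L theta_ge0 asA V W N Tt t0 gam M eps cD Dset N0 Tt0 t00 close_h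
    W0 iW mD cD0 hD thD epsT sT0 gamE f p s q x y gf pp s0 q0 fB.
  split => // wM; apply: n2.
    by have := VW x; have := W0 y; lra.
  by have := VW y; have := W0 x; lra.
have farH f s q x y := contr_far P mtf theta r L theta_ge0 asA V W N Tt t0 gam M eps cD Dset N0 Tt0 t00 close_h
    W0 iW mD cD0 hD thD epsT sT0 gamE f s q x y.
have QW0 x : 0 <= Op P h W x by exact: Ex_ge0.
have [eta [C [e1 e2 e3 HR]]] := rate ph c pC pN p0 p1 cp pL (Op P h) good (dd theta N) W (Op P h W)
  M gam c0 K1 (fun f gf => Op_good P mtf h f h0' gf) dth01 dd0 W0 QW0 farH nearH gam0 c00 K10 M1 drift1 drift2 delta dl.
exists eta, C; split => // f s m x y lf /andP[s0 sh].
have gf := lip1_good rho polish f lf.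
have gs : good (Op P s f) by exact: Op_good.
have lds u v : `|Op P s f u - Op P s f v| <= dd theta N u v.
  apply: le_trans (lip1_Op_theta f s u v lf s0) _; rewrite /dd le_min !ge_min lexx orbT andbT.
  apply/orP; left; rewrite ler_wpM2r//.
  have := HLb s; rewrite s0 sh => /(_ isT); have := r_mono 0 s (lexx 0) s0; rewrite /N; lra.
have := HR (Op P s f) m x y gs lds.
by rewrite !iter_Op// -!(OpD P mtf) ?mulr_ge0//; rewrite ?addnn -?mul2n.
Qed.

End Setup.

(** * The discrete rate and the inverse of [Hphi] *)

Section RateCvg.
Context {R : realType}.
Variables (phi : R -> R).
Hypotheses (phiC : concave0 phi) (phi_ge0 : forall u, 0 <= u -> 0 <= phi u) (phiN : nondecr0 phi)
  (phioo : phi u @[u --> +oo] --> +oo) (phi0 : phi 0 = 0).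
Let c := phi 1.
Let ph := phit phi.
Let cp : 0 < c. Proof. exact: phi1_gt0. Qed.
Let pC : concave0 ph. Proof. exact: phit_concave. Qed.
Let pN : nondecr0 ph. Proof. exact: phit_nondecr. Qed.
Let p0 : ph 0 = 0. Proof. exact: phit0. Qed.
Let p1 : ph 1 = c. Proof. exact: phit1. Qed.
Let pL u : 0 <= u -> ph u <= c * u. Proof. by move=> _; exact: phit_lin. Qed.
Variable eta : R.
Hypotheses (eta0 : 0 < eta) (etac : eta * c <= 1).

Lemma rk_powR_cvg (delta : R) : 0 < delta -> (rk ph eta k `^ delta)^-1 @[k --> \oo] --> 0.
Proof.
move=> d0; apply/cvgrPdist_le => e e0.
have [u u1 Hu] := phi_unbounded phi phioo (e^-1 `^ delta^-1).
have ec : 0 < eta * c by rewrite mulr_gt0.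
have [k [k0 Hk]] := inv_natr_small (eta * c / u) (divr_gt0 ec ltac:(by apply: lt_le_trans u1)).
exists k => // n /= kn; rewrite sub0r normrN ger0_norm ?invr_ge0 ?powR_ge0//.
have rn := rk_gt0 ph c pN p0 p1 cp eta eta0 n.
rewrite invf_ple ?posrE ?powR_gt0//.
have e10 : 0 <= e^-1 by rewrite invr_ge0 ltW.
have -> : e^-1 = (e^-1 `^ delta^-1) `^ delta by rewrite -powRrM mulVf ?lt0r_neq0// powRr1.
apply: ge0_ler_powR; rewrite ?nnegrE ?(ltW d0) ?powR_ge0 ?(ltW rn)//.
apply: (le_trans Hu); rewrite -(phitE phi phiC phi0 u u1); apply: pN; first by apply: le_trans u1.
have := zk_linear ph c pN p0 p1 eta eta0 n; apply: le_trans.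
have u0 : 0 < u by apply: lt_le_trans u1.
move: Hk; rewrite ler_pdivlMr// ler_pdivrMl ?ltr0n// => Hk.
apply: (le_trans Hk); rewrite mulrC -[X in X <= _]add0r; apply: lerD => //.
by rewrite ler_pM2l// ler_nat.
Qed.

(** One step of the flow adds at least [eta * rk m / rk m.+1] to [Hphi], and this is at least
    [eta / 2] because [rk] at most doubles. *)
Lemma Hphi_zk m : ((eta / 2 * m%:R)%:E <= Hphi phi (zk ph eta m))%E.
Proof.
elim: m => [|m IH]; first by rewrite mulr0; apply: integral_ge0 => u /= /andP[u1 _]; rewrite lee_fin invr_ge0 phi_ge0//; lra.
have z1 := zk_ge1 ph pN p0 eta eta0 m; have zz := zk_le ph pN p0 eta eta0 m.
have zS1 := zk_ge1 ph pN p0 eta eta0 m.+1.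
apply: le_trans (Hphi_incr phi phiC phi_ge0 phiN phioo phi0 _ _ z1 zz).
rewrite -(natr1 m) mulrDr mulr1 EFinD; apply: leeD => //; rewrite lee_fin.
rewrite -(phitE phi phiC phi0 _ zS1).
rewrite (_ : zk ph eta m.+1 - zk ph eta m = eta * rk ph eta m); last by rewrite zkS; ring.
rewrite -[phit phi (zk ph eta m.+1)]/(rk ph eta m.+1).
have r0 := rk_gt0 ph c pN p0 p1 cp eta eta0 m; have r1 := rk_gt0 ph c pN p0 p1 cp eta eta0 m.+1.
rewrite ler_pdivlMr//.
have g := rk_growth ph c pC pN p0 pL eta eta0 m.
have : rk ph eta m.+1 <= 2 * rk ph eta m by have := ler_wpM2r (ltW r0) etac; lra.
by move=> /(ler_wpM2l (ltW (half_gt0 _ eta0))); lra.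
Qed.

(** Strict growth of [Hphi] places its inverse value [u] below [zk m.+1]; the factor [2] pays for
    the extra index. *)
Lemma Hphi_inv_le u m t C2 : 1 <= u -> Hphi phi u = (C2 * t)%:E ->
  C2 * t <= eta / 2 * m.+1%:R -> phi u <= 2 * rk ph eta m.
Proof.
move=> u1 Hu Cle.
have zS1 := zk_ge1 ph pN p0 eta eta0 m.+1.
have uz : u <= zk ph eta m.+1.
  rewrite leNgt; apply/negP => zu.
  have := Hphi_incr phi phiC phi_ge0 phiN phioo phi0 _ _ zS1 (ltW zu).
  have pu : 0 < phi u by apply: lt_le_trans cp _; exact: phiN.
  have : ((eta / 2 * m.+1%:R)%:E + ((u - zk ph eta m.+1) / phi u)%:E <=
     Hphi phi (zk ph eta m.+1) + ((u - zk ph eta m.+1) / phi u)%:E)%E.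
    by apply: leeD => //; exact: Hphi_zk.
  move=> h1 /(le_trans h1); rewrite Hu -EFinD lee_fin.
  have : 0 < (u - zk ph eta m.+1) / phi u by rewrite divr_gt0// subr_gt0.
  lra.
apply: (@le_trans _ _ (rk ph eta m.+1)).
  by rewrite -(phitE phi phiC phi0 u u1); apply: pN => //; exact: le_trans u1.
have r0 := rk_gt0 ph c pN p0 p1 cp eta eta0 m.
have g := rk_growth ph c pC pN p0 pL eta eta0 m.
have := ler_wpM2r (ltW r0) etac; lra.
Qed.

End RateCvg.

Lemma powR_1D (R : realType) (v delta : R) : 0 <= v -> 0 < delta < 1 ->
  (1 + v) `^ delta <= 2 * (1 + v `^ delta).
Proof.
move=> v0 /andP[d0 d1].
have two b : 1 <= b -> b `^ delta <= b :> R.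
  move=> b1; rewrite -[X in _ <= X]powRr1; last by lra.
  by apply: ler_powR => //; exact: ltW.
have vp := powR_ge0 v delta.
have [v1|v1] := leP v 1.
  apply: (@le_trans _ _ (1 + v)); first by apply: two; lra.
  lra.
apply: (@le_trans _ _ ((2 * v) `^ delta)).
  by apply: ge0_ler_powR; rewrite ?nnegrE ?(ltW d0)//; lra.
rewrite powRM//; have := two 2 ltac:(lra) => h2.
have := ler_wpM2r vp h2; lra.
Qed.

Theorem theorem2p7 (R : realType) (d : measure_display) (E : measurableType d)
  (rho : E -> E -> R) (P : R -> E -> probability E R)
  (V : E -> R) (phi : R -> R) (K : R) (theta : E -> E -> R) (r L : R -> R) (t0 : R) :
  polish_borel rho ->
  markov_tf P ->
  feller rho P ->
  (* (1) Lyapunov condition *)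
  measurable_fun setT V -> (forall x, 0 <= V x) ->
  (forall a b l, 0 <= a -> 0 <= b -> 0 <= l <= 1 ->
     l * phi a + (1 - l) * phi b <= phi (l * a + (1 - l) * b)) ->
  (forall u, 0 < u -> derivable phi u 1) ->
  (forall u, 0 <= u -> 0 <= phi u) ->
  (forall a b, 0 <= a -> a <= b -> phi a <= phi b) ->
  phi u @[u --> +oo] --> +oo ->
  phi 0 = 0 ->
  0 < K ->
  (forall t x, 0 <= t ->
     (\int[P t x]_y (V y)%:E
      + \int[@lebesgue_measure R]_(s in [set s : R | (0 <= s <= t)%R])
            (\int[P s x]_y (phi (V y))%:E)
      <= (V x + K * t)%:E)%E) ->
  (* (2) *)
  premetric rho theta ->
  (forall x y, Num.min (rho x y) 1 <= theta x y) ->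
  (* (3) *)
  assumptionA P theta r L ->
  (* (4) *)
  0 < t0 ->
  (forall M : R, 0 < M -> assumptionB1 P theta [set x | V x <= M] t0) ->
  exists pi : probability E R,
    [/\ invariant_prob P pi,
        (forall mu : probability E R, invariant_prob P mu ->
           forall A, measurable A -> mu A = pi A) &
        (forall delta : R, 0 < delta < 1 ->
           exists C1 C2 : R, [/\ 0 < C1, 0 < C2 &
             forall (x : E) (t u : R), 0 <= t -> 1 <= u -> Hphi phi u = (C2 * t)%:E ->
               (wasserstein (fun a b => Num.min (rho a b) 1%R) (P t x) pi
                 <= ((C1 * (1 + phi (V x) `^ delta) / phi u `^ delta)%R)%:E)%E])].
Proof.
move=> polish mtf fel mV V0 phiC _ phi_ge0 phiN phioo phi0 K0 lyap prem rho_theta asA t00 asB.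
have [h [c0 [K3 [kappa [W [[h0 c00 K30 kap0] [[W0 iW iphW drift phWV] rates]]]]]]] :=
  ergodic_setup rho P V phi K theta r L t0 polish mtf mV V0 phiC phi_ge0 phiN phioo phi0 K0 lyap
    prem rho_theta asA t00 asB.
set ph := phit phi in iphW drift phWV rates; set c := phi 1 in rates.
have cp : 0 < c by exact: phi1_gt0.
have pC : concave0 ph by exact: phit_concave.
have pN : nondecr0 ph by exact: phit_nondecr.
have p0 : ph 0 = 0 by exact: phit0.
have p1 : ph 1 = c by exact: phit1.
have phW0 x : 0 <= ph (W x) by exact: phit_ge0.
have h0' := ltW h0.
have phw x y : 1 + ph (1 + (W x + W y)) <= 1 + c + ph (W x) + ph (W y).
  have := ph_subadd _ pC pN p0 1 (W x + W y) ler01 (addr_ge0 (W0 x) (W0 y)).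
  by have := ph_subadd _ pC pN p0 (W x) (W y) (W0 x) (W0 y); rewrite p1; lra.
have phw0 x y : 0 <= ph (1 + (W x + W y)) by apply: phit_ge0 => //; rewrite addr_ge0// addr_ge0.
have le_self (delta b : R) : delta <= 1 -> 1 <= b -> b `^ delta <= b.
  by move=> d1 b1; rewrite -[X in _ <= X]powRr1 ?ler_powR//; lra.
(* Any exponent will do to construct the invariant measure, as the power of a number at least [1] is
   then bounded by the number itself. *)
have half01 : 0 < (1 / 2 : R) < 1 by lra.
have [eta1 [D1 [eta10 eta1c D10 rate1]]] := rates _ half01.
pose eps k := D1 * (1 + c) * (rk ph eta1 k `^ (1 / 2))^-1.
have rk0 eta k : 0 < eta -> 0 < rk ph eta k by move=> e0; exact: (rk_gt0 ph c).
have eps_ge0 k : 0 <= eps k by rewrite !mulr_ge0 ?invr_ge0 ?powR_ge0 ?(ltW D10)//; lra.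
have epscv : eps k @[k --> \oo] --> 0.
  rewrite -(mulr0 (D1 * (1 + c))); apply: cvgMr.
  by apply: (rk_powR_cvg phi) => //; lra.
have osc f k x y : lip1 rho f ->
    `|Op P ((2 * k)%:R * h) f x - Op P ((2 * k)%:R * h) f y| <= eps k * (1 + ph (W x) + ph (W y)).
  move=> lf; have s0 : 0 <= (0 : R) <= 2 * h by apply/andP; split => //; rewrite mulr_ge0.
  have := rate1 f 0 k x y lf s0; rewrite !addr0 => hr; apply: (le_trans hr).
  rewrite /eps -[X in _ <= X]mulrA [X in _ <= _ * X]mulrC mulrA ler_wpM2r ?invr_ge0 ?powR_ge0//.
  rewrite -mulrA ler_pM2l//; apply: (@le_trans _ _ (1 + ph (1 + (W x + W y)))).
    by apply: le_self; [lra | have := phw0 x y; lra].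
  apply: le_trans (phw x y) _.
  by have := mulr_ge0 (ltW cp) (addr_ge0 (phW0 x) (phW0 y)); lra.
have [pi [ipi pw]] := invariant_measure rho polish P mtf fel h c0 K3 W (fun y => ph (W y)) eps
  h0 c00 W0 iW iphW drift eps_ge0 epscv osc.
exists pi; split => //.
  move=> mu imu; exact: (invariant_unique rho polish P mtf h h0 pi mu pw imu).
move=> delta dl; have /andP[dl0 dl1] := dl.
have [eta [C [eta0 etac C0 rate2]]] := rates _ dl.
have [ipw _] := invariant_moment P mtf h c0 K3 W (fun y => ph (W y)) h0 c00 K30 W0 phW0 iW iphW drift pi ipi.
set Pi := Ex pi (fun y => ph (W y)).
have Pi0 : 0 <= Pi by exact: Ex_ge0.
(* This absorbs [1 + c + ph (W x)] into [kp * (1 + phi (V x))]. In [C1], one factor [2] comes from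
   splitting the power of [1 + phi (V x)], the other from the comparison of [phi u] with [rk m], and
   [1 + Pi] from integration over the second point. *)
pose kp := 1 + c + kappa; have kp1 : 1 <= kp by rewrite /kp; lra.
pose C1 := 4 * C * kp * (1 + Pi).
have C10 : 0 < C1 by rewrite /C1 !mulr_gt0//; lra.
(* An index [m] takes time [2 * h] and adds at least [eta / 2] to [Hphi]. *)
pose C2 := eta / (4 * h).
have C20 : 0 < C2 by rewrite divr_gt0// mulr_gt0.
exists C1, C2; split => // x t u tt u1 Hu.
apply: (wasserstein_le_dual rho polish) => f lf.
pose m := Num.truncn (t / (2 * h)).
have h20 : 0 < 2 * h by rewrite mulr_gt0.
have th0 : 0 <= t / (2 * h) by rewrite divr_ge0// ltW.
have /andP[m1 m2] : m%:R <= t / (2 * h) < m.+1%:R by exact: truncn_itv.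
pose s := t - (2 * m)%:R * h.
have mt : (2 * m)%:R * h <= t by move: m1; rewrite ler_pdivlMr// natrM; lra.
have tm : t < m.+1%:R * (2 * h) by move: m2; rewrite ltr_pdivrMr.
have s0h : 0 <= s <= 2 * h.
  rewrite /s subr_ge0 mt /=; move: tm; rewrite -(natr1 m) natrM; lra.
have tE : t = (2 * m)%:R * h + s by rewrite /s; ring.
have gf := lip1_good rho polish f lf.
have gt : good (Op P t f) by exact: Op_good.
have rm0 := rk0 eta m eta0.
have rmd : 0 < rk ph eta m `^ delta by rewrite powR_gt0.
pose A := C * kp * (2 * (1 + phi (V x) `^ delta)) / rk ph eta m `^ delta.
have A0 : 0 <= A.
  rewrite /A !mulr_ge0 ?invr_ge0 ?powR_ge0 ?(ltW C0)//; first lra.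
  by rewrite addr_ge0// powR_ge0.
have pV0 : 0 <= phi (V x) by exact: phi_ge0.
(* Bounding the sum of the weights by a product separates the two points: the power [delta] is kept
   on the factor of [x], and dropped on that of [y], where the first moment under [pi] is at
   hand. *)
have key y : `|Op P t f x - Op P t f y| <= A * (1 + ph (W y)).
  rewrite tE; apply: le_trans (rate2 f s m x y lf s0h) _.
  rewrite /A [X in _ <= X]mulrAC ler_pM2r ?invr_gt0// -!mulrA ler_pM2l//.
  apply: (@le_trans _ _ ((kp * (1 + phi (V x)) * (1 + ph (W y))) `^ delta)).
    have b2 := phWV x; have b3 := phW0 y.
    have b5 : 1 + c + ph (W x) <= kp * (1 + phi (V x)).
      have := mulr_ge0 (ltW cp) pV0; rewrite /kp; lra.
    have b6 : 1 + c + ph (W x) + ph (W y) <= kp * (1 + phi (V x)) * (1 + ph (W y)).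
      rewrite mulrDr mulr1 lerD// ler_peMl//.
      by rewrite -[X in X <= _]mulr1 ler_pM// lerDl.
    have b7 : 0 <= 1 + ph (1 + (W x + W y)) by exact: addr_ge0.
    have b8 := le_trans (phw x y) b6.
    by apply: ge0_ler_powR; rewrite ?nnegrE ?(ltW dl0)//; exact: le_trans b7 b8.
  have q1 : 0 <= kp by exact: le_trans ler01 kp1.
  have q2 : 0 <= 1 + phi (V x) by exact: addr_ge0.
  have q3 : 1 <= 1 + ph (W y) by rewrite lerDl.
  rewrite powRM ?mulr_ge0//; last exact: le_trans ler01 q3.
  rewrite (powRM _ q1 q2) -mulrA; apply: ler_pM; rewrite ?mulr_ge0 ?powR_ge0//.
    by apply: le_self => //; exact: ltW.
  rewrite [X in _ <= X]mulrA; apply: ler_pM; rewrite ?powR_ge0//; first exact: powR_1D.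
  by apply: le_self => //; exact: ltW.
have iy : itg pi (fun y => A * (1 + ph (W y))) by apply: itgZ; apply: itgD => //; exact: itg_cst.
have igt : itg pi (Op P t f) by exact: good_itg.
have EA : Ex pi (fun y => A * (1 + ph (W y))) = A * (1 + Pi).
  by rewrite ExZ ?ExD ?Ex_cst//; [exact: itg_cst | apply: itgD => //; exact: itg_cst].
have : Op P t f x - Ex pi f <= A * (1 + Pi).
  rewrite -EA -(inv_Op P mtf pi t f ipi tt gf) -[X in X - _](Ex_cst pi) -ExB//; last exact: itg_cst.
  apply: Ex_le => //; first by apply: itgB => //; exact: itg_cst.
  by move=> y; apply: le_trans (ler_norm _) (key y).
have phu : phi u <= 2 * rk ph eta m.
  apply: (Hphi_inv_le phi phiC phi_ge0 phiN phioo phi0 eta eta0 etac u m t C2 u1 Hu).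
  rewrite /C2 mulrAC ler_pdivrMr ?mulr_gt0//.
  by have := ler_wpM2l (ltW eta0) (ltW tm); lra.
have pu0 : 0 < phi u by apply: lt_le_trans cp _; exact: phiN.
have pud : 0 < phi u `^ delta by rewrite powR_gt0.
have phud : phi u `^ delta <= 2 * rk ph eta m `^ delta.
  apply: (@le_trans _ _ ((2 * rk ph eta m) `^ delta)).
    by apply: ge0_ler_powR; rewrite ?nnegrE ?(ltW dl0) ?(ltW pu0) ?mulr_ge0 ?(ltW rm0).
  by rewrite powRM ?(ltW rm0)// ler_pM2r//; apply: le_self; [exact: ltW | rewrite ler1n].
have AC : A * (1 + Pi) <= C1 * (1 + phi (V x) `^ delta) / phi u `^ delta.
  rewrite /A /C1; set v := 1 + phi (V x) `^ delta.
  have v0 : 0 <= v by rewrite addr_ge0// powR_ge0.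
  have inv : (rk ph eta m `^ delta)^-1 <= 2 / phi u `^ delta.
    by rewrite ler_pdivlMr// ler_pdivrMl// mulrC.
  have q : 0 <= C * kp * (2 * v) * (1 + Pi).
    have kp0 : 0 <= kp by exact: le_trans ler01 kp1.
    by rewrite !mulr_ge0 ?(ltW C0)// addr_ge0.
  have := ler_wpM2l q inv; rewrite mulrAC => /le_trans; apply.
  by rewrite le_eqVlt; apply/orP; left; apply/eqP; ring.
by move=> /le_trans/(_ AC); rewrite /Op lerBlDl.
Qed.
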